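(* Let $\mathcal A=\sum_{n\ge0}\mathcal A_n^{FC}(q)x^n$, $\mathcal B=\sum_{n\ge0}\mathcal B_n^{FC}(q)x^n$, $\mathcal D=\sum_{n\ge0}\mathcal D_{n+1}^{FC}(q)x^n$. Let $$\mathcal J(x)=\sum_{n\ge0}\frac{(-1)^{\lceil n/2\rceil}x^nq^{\binom n2}}{(q^2;q^2)_{\lfloor n/2\rfloor}},\qquad \mathcal K(x)=\sum_{n\ge0}x^nq^{\binom{n+1}2}\sum_{k=0}^{\lfloor n/2\rfloor}\frac{(-1)^k}{(q^2;q^2)_k},$$ and let $\mathcal K_e(x)=\frac12(\mathcal K(x)+\mathcal K(-x))$. Then $$\mathcal A=\frac{\mathcal J(-xq)}{\mathcal J(x)},\qquad \mathcal B=\frac{\mathcal K(x)}{\mathcal J(x)}+\frac{xq^2(1-x)}{1-xq^2}\frac{\mathcal J(-xq)}{\mathcal J(x)}-\frac{xq^2}{1-xq^2},$$ $$\mathcal D=\frac{2xq\,\mathcal K_e(xq)}{\mathcal J(x)}+\frac{q+x(1-q)-x^2q^2}{1-xq^2}\frac{\mathcal J(-xq)}{\mathcal J(x)}-\frac{q}{1-xq^2}+1.$$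
   Context: For a Coxeter system $(W,S)$, $\ell$ is the Coxeter length; $w$ is fully commutative (fc) if any reduced expression of $w$ can be obtained from any other using only commutation relations $st=ts$ ($m_{st}=2$). An fc involution is an fc $w$ with $w^2=1$ (identity included), and $\mathcal W^{FC}(q)=\sum_w q^{\ell(w)}$ over fc involutions of $W$. $A_n,B_n,D_n$ are the classical finite Coxeter groups with $n$ generators; conventions: $A_0=B_0$ trivial, $B_1=A_1$, $\mathcal D_1^{FC}(q)=1$, $\mathcal D_2^{FC}(q)=(1+q)^2$. Notation $(a;q^2)_n=(1-a)(1-aq^2)\cdots(1-aq^{2n-2})$. *)

(* Defs.v *)
From HB Require Import structures.
From mathcomp Require Import all_boot all_order all_algebra finmap.
From mathcomp Require Import generic_quotient.
From mathcomp Require Import boolp classical_sets cardinality.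

Set Implicit Arguments.
Unset Strict Implicit.
Unset Printing Implicit Defensive.

Import GRing.Theory.

Local Open Scope quotient_scope.

Section FormalPowerSeries.
Local Open Scope ring_scope.

Record fps (R : Type) := Fps { fps_coef : nat -> R }.

Lemma fpsP (R : Type) (f g : fps R) : fps_coef f =1 fps_coef g -> f = g.
Proof. by case: f g => [f] [g] /= /funext ->. Qed.

HB.instance Definition _ (R : Type) := gen_eqMixin (fps R).
HB.instance Definition _ (R : Type) := gen_choiceMixin (fps R).

Section Zmod.
Variable R : zmodType.
Implicit Types f g h : fps R.

Definition fps_zero : fps R := Fps (fun=> 0).
Definition fps_opp f : fps R := Fps (fun n => - fps_coef f n).
Definition fps_add f g : fps R := Fps (fun n => fps_coef f n + fps_coef g n).

Fact fps_addA : associative fps_add.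
Proof. by move=> f g h; apply: fpsP => n /=; rewrite addrA. Qed.
Fact fps_addC : commutative fps_add.
Proof. by move=> f g; apply: fpsP => n /=; rewrite addrC. Qed.
Fact fps_add0 : left_id fps_zero fps_add.
Proof. by move=> f; apply: fpsP => n /=; rewrite add0r. Qed.
Fact fps_addN : left_inverse fps_zero fps_opp fps_add.
Proof. by move=> f; apply: fpsP => n /=; rewrite addNr. Qed.

HB.instance Definition _ :=
  GRing.isZmodule.Build (fps R) fps_addA fps_addC fps_add0 fps_addN.
End Zmod.

Section ComRing.
Variable R : comNzRingType.
Implicit Types f g h : fps R.

Definition fps_one : fps R := Fps (fun n => (n == 0%N)%:R).
Definition fps_mul f g : fps R :=
  Fps (fun n => \sum_(i < n.+1) fps_coef f i * fps_coef g (n - i)).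

Let trunc n f : {poly R} := \poly_(i < n.+1) fps_coef f i.

Let trunc_mul n f g i : (i <= n)%N ->
  fps_coef (fps_mul f g) i = (trunc n f * trunc n g)`_i.
Proof.
move=> le_in; rewrite coefM; apply: eq_bigr => j _; rewrite !coef_poly.
have le_jn : (j < n.+1)%N by apply: leq_trans (ltn_ord j) _.
by rewrite le_jn ltnS (leq_trans (leq_subr _ _) le_in).
Qed.

Fact fps_mulA : associative fps_mul.
Proof.
move=> f g h; apply: fpsP => n.
transitivity ((trunc n f * (trunc n g * trunc n h))`_n).
  rewrite coefM; apply: eq_bigr => i _.
  by rewrite (trunc_mul _ _ (leq_subr i n)) coef_poly ltn_ord.
rewrite mulrA coefM; apply: eq_bigr => i _.
rewrite -trunc_mul; last by rewrite -ltnS.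
by rewrite coef_poly ltnS leq_subr.
Qed.
Fact fps_mulC : commutative fps_mul.
Proof.
by move=> f g; apply: fpsP => n; rewrite !(@trunc_mul n) // mulrC.
Qed.
Fact fps_mul1 : left_id fps_one fps_mul.
Proof.
move=> f; apply: fpsP => n /=; rewrite big_ord_recl /= mul1r subn0.
by rewrite big1 ?addr0 // => i _; rewrite mul0r.
Qed.
Fact fps_mulD : left_distributive fps_mul (@fps_add R).
Proof.
move=> f g h; apply: fpsP => n /=; rewrite -big_split /=.
by apply: eq_bigr => i _; rewrite mulrDl.
Qed.
Fact fps_one_neq0 : fps_one != 0.
Proof.
by apply/eqP => /(congr1 (fun f => fps_coef f 0))/eqP /=; rewrite oner_eq0.
Qed.

HB.instance Definition _ := GRing.Zmodule_isComNzRing.Build (fps R)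
  fps_mulA fps_mulC fps_mul1 fps_mulD fps_one_neq0.

Definition fpsC (c : R) : fps R := Fps (fun n => if n == 0%N then c else 0).
Definition fpsX : fps R := Fps (fun n => (n == 1%N)%:R).

(* The series f(c * X). *)
Definition fps_dilate (c : R) (f : fps R) : fps R :=
  Fps (fun n => c ^+ n * fps_coef f n).
End ComRing.

Section UnitRing.
Variable R : comUnitRingType.
Implicit Types f g : fps R.

Definition fps_unit : {pred fps R} :=
  [pred f : fps R | fps_coef f 0 \is a GRing.unit].

Fixpoint fps_inv_seq f n : seq R :=
  if n is k.+1 then
    let s := fps_inv_seq f k in
    rcons s (((k == 0%N)%:R - \sum_(i < k) fps_coef f (k - i) * s`_i)
             / fps_coef f 0)
  else [::].

Definition fps_inv f : fps R :=
  if f \in fps_unit then Fps (fun n => (fps_inv_seq f n.+1)`_n) else f.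

Let size_inv_seq f n : size (fps_inv_seq f n) = n.
Proof. by elim: n => //= n IHn; rewrite size_rcons IHn. Qed.

Let nth_inv_seq f n i : (i < n)%N ->
  (fps_inv_seq f n)`_i = (fps_inv_seq f i.+1)`_i.
Proof.
elim: n => // n IHn; rewrite ltnS leq_eqVlt => /predU1P[-> // | lt_in].
by rewrite [LHS]/= nth_rcons size_inv_seq lt_in IHn.
Qed.

Fact fps_mulV : {in fps_unit, left_inverse 1 fps_inv *%R}.
Proof.
move=> f uf; apply: fpsP => n; rewrite /= /fps_inv uf /= big_ord_recr /=.
rewrite subnn nth_rcons size_inv_seq ltnn eqxx divrK // addrC.
rewrite -addrA -[RHS]addr0; congr (_ + _).
apply/eqP; rewrite addrC subr_eq0; apply/eqP.
by apply: eq_bigr => i _; rewrite mulrC (nth_inv_seq _ (ltn_ord i)).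
Qed.
Fact fps_unitPl f g : g * f = 1 -> f \in fps_unit.
Proof.
move/(congr1 (fun h => fps_coef h 0)); rewrite /= big_ord1 => /= gf1.
by rewrite inE; apply/unitrPr; exists (fps_coef g 0); rewrite mulrC.
Qed.
Fact fps_inv_out : {in [predC fps_unit], fps_inv =1 id}.
Proof. by move=> f; rewrite inE /= /fps_inv => /negbTE->. Qed.

HB.instance Definition _ := GRing.ComNzRing_hasMulInverse.Build (fps R)
  fps_mulV fps_unitPl fps_inv_out.

Lemma fps_unitE f :
  (f \is a GRing.unit) = (fps_coef f 0 \is a GRing.unit).
Proof. by []. Qed.
End UnitRing.

End FormalPowerSeries.

(* The entry 0 stands for infinity. *)
Record coxeter_matrix (I : finType) := CoxeterMatrix {
  cox_m :> I -> I -> nat;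
  cox_m_diag : forall s, cox_m s s = 1;
  cox_m_sym : forall s t, cox_m s t = cox_m t s;
  cox_m_off : forall s t, s != t -> cox_m s t != 1
}.

Section CoxeterGroup.
Variables (I : finType) (M : coxeter_matrix I).
Implicit Types (s t : I) (u v : seq I).

(* The congruence on words generated by (s t)^(m s t) = 1; when s = t this is
   s s = 1, and when m s t = 0 it is void. *)
Inductive cox_cong : seq I -> seq I -> Prop :=
| cox_cong_refl u : cox_cong u u
| cox_cong_sym u v : cox_cong u v -> cox_cong v u
| cox_cong_trans v u u' : cox_cong u v -> cox_cong v u' -> cox_cong u u'
| cox_cong_rel u v s t :
    cox_cong (u ++ flatten (nseq (M s t) [:: s; t]) ++ v) (u ++ v).

Definition cox_rel : rel (seq I) := fun u v => `[< cox_cong u v >].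

Fact cox_rel_refl : reflexive cox_rel.
Proof. by move=> u; apply/asboolP; apply: cox_cong_refl. Qed.
Fact cox_rel_sym : ssrbool.symmetric cox_rel.
Proof. by move=> u v; apply/asboolP/asboolP; apply: cox_cong_sym. Qed.
Fact cox_rel_trans : ssrbool.transitive cox_rel.
Proof.
by move=> v u u' /asboolP uv /asboolP vu'; apply/asboolP;
  apply: cox_cong_trans uv vu'.
Qed.

Canonical cox_equiv := EquivRel cox_rel cox_rel_refl cox_rel_sym cox_rel_trans.

Definition cox_group := {eq_quot cox_equiv}.
HB.instance Definition _ := Choice.on cox_group.
HB.instance Definition _ := EqQuotient.on cox_group.

Definition cox_class (u : seq I) : cox_group := \pi_cox_group u.

Lemma cox_classP u v : cox_class u = cox_class v <-> cox_cong u v.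
Proof.
by split=> [/eqquotP/asboolP // | uv]; apply/eqquotP/asboolP.
Qed.

Lemma cox_classK (w : cox_group) : cox_class (repr w) = w.
Proof. exact: reprK. Qed.

Lemma cox_cong_cat u u' v v' :
  cox_cong u u' -> cox_cong v v' -> cox_cong (u ++ v) (u' ++ v').
Proof.
move=> uu' vv'; apply: (@cox_cong_trans (u' ++ v)).
  elim: uu' => {u u'} [u|u u' _ IH|x u u' _ IH1 _ IH2|a b s t].
  - exact: cox_cong_refl.
  - exact: cox_cong_sym.
  - exact: cox_cong_trans IH1 IH2.
  - by rewrite -!catA; apply: cox_cong_rel.
elim: vv' => {v v'} [v|v v' _ IH|x v v' _ IH1 _ IH2|a b s t].
- exact: cox_cong_refl.
- exact: cox_cong_sym.
- exact: cox_cong_trans IH1 IH2.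
- by rewrite !(catA u' a); apply: cox_cong_rel.
Qed.

Lemma cox_cong_revl u : cox_cong (rev u ++ u) [::].
Proof.
elim: u => [|s u IHu]; first exact: cox_cong_refl.
rewrite rev_cons cat_rcons; apply: cox_cong_trans IHu.
have := cox_cong_rel (rev u) u s s.
by rewrite cox_m_diag.
Qed.

Definition cox_mul (w w' : cox_group) := cox_class (repr w ++ repr w').
Definition cox_inv (w : cox_group) := cox_class (rev (repr w)).
Definition cox_one := cox_class [::].

Lemma cox_mul_class u v : cox_mul (cox_class u) (cox_class v) = cox_class (u ++ v).
Proof.
by apply/cox_classP/cox_cong_cat; apply/cox_classP; rewrite cox_classK.
Qed.

Fact cox_mulA : associative cox_mul.
Proof.
move=> x y z; rewrite -(cox_classK x) -(cox_classK y) -(cox_classK z).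
by rewrite !cox_mul_class catA.
Qed.
Fact cox_mul1 : left_id cox_one cox_mul.
Proof. by move=> x; rewrite -(cox_classK x) cox_mul_class. Qed.
Fact cox_1mul : right_id cox_one cox_mul.
Proof. by move=> x; rewrite -(cox_classK x) cox_mul_class cats0. Qed.
Fact cox_mulV : left_inverse cox_one cox_inv cox_mul.
Proof.
move=> x; rewrite -{2}(cox_classK x) cox_mul_class.
by apply/cox_classP/cox_cong_revl.
Qed.
Fact cox_mulVr : right_inverse cox_one cox_inv cox_mul.
Proof.
move=> x; rewrite -{1}(cox_classK x) cox_mul_class.
by rewrite -{1}[repr x]revK; apply/cox_classP/cox_cong_revl.
Qed.

HB.instance Definition _ := isGroup.Build cox_group
  cox_mulA cox_mul1 cox_1mul cox_mulV cox_mulVr.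

Definition cox_gen (s : I) : cox_group := cox_class [:: s].

Definition expresses u (w : cox_group) : Prop :=
  (\prod_(s <- u) cox_gen s)%g = w.

Lemma expressesE u w : expresses u w <-> cox_class u = w.
Proof.
rewrite /expresses; suff -> : (\prod_(s <- u) cox_gen s)%g = cox_class u by [].
elim: u => [|s u IHu]; first by rewrite big_nil.
by rewrite big_cons IHu; apply: cox_mul_class.
Qed.

Fact cox_length_subproof (w : cox_group) :
  exists k, `[< exists u, expresses u w /\ size u = k >].
Proof.
by exists (size (repr w)); apply/asboolP; exists (repr w);
  split=> //; apply/expressesE/cox_classK.
Qed.

Definition cox_length (w : cox_group) : nat := ex_minn (cox_length_subproof w).

Definition reduced_expression u (w : cox_group) : Prop :=
  expresses u w /\ size u = cox_length w.

Inductive commutation_equiv : seq I -> seq I -> Prop :=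
| commutation_refl u : commutation_equiv u u
| commutation_step u u' v s t : M s t = 2 ->
    commutation_equiv (u ++ [:: t; s] ++ u') v ->
    commutation_equiv (u ++ [:: s; t] ++ u') v.

Definition fully_commutative (w : cox_group) : Prop :=
  forall u v, reduced_expression u w -> reduced_expression v w ->
    commutation_equiv u v.

Definition fc_involution (w : cox_group) : Prop :=
  fully_commutative w /\ (w * w = 1)%g.

Definition fc_involutions_of_length k : set cox_group :=
  [set w | fc_involution w /\ cox_length w = k].

Lemma finite_fc_involutions_of_length k :
  finite_set (fc_involutions_of_length k).
Proof.
apply: (@sub_finite_set _ _
  ((fun u : k.-tuple I => cox_class u) @` [set: k.-tuple I])%classic).
  move=> w [_ <-]; rewrite /cox_length; case: ex_minnP => j /asboolP[u [uw uj]] _.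
  by exists (@Tuple _ _ u (introT eqP uj)) => //; apply/expressesE.
exact/finite_image/finite_finset.
Qed.

(* The sum of q ^ l(w) over the fc involutions w, as a series in q. *)
Definition fc_involution_gf : fps rat :=
  Fps (fun k => (#|` fset_set (fc_involutions_of_length k)|)%:R%R).

End CoxeterGroup.

Section ClassicalTypes.

(* lab i j, for i < j, is the label of the pair {i, j}. *)
Definition labelled_m (lab : nat -> nat -> nat) n (i j : 'I_n) : nat :=
  if i == j then 1 else lab (minn i j) (maxn i j).

Lemma labelled_m_diag lab n (i : 'I_n) : labelled_m lab i i = 1.
Proof. by rewrite /labelled_m eqxx. Qed.
Lemma labelled_m_sym lab n (i j : 'I_n) : labelled_m lab i j = labelled_m lab j i.
Proof. by rewrite /labelled_m eq_sym minnC maxnC. Qed.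
Lemma labelled_m_off lab n : (forall i j, lab i j != 1) ->
  forall i j : 'I_n, i != j -> labelled_m lab i j != 1.
Proof. by move=> lab1 i j /negbTE ij; rewrite /labelled_m ij. Qed.

Definition labelled_matrix lab (lab1 : forall i j, lab i j != 1) n :=
  CoxeterMatrix (@labelled_m_diag lab n) (@labelled_m_sym lab n)
    (@labelled_m_off lab n lab1).

(* 0 - 1 - 2 - ... *)
Definition A_label (i j : nat) : nat := if j == i.+1 then 3 else 2.

(* 0 =4= 1 - 2 - ... *)
Definition B_label (i j : nat) : nat :=
  if j == i.+1 then (if i == 0 then 4 else 3) else 2.

(* 1 - 2 - 3 - ..., with 0 attached to 2. *)
Definition D_label (i j : nat) : nat :=
  if ((i == 0) && (j == 2)) || ((0 < i) && (j == i.+1)) then 3 else 2.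

Lemma A_label1 i j : A_label i j != 1.
Proof. by rewrite /A_label; case: ifP. Qed.
Lemma B_label1 i j : B_label i j != 1.
Proof. by rewrite /B_label; do 2?case: ifP. Qed.
Lemma D_label1 i j : D_label i j != 1.
Proof. by rewrite /D_label; case: ifP. Qed.

Definition A_matrix n : coxeter_matrix 'I_n := labelled_matrix A_label1 n.
Definition B_matrix n : coxeter_matrix 'I_n := labelled_matrix B_label1 n.
Definition D_matrix n : coxeter_matrix 'I_n := labelled_matrix D_label1 n.

End ClassicalTypes.

Section GeneratingFunctions.
Local Open Scope ring_scope.

Notation Qq := (fps rat).
Notation Qqx := (fps (fps rat)).

Definition q : Qq := fpsX rat.

Definition A_FC n : Qq := fc_involution_gf (A_matrix n).
Definition B_FC n : Qq := fc_involution_gf (B_matrix n).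

(* The values for n = 1, 2 are conventions; that for n = 1 is not the series
   of a Coxeter group with one generator. *)
Definition D_FC n : Qq :=
  match n with
  | 1 => 1
  | 2 => (1 + q) ^+ 2
  | _ => fc_involution_gf (D_matrix n)
  end.

Definition A_series : Qqx := Fps A_FC.
Definition B_series : Qqx := Fps B_FC.
Definition D_series : Qqx := Fps (fun n => D_FC n.+1).

(* (a; q^2)_n *)
Definition qpoch2 (a : Qq) n : Qq := \prod_(i < n) (1 - a * q ^+ (2 * i)%N).

Definition J_series : Qqx :=
  Fps (fun n => (-1) ^+ uphalf n * q ^+ 'C(n, 2) / qpoch2 (q ^+ 2) n./2).

Definition K_series : Qqx :=
  Fps (fun n => q ^+ 'C(n.+1, 2) *
    \sum_(0 <= k < n./2.+1) (-1) ^+ k / qpoch2 (q ^+ 2) k).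

Definition Ke_series : Qqx := 2%:R^-1 * (K_series + fps_dilate (-1) K_series).

(* The denominators that occur are units, so that the convention
   f^-1 = f for non-units plays no role. *)
Lemma qpoch2_unit k : qpoch2 (q ^+ 2) k \is a GRing.unit.
Proof.
apply: rpred_prod => i _; rewrite -exprD add2n exprS.
by rewrite fps_unitE /= big_ord1 mul0r oppr0 addr0.
Qed.

Lemma J_series_unit : J_series \is a GRing.unit.
Proof.
rewrite fps_unitE /=.
by rewrite rpred_div ?qpoch2_unit // !expr0 mulr1 unitr1.
Qed.

Lemma two_unit : 2%:R \is a @GRing.unit Qqx.
Proof. by []. Qed.

Lemma geometric_unit : 1 - fpsX Qq * fpsC q ^+ 2 \is a GRing.unit.
Proof.
rewrite fps_unitE /=.
by rewrite big_ord1 mul0r oppr0 addr0 unitr1.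
Qed.

End GeneratingFunctions.

(* Main.v *)
Require Import Defs.
From mathcomp Require Import all_boot all_order all_algebra.
From mathcomp Require Import finmap zify ring generic_quotient.
From mathcomp Require Import boolp classical_sets cardinality.

(** The exchange condition, obtained from the parity of the number of prefix
    reflections of a word equal to a given element, shows that a word whose
    commutation class contains no factor ss, and no factor sts (resp. stst) with
    m(s,t) = 3 (resp. 4), is reduced, and that it is the only reduced expression
    of its element up to commutations. So fc involutions correspond to
    commutation classes of such words that are stable under reversal.

    Along the path s_1 - s_2 - ..., the subwords on two adjacent letters of such
    a word are alternating palindromes, so the numbers h_1, h_2, ... of
    occurrences of the letters differ by one at each step, unless both are 0, and
    end at 0. The only exceptions come from a factor j ... 1 0 1 ... j in type B,
    and from j ... 3 2 (01) 2 3 ... j in type D; they start with a run of letters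
    occurring twice. In all cases the word is determined by its letter counts.

    If F_h is the series of the paths starting at height h, counted by length and
    by sum of heights, then F_h = x q^h (F_(h-1) + F_(h+1)) and
    F_0 = 1 + x (F_0 + F_1). The solution is F_h = G_h / J for explicit series
    G_h, with G_0 + G_1 = J(-xq), and the sum of all G_h is K. *)

Set Implicit Arguments.
Unset Strict Implicit.
Unset Printing Implicit Defensive.

Import GRing.Theory.

(** * The exchange condition *)

(** The projections of a word on pairs of non-commuting letters determine its commutation class, and
    an alternating palindrome on two letters is determined by its letter counts; hence counts
    suffice. Alternation comes from gaps: between consecutive occurrences of i lie at least two
    letters not commuting with i, since none yields ss and a single one with label 3 yields sts. As
    the alphabet is bounded, a descending induction from its upper end finds an i between any two
    letters i+1. So the only obstacle to alternation on {i, i+1} is a [peak]: two letters i with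
    neither i nor i+1 between them. Such a gap contains two letters i-1, hence a peak at i-1, and so
    on down to the special end of the graph. There the descent can stop, because of the label 4, for
    which one neighbour in a gap is enough, or because of the two leaves of the fork. In type D the
    leaves commute and [predn] merges them, which turns the fork into a path; only the order of the
    letters 0 and 1 is forgotten and has to be recovered. *)

Section Exchange.
Variables (I : finType) (M : coxeter_matrix I).
Implicit Types (s t : I) (u v : seq I) (g : cox_group M).

Local Notation "u ≡ v" := (cox_cong M u v) (at level 70).
Local Notation cls := (cox_class M).

Lemma cong_cons s u v : u ≡ v -> s :: u ≡ s :: v.
Proof. by move=> uv; apply: (@cox_cong_cat _ _ [:: s] [:: s]) => //; apply: cox_cong_refl. Qed.

Lemma cong_cat2l a u v : u ≡ v -> a ++ u ≡ a ++ v.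
Proof. by apply: cox_cong_cat; apply: cox_cong_refl. Qed.

Lemma cong_cat2r a u v : u ≡ v -> u ++ a ≡ v ++ a.
Proof. by move=> uv; apply: cox_cong_cat => //; apply: cox_cong_refl. Qed.

Lemma cong_square s u : s :: s :: u ≡ u.
Proof. by have := cox_cong_rel M [::] u s s; rewrite cox_m_diag. Qed.

Lemma cong_move s u v : s :: u ≡ v -> u ≡ s :: v.
Proof.
by move=> suv; apply: cox_cong_trans (cong_cons s suv);
  apply: cox_cong_sym; apply: cong_square.
Qed.

Lemma cong_cancel s u v : s :: u ≡ s :: v -> u ≡ v.
Proof. by move/cong_move=> uv; apply: cox_cong_trans uv (cong_square _ _). Qed.

Lemma cong_cancelr a u v : u ++ a ≡ v ++ a -> u ≡ v.
Proof.
move=> uv.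
have aV : a ++ rev a ≡ [::] by rewrite -{1}[a]revK; apply: cox_cong_revl.
have e x : x ++ a ++ rev a ≡ x by rewrite -{2}[x]cats0; apply: cong_cat2l.
apply: cox_cong_trans (cox_cong_sym (e u)) (cox_cong_trans _ (e v)).
by rewrite !catA; apply: cong_cat2r.
Qed.

Lemma size_flatten_nseq2 s t m : size (flatten (nseq m [:: s; t])) = m.*2.
Proof. by elim: m => //= m ->. Qed.

Lemma cong_odd u v : u ≡ v -> odd (size u) = odd (size v).
Proof.
elim=> {u v} [//|//|x u v _ -> //|u v s t].
by rewrite !size_cat size_flatten_nseq2 !oddD odd_double addFb.
Qed.

Definition reduced u := forall v, u ≡ v -> size u <= size v.

Lemma exists_reduced u : exists2 v, u ≡ v & reduced v.
Proof.
have [n le_un] := ubnP (size u); elim: n u le_un => // n IHn u le_un.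
have [red|/existsNP[v /not_implyP[uv /negP]]] := pselect (reduced u).
  by exists u => //; apply: cox_cong_refl.
rewrite -ltnNge => lt_vu.
have [|v' vv' red] := IHn v; first exact: leq_trans lt_vu _.
by exists v' => //; apply: cox_cong_trans uv vv'.
Qed.

Lemma reduced_expressionE u w :
  reduced_expression u w <-> cls u = w /\ reduced u.
Proof.
rewrite /reduced_expression expressesE; split=> [[uw]|[uw red]].
  rewrite /cox_length; case: ex_minnP => k /asboolP[x [/expressesE xw <-]] mink.
  move=> szu; split=> // v /cox_classP uv; rewrite szu mink //.
  by apply/asboolP; exists v; split=> //; apply/expressesE; rewrite -uv.
split=> //; rewrite /cox_length; case: ex_minnP => k.
move=> /asboolP[x [/expressesE xw <-]] mink; apply/eqP; rewrite eqn_leq.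
rewrite red; last by apply/cox_classP; rewrite xw.
by rewrite mink //; apply/asboolP; exists u; split=> //; apply/expressesE.
Qed.

Lemma reduced_sizeE u v : reduced u -> u ≡ v -> size v <= size u -> reduced v.
Proof.
move=> red uv le_vu x vx; apply: leq_trans le_vu (red _ _).
exact: cox_cong_trans uv vx.
Qed.

Lemma reduced_cons s u : reduced (s :: u) -> reduced u.
Proof. by move=> red v /(cong_cons s)/red. Qed.

Lemma clsE s u : cls (s :: u) = (cls [:: s] * cls u)%g.
Proof. by rewrite [RHS]cox_mul_class. Qed.

Lemma cls_cat u v : cls (u ++ v) = (cls u * cls v)%g.
Proof. by rewrite [RHS]cox_mul_class. Qed.

Lemma cls_nil : cls [::] = 1%g.
Proof. by []. Qed.

Lemma gen_square s : (cls [:: s] * cls [:: s] = 1)%g.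
Proof. by rewrite -clsE; apply/cox_classP/cong_square. Qed.


Lemma gen_inv s : ((cls [:: s])^-1 = cls [:: s])%g.
Proof. exact/mulg1_eq/gen_square. Qed.

(* The parity of the number of i such that s_1 ... s_i ... s_1 = g, for the
   word s_1 s_2 ...; it is an invariant of the group element, which is what
   yields the exchange condition. *)
Fixpoint refl_parity u g : bool :=
  if u is s :: u' then
    (g == cls [:: s]) (+) refl_parity u' (g ^ cls [:: s])%g
  else false.

Lemma refl_parity_cat u v g :
  refl_parity (u ++ v) g = refl_parity u g (+) refl_parity v (g ^ cls u)%g.
Proof.
elim: u g => [|s u IHu] g /=; first by rewrite cls_nil conjg1.
by rewrite IHu -addbA -conjgM -clsE.
Qed.

Lemma cls_flatten s t m :
  cls (flatten (nseq m [:: s; t])) = ((cls [:: s] * cls [:: t]) ^+ m)%g.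
Proof.
by elim: m => [|m IHm] //; rewrite expgS -IHm -clsE -cls_cat.
Qed.

(** Removing the leading letters s t conjugates by st, which turns the reflection (st)^(i+2) s into
    (st)^i s. *)
Lemma refl_parity_flatten s t m g :
  refl_parity (flatten (nseq m [:: s; t])) g =
  \big[addb/false]_(i < m.*2)
    (g == (cls [:: s] * cls [:: t]) ^+ i * cls [:: s])%g.
Proof.
elim: m g => [|m IHm] g; first by rewrite big_ord0.
rewrite doubleS !big_ord_recl /= IHm expg0 mul1g; congr (_ (+) _).
congr (_ (+) _).
  rewrite expg1 -[RHS](inj_eq (@conjg_inj _ (cls [:: s]))).
  by rewrite [X in _ = (_ == X)]conjgE gen_inv -!mulgA gen_square mulg1 mulgA gen_square mul1g.
apply: eq_bigr => i _; rewrite -conjgM -clsE /bump /= !add1n.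
rewrite -[RHS](inj_eq (@conjg_inj _ (cls [:: s; t]))); congr (_ == _).
rewrite conjgE (clsE s [:: t]) expgS expgSr; set c := (_ * cls [:: t])%g.
rewrite -!mulgA [X in _ = (_ * X)%g]mulgA mulKg; congr (_ * _)%g; rewrite /c.
by rewrite (mulgA (cls [:: s]) (cls [:: s])) gen_square mul1g gen_square mulg1.
Qed.

(** As (st)^m = 1, the 2m prefix reflections (st)^i s come in equal pairs, i and i + m, which cancel
    modulo 2. *)
Lemma refl_parity_rel s t g :
  refl_parity (flatten (nseq (M s t) [:: s; t])) g = false.
Proof.
have st1 : ((cls [:: s] * cls [:: t]) ^+ M s t)%g = 1%g.
  rewrite -cls_flatten; apply/cox_classP.
  by have := cox_cong_rel M [::] [::] s t; rewrite cats0.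
rewrite refl_parity_flatten -addnn big_split_ord /=.
under [X in _ (+) X]eq_bigr => i _ do rewrite expgnDr st1 mul1g.
by rewrite addbb.
Qed.

Lemma refl_parity_cong u v g : u ≡ v -> refl_parity u g = refl_parity v g.
Proof.
move=> uv; elim: uv g => {u v} [//|u v _ IH g|x u v _ IH1 _ IH2 g|u v s t g].
- by rewrite IH.
- by rewrite IH1 IH2.
rewrite !refl_parity_cat refl_parity_rel addFb.
congr (_ (+) refl_parity _ _); rewrite -conjgM -cls_cat.
congr (_ ^ _)%g; apply/cox_classP.
by have := cox_cong_rel M u [::] s t; rewrite !cats0.
Qed.

(** If g is the reflection of the prefix ending at some letter, left multiplication by g deletes
    that letter; an odd number of such prefixes is at least one. *)
Lemma deletion u g : refl_parity u g ->
  exists a s b, u = a ++ s :: b /\ (g * cls u)%g = cls (a ++ b).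
Proof.
elim: u g => //= s u IHu g; have [-> _|_ /=] := eqVneq g (cls [:: s]).
  by exists [::], s, u; split=> //; rewrite (clsE s u) mulgA gen_square mul1g.
move=> /IHu[a [r [b [-> e]]]]; exists (s :: a), r, b; split=> //.
by rewrite cat_cons (clsE s (_ ++ _ :: _)) (clsE s (a ++ b)) -e conjgE !mulgA mulgV mul1g.
Qed.

(** The first prefix contributes one occurrence of s. An odd number of further ones would, by
    deletion, express s u by a word shorter than u. *)
Lemma reduced_refl_parity s u : reduced (s :: u) -> refl_parity (s :: u) (cls [:: s]).
Proof.
move=> red /=; rewrite eqxx conjgE gen_inv mulgA gen_square mul1g.
apply/negP => /deletion[a [r [b [uE]]]]; rewrite -clsE => /cox_classP /red.
by rewrite uE /= !size_cat /=; lia.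
Qed.

(** The parity attached to s is odd for the reduced word s v and invariant under congruence, so s is
    also a prefix reflection of u. *)
Lemma exchange s u v : reduced u -> u ≡ s :: v -> reduced (s :: v) ->
  exists a r b, u = a ++ r :: b /\ u ≡ s :: a ++ b.
Proof.
move=> red uv redv.
have := reduced_refl_parity redv; rewrite -(refl_parity_cong _ uv).
move=> /deletion[a [r [b [-> /esym]]]]; rewrite -clsE => /cox_classP e.
by exists a, r, b; split=> //; apply/cong_move/cox_cong_sym.
Qed.

(** Congruent words have lengths of the same parity, so a reduced word for s u is shorter than s u
    by at least two, which leaves room for an additional letter s. *)
Lemma not_reduced_cons s u : reduced u -> ~ reduced (s :: u) ->
  exists v, u ≡ s :: v /\ reduced (s :: v).
Proof.
move=> red nred; have [v sv redv] := exists_reduced (s :: u).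
have uv := cong_move sv; exists v; split=> //.
apply: reduced_sizeE red uv _.
have lt_v : size v < size (s :: u).
  rewrite ltnNge; apply/negP => le_uv; apply: nred.
  exact: reduced_sizeE redv (cox_cong_sym sv) _.
have := cong_odd sv; rewrite /= in lt_v *; lia.
Qed.

End Exchange.

(** * Commutation classes *)

Lemma first_occurrence (T : eqType) (x : T) s :
  x \in s -> exists a b, s = a ++ x :: b /\ x \notin a.
Proof.
elim: s => // y s IHs; rewrite inE; have [<- _|xy /=] := eqVneq x y.
  by exists [::], s.
by case/IHs=> a [b [-> xa]]; exists (y :: a), b; rewrite inE negb_or xy.
Qed.

Section Commutation.
Variables (I : finType) (M : coxeter_matrix I).
Implicit Types (s t : I) (u v : seq I).

Local Notation "u ≡ v" := (cox_cong M u v) (at level 70).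
Local Notation "u ~~> v" := (commutation_equiv M u v) (at level 70).

Lemma comm_trans v u w : u ~~> v -> v ~~> w -> u ~~> w.
Proof.
by elim=> // a b x s t st _ IH /IH; apply: commutation_step.
Qed.

Lemma comm_swap a b s t : M s t = 2 -> a ++ [:: s; t] ++ b ~~> a ++ [:: t; s] ++ b.
Proof. by move=> st; apply: commutation_step => //; apply: commutation_refl. Qed.

Lemma comm_sym u v : u ~~> v -> v ~~> u.
Proof.
elim=> [x|a b x s t st _ IH]; first exact: commutation_refl.
by apply: comm_trans IH _; apply: comm_swap; rewrite cox_m_sym.
Qed.

Lemma comm_cat a b u v : u ~~> v -> a ++ u ++ b ~~> a ++ v ++ b.
Proof.
elim=> [x|c d x s t st _ IH]; first exact: commutation_refl.
rewrite -catA catA; apply: commutation_step => //.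
by move: IH; rewrite -!catA.
Qed.

Lemma comm_cons s u v : u ~~> v -> s :: u ~~> s :: v.
Proof. by move/(comm_cat [:: s] [::]); rewrite !cats0. Qed.

Lemma comm_cong u v : u ~~> v -> u ≡ v.
Proof.
elim=> [x|a b x s t st _ IH]; first exact: cox_cong_refl.
apply: cox_cong_trans IH; apply: cong_cat2l; apply: cong_cat2r.
have := cox_cong_rel M [::] [::] s t; rewrite st /=.
by move/cong_move/cong_move.
Qed.

Lemma comm_perm u v : u ~~> v -> perm_eq u v.
Proof.
elim=> [x //|a b x s t st _]; apply: perm_trans.
by rewrite perm_cat2l perm_cat2r; apply/permP => p /=; lia.
Qed.

Lemma comm_size u v : u ~~> v -> size u = size v.
Proof. by move/comm_perm/perm_size. Qed.

Lemma comm_filter (p : pred I) u v :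
  (forall s t, p s -> p t -> M s t <> 2) -> u ~~> v -> filter p u = filter p v.
Proof.
move=> pM; elim=> // a b x s t st _ <-; rewrite !filter_cat /=.
by case ps: (p s); case pt: (p t) => //; case: (pM s t).
Qed.

Lemma comm_moveS s u : all (fun t => M s t == 2) u -> forall a b,
  a ++ s :: u ++ b ~~> a ++ u ++ s :: b.
Proof.
elim: u => [|t u IHu] /= => [_ a b|/andP[/eqP st all_u] a b].
  exact: commutation_refl.
apply: comm_trans (comm_swap a (u ++ b) st) _.
by have := IHu all_u (rcons a t) b; rewrite -!cats1 -!catA.
Qed.

Lemma comm_move0 s u b : all (fun t => M s t == 2) u -> s :: u ++ b ~~> u ++ s :: b.
Proof. by move/comm_moveS/(_ [::] b). Qed.

(** The projection criterion for partially commutative monoids. The first letter of u occurs in v,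
    preceded there only by letters commuting with it, so it can be moved to the front and cancelled.
    The pairs s = t, with label 1, record the letter counts. *)
Lemma commP u v :
  (forall s t, M s t <> 2 -> filter (pred2 s t) u = filter (pred2 s t) v) ->
  u ~~> v.
Proof.
have diag2 s : M s s <> 2 by rewrite cox_m_diag.
elim: u v => [|s u IHu] v puv.
  case: v puv => [|t v] puv; first exact: commutation_refl.
  by have := puv t t (diag2 t); rewrite /= eqxx.
have sv : s \in v.
  have := puv s s (diag2 s); rewrite /= eqxx => e.
  have : s \in filter (pred2 s s) v by rewrite -e mem_head.
  by rewrite mem_filter => /andP[].
have [a [b [vE sa]]] := first_occurrence sv; rewrite {v sv}vE in puv *.
have all_a : all (fun r => M s r == 2) a.
  apply/allP => r ra; apply/negP => /negP/eqP/puv /=; rewrite eqxx filter_cat /=.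
  have : r \in filter (pred2 s r) a by rewrite mem_filter ra /= eqxx orbT.
  case E: (filter _ a) => [|x y] // _ /= [sx _].
  have : x \in filter (pred2 s r) a by rewrite E mem_head.
  by rewrite mem_filter -sx (negPf sa) andbF.
apply: comm_trans _ (comm_move0 b all_a); apply: comm_cons.
apply: IHu => x y xy; have := puv _ _ xy; rewrite !filter_cat /=.
case: ifP => sxy; last by [].
suff : filter (pred2 x y) a = [::] by move=> -> [].
apply/eqP; rewrite -[_ == _]negbK -has_filter; apply/hasPn => r ra /=.
have /= sr := allP all_a r ra.
case/orP: sxy => /eqP ?; subst s.
  apply/norP; split; first by apply: contraNneq sa => <-.
  by apply/eqP => ?; subst r; case: xy; apply/eqP.
apply/norP; split; last by apply: contraNneq sa => <-.
by apply/eqP => ?; subst r; case: xy; rewrite cox_m_sym; apply/eqP.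
Qed.

Lemma comm_filter2 s t u v : M s t <> 2 -> u ~~> v ->
  filter (pred2 s t) u = filter (pred2 s t) v.
Proof.
move=> st; apply: comm_filter => x y /orP[]/eqP-> /orP[]/eqP->;
  by rewrite ?cox_m_diag // cox_m_sym.
Qed.

(** Squares and the long braid words: the factors whose absence from a whole commutation class
    characterizes full commutativity when all labels of distinct letters are 2, 3 or 4. *)
Definition bad_factor v := exists a b s t,
  [\/ v = a ++ [:: s; s] ++ b,
      M s t = 3 /\ v = a ++ [:: s; t; s] ++ b |
      M s t = 4 /\ v = a ++ [:: s; t; s; t] ++ b].

Definition good u := forall v, u ~~> v -> ~ bad_factor v.

Lemma good_comm u v : u ~~> v -> good u -> good v.
Proof. by move=> uv gu x vx; apply: gu; apply: comm_trans uv vx. Qed.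

Lemma good_cons s u : good (s :: u) -> good u.
Proof.
move=> gsu v uv [a [b [x [y h]]]]; apply: (gsu (s :: v)); first exact: comm_cons.
by exists (s :: a), b, x, y; case: h => [->|[? ->]|[? ->]]; [constructor 1|constructor 2|constructor 3].
Qed.

End Commutation.

(** * Words without forbidden factors *)

Section GoodWords.
Variables (I : finType) (M : coxeter_matrix I).
Hypothesis M234 : forall s t, s != t -> M s t \in [:: 2; 3; 4].
Implicit Types (s t : I) (u v : seq I).

Local Notation "u ≡ v" := (cox_cong M u v) (at level 70).
Local Notation "u ~~> v" := (commutation_equiv M u v) (at level 70).

(* An integral Cartan matrix; the order on I only breaks the tie between the
   entries -2 and -1 when M s t = 4. *)
Definition cartan s t : int :=
  if s == t then 2%R else
  if M s t == 2 then 0%R else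
  if M s t == 3 then (-1)%R else
  if enum_rank s < enum_rank t then (-2)%R else (-1)%R.

(** The simple reflection s on a weight given by its coordinates on the fundamental weights, an
    integral form of the geometric representation. It serves to separate a few short words, by their
    action on a fundamental weight [delta]. *)
Definition reflect_weight s (x : I -> int) : I -> int :=
  fun r => (x r - x s * cartan s r)%R.

Definition act_word u x := foldr reflect_weight x u.

Lemma cartan_diag s : cartan s s = 2%R.
Proof. by rewrite /cartan eqxx. Qed.

Lemma cartan2 s t : M s t = 2 -> cartan s t = 0%R.
Proof.
by rewrite /cartan; case: eqVneq => [->|_ ->//]; rewrite cox_m_diag.
Qed.

Lemma cartan3 s t : M s t = 3 -> cartan s t = (-1)%R.
Proof.
by rewrite /cartan; case: eqVneq => [->|_ ->//]; rewrite cox_m_diag.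
Qed.

Lemma cartan4 s t : M s t = 4 -> (cartan s t = (-2)%R /\ cartan t s = (-1)%R) \/
  (cartan s t = (-1)%R /\ cartan t s = (-2)%R).
Proof.
move=> st; have ts : M t s = 4 by rewrite cox_m_sym.
rewrite /cartan st ts eq_sym; case: eqVneq => [e|ne].
  by move: st; rewrite e cox_m_diag.
rewrite /=; case: ltngtP => [_|_|/val_inj/enum_rank_inj e]; [by left|by right|].
by rewrite e eqxx in ne.
Qed.

Lemma act_rel s t x r : act_word (flatten (nseq (M s t) [:: s; t])) x r = x r.
Proof.
have [->|/M234] := eqVneq s t.
  by rewrite cox_m_diag /= /reflect_weight cartan_diag; ring.
have ts := cox_m_sym M t s.
rewrite !inE => /or3P[]/eqP st; rewrite st in ts *; rewrite /= /reflect_weight !cartan_diag.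
- by rewrite (cartan2 st) (cartan2 ts); ring.
- by rewrite (cartan3 st) (cartan3 ts); ring.
- by case: (cartan4 st) => [[-> ->]|[-> ->]]; ring.
Qed.

Lemma act_cat u v x : act_word (u ++ v) x = act_word u (act_word v x).
Proof. exact: foldr_cat. Qed.

Lemma act_cong u v x : u ≡ v -> act_word u x = act_word v x.
Proof.
move=> uv; elim: uv x => {u v} [//|u v _ IH x|z u v _ IH1 _ IH2 x|u v s t x].
- by rewrite IH.
- by rewrite IH1.
rewrite !act_cat; congr act_word; apply/funext => r; exact: act_rel.
Qed.

Definition delta s : I -> int := fun r => (r == s)%:R%R.

Lemma gen_neq s t : s != t -> ~ [:: s] ≡ [:: t].
Proof.
move=> st /(act_cong (delta s)) /(congr1 (fun f => f s)) /=.
by rewrite /reflect_weight /delta !eqxx eq_sym (negPf st) cartan_diag; lia.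
Qed.

Lemma noncomm_gen s t : s != t -> M s t <> 2 -> ~ [:: s; t] ≡ [:: t; s].
Proof.
move=> st Mst /(act_cong (delta t)) /(congr1 (fun f => f s)) /=.
have Mts : M t s <> 2 by rewrite cox_m_sym.
have := M234 st; rewrite !inE => /or3P[]/eqP st'; [by []| |].
- have ts' : M t s = 3 by rewrite cox_m_sym.
  by rewrite /reflect_weight /delta !eqxx ?(negPf st) ?cartan_diag (cartan3 st') (cartan3 ts'); lia.
- by rewrite /reflect_weight /delta !eqxx ?(negPf st) ?cartan_diag; case: (cartan4 st') => [[-> ->]|[-> ->]]; lia.
Qed.

Lemma nonbraid_gen s t : M s t = 4 -> ~ [:: s; t; s] ≡ [:: t; s; t].
Proof.
move=> Mst; have st : s != t by apply/eqP => e; move: Mst; rewrite e cox_m_diag.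
move=> /(act_cong (delta t)) /(congr1 (fun f => f s)) /=.
rewrite /reflect_weight /delta !eqxx ?(negPf st) ?cartan_diag.
by case: (cartan4 Mst) => [[-> ->]|[-> ->]]; lia.
Qed.

Lemma cong4 s t u : M s t = 4 -> [:: t, s, t, s & u] ≡ [:: s, t, s, t & u].
Proof.
move=> st; have := cox_cong_rel M [::] [:: t, s, t, s & u] s t.
rewrite st /= => e; apply: cox_cong_trans (cox_cong_sym e) _.
do 4 apply: cong_cons.
by do 4 (apply: cox_cong_sym; apply: cong_move; apply: cox_cong_sym);
   apply: cox_cong_refl.
Qed.

(** Induction on the length. If s u is not reduced, then u is congruent to some reduced s v, hence
    equivalent to it by uniqueness for u, and a square appears. If t v is another reduced word and s
    <> t, repeated exchange produces a reduced word starting with the alternating word on s, t: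
    label 2 gives a swap and the induction applies, labels 3 and 4 give a forbidden factor. *)
Theorem good_word_reduced u : good M u ->
  reduced M u /\ (forall v, reduced M v -> u ≡ v -> u ~~> v).
Proof.
have [n] := ubnP (size u); elim: n u => // n IHn [_ _|s u].
  split=> // v redv /cox_cong_sym/redv; case: v redv => // *.
  exact: commutation_refl.
rewrite /= ltnS => le_un gsu.
have [redu uniu] := IHn u le_un (good_cons gsu).
have red : reduced M (s :: u).
  apply: contrapT => /(not_reduced_cons redu)[v [uv redv]].
  apply: (gsu (s :: s :: v)); first by apply: comm_cons; apply: uniu.
  by exists [::], v, s, s; constructor 1.
split=> // -[|t v] redv uv; first by have := red _ uv.
have [e|st] := eqVneq s t.
  rewrite -e in uv redv *; apply: comm_cons; apply: uniu (cong_cancel uv).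
  exact: reduced_cons redv.
(* The deleted letter cannot be the initial s, as s and t would then be congruent. Likewise below,
   each exchange deletes a letter beyond the alternating prefix: a deletion inside it would
   contradict reducedness, st <> ts or, for label 4, sts <> tst. *)
have [[|s' a] [r [b [/= [sE uE]]]]] := exchange red uv redv.
  rewrite -uE -[s :: u]/([:: s] ++ u) -[t :: u]/([:: t] ++ u).
  by move/cong_cancelr/(gen_neq st).
rewrite -sE => utx; move: {uE}(congr1 size uE) utx.
rewrite size_cat /= addnS -size_cat; set x := a ++ b => sz_u utx.
have redx : reduced M [:: t, s & x] by apply: reduced_sizeE red utx _; rewrite /= sz_u.
have Mst := M234 st; rewrite !inE in Mst.
have [M2|M2] := eqVneq (M s t) 2.
  have swp z : [:: s, t & z] ~~> [:: t, s & z] by apply: (comm_swap [::] z M2).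
  have ux : u ≡ t :: x.
    apply: (@cong_cancel _ _ s); apply: cox_cong_trans utx _.
    by apply: cox_cong_sym; apply: comm_cong.
  have cux : u ~~> t :: x.
    by apply: (uniu _ _ ux); apply: reduced_sizeE redu ux _; rewrite /= sz_u.
  have csux : s :: u ~~> [:: t, s & x].
    exact: comm_trans (comm_cons s cux) (swp x).
  apply: (comm_trans csux); apply: comm_cons.
  have [|_ uni] := IHn (s :: x) _ (good_cons (good_comm csux gsu)).
    by rewrite /= -sz_u.
  apply: uni; first exact: reduced_cons redv.
  by apply: (@cong_cancel _ _ t); apply: cox_cong_trans (cox_cong_sym utx) uv.
have [[|t' a'] [r' [b' [/= [tE xE]]]]] := exchange redx (cox_cong_sym utx) red.
  rewrite -xE => e; have := redx _ (cox_cong_trans e (cong_square _ _ _)).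
  by rewrite /=; lia.
rewrite -tE; case: a' xE => [|s'' a'] /= [s'E xE].
  rewrite -xE -[[:: t, s & x]]/([:: t; s] ++ x) -[[:: s, t & x]]/([:: s; t] ++ x).
  by move/cong_cancelr/cox_cong_sym/(noncomm_gen st); case; apply/eqP.
rewrite -s'E; move: {xE}(congr1 size xE); rewrite size_cat /= addnS -size_cat.
set y := a' ++ b' => sz_x txy.
have uy : u ≡ [:: t, s & y].
  by apply: (@cong_cancel _ _ s); apply: cox_cong_trans utx txy.
have cuy : [:: s & u] ~~> [:: s, t, s & y].
  apply: comm_cons; apply: (uniu _ _ uy); apply: reduced_sizeE redu uy _.
  by rewrite /= sz_u sz_x.
have [M3|M3] := eqVneq (M s t) 3.
  by case: (gsu _ cuy); exists [::], y, s, t; constructor 2.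
have M4 : M s t = 4 by move: Mst; rewrite (negPf M2) (negPf M3) => /eqP.
have redy : reduced M [:: s, t, s & y].
  by apply: reduced_sizeE red (comm_cong cuy) _; rewrite (comm_size cuy).
have yv : [:: s, t, s & y] ≡ t :: v.
  exact: cox_cong_trans (cox_cong_sym (comm_cong cuy)) uv.
have [[|s3 c] [q [d [/= [s3E yE]]]]] := exchange redy yv redv.
  rewrite -yE => e; have := redy _ (cox_cong_trans e (cong_square _ _ _)).
  by rewrite /=; lia.
rewrite -s3E; case: c yE => [|t4 c] /= [t4E yE].
  rewrite -yE => e.
  have := redy _ (cox_cong_trans e (cong_cons t (cong_square _ _ _))).
  by rewrite /=; lia.
rewrite -t4E; case: c yE => [|s5 c] /= [s5E yE].
  rewrite -yE -[[:: s, t, s & y]]/([:: s; t; s] ++ y) -[[:: t, s, t & y]]/([:: t; s; t] ++ y).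
  by move/cong_cancelr/(nonbraid_gen M4).
rewrite -s5E; move: {yE}(congr1 size yE); rewrite size_cat /= addnS -size_cat.
set z := c ++ d => sz_y syz.
(* The exchange gives tsts z, which the braid relation of length 4 turns into stst z. *)
have uz : u ≡ [:: t, s, t & z].
  apply: (@cong_cancel _ _ s); apply: cox_cong_trans (comm_cong cuy) _.
  exact: cox_cong_trans syz (cong4 _ M4).
have cuz : [:: s & u] ~~> [:: s, t, s, t & z].
  apply: comm_cons; apply: (uniu _ _ uz); apply: reduced_sizeE redu uz _.
  by rewrite /= sz_u sz_x sz_y.
by case: (gsu _ cuz); exists [::], z, s, t; constructor 3.
Qed.

(** A square contradicts reducedness. Replacing sts by tst, or stst by tsts, gives another reduced
    word, equivalent by full commutativity; but commutations preserve the projection on {s, t},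
    which has changed. *)
Lemma fc_good u : reduced M u -> fully_commutative (cox_class M u) -> good M u.
Proof.
move=> red fc v uv [a [b [s [t h]]]].
have redv : reduced M v by apply: reduced_sizeE red (comm_cong uv) _; rewrite (comm_size uv).
have braid x y : v = a ++ x ++ b -> size x = size y -> x ≡ y ->
    filter (pred2 s t) x = x -> filter (pred2 s t) y = y -> M s t <> 2 -> x = y.
  move=> vE sxy xy fx fy st.
  have vy : v ≡ a ++ y ++ b by rewrite vE; apply: cong_cat2l; apply: cong_cat2r.
  have : v ~~> a ++ y ++ b.
    apply: comm_trans (comm_sym uv) _; apply: fc.
      by apply/reduced_expressionE.
    apply/reduced_expressionE; split.
      by apply/cox_classP/cox_cong_sym; apply: cox_cong_trans (comm_cong uv) vy.
    by apply: reduced_sizeE redv vy _; rewrite vE !size_cat sxy.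
  move/(comm_filter2 st)/eqP; rewrite vE !filter_cat eqseq_cat // fx fy.
  by rewrite eqseq_cat // => /andP[_ /andP[/eqP]].
case: h => [vE|[M3 vE]|[M4 vE]].
- have e : v ≡ a ++ b by rewrite vE; apply: cong_cat2l; apply: (cong_square M s b).
  by have := redv _ e; rewrite vE !size_cat /=; lia.
- have st : s != t by apply/eqP => e; move: M3; rewrite e cox_m_diag.
  suff [e _] : [:: s; t; s] = [:: t; s; t] by rewrite e eqxx in st.
  apply: (braid _ _ vE) => //.
  + have := cox_cong_rel M [::] [::] s t; rewrite M3 /=.
    by do 3 move/cong_move; move/cox_cong_sym.
  + by rewrite /= !eqxx orbT.
  + by rewrite /= !eqxx orbT.
  + by rewrite M3.
- have st : s != t by apply/eqP => e; move: M4; rewrite e cox_m_diag.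
  suff [e _] : [:: s; t; s; t] = [:: t; s; t; s] by rewrite e eqxx in st.
  apply: (braid _ _ vE) => //.
  + exact/cox_cong_sym/cong4.
  + by rewrite /= !eqxx orbT.
  + by rewrite /= !eqxx orbT.
  + by rewrite M4.
Qed.

(** Reversing a word inverts its element, so for an involution u and [rev u] are reduced expressions
    of the same element. *)
Lemma fc_involutionP w : fc_involution w <->
  exists u, [/\ cox_class M u = w, good M u, u ~~> rev u & size u = cox_length w].
Proof.
split=> [[fc ww]|[u [<- gu uru szu]]].
  have [u] := exists_reduced M (repr w); move/cox_classP; rewrite cox_classK => wE red.
  have gu : good M u by apply: fc_good => //; rewrite -wE.
  have redw : reduced_expression u w by apply/reduced_expressionE.
  exists u; split=> //; last by case: redw.
  have uV : cox_class M (rev u) = w.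
    have /cox_classP := cox_cong_revl M u; rewrite cls_cat -wE cls_nil => e.
    by apply: (@mulIg _ w); rewrite e ww.
  apply: fc => //; apply/reduced_expressionE; split=> //.
  apply: reduced_sizeE (proj1 (good_word_reduced gu)) _ _.
    by apply/cox_classP; rewrite uV.
  by rewrite size_rev.
have [red uni] := good_word_reduced gu; split.
  move=> x y /reduced_expressionE[/cox_classP/cox_cong_sym xu redx].
  move=> /reduced_expressionE[/cox_classP/cox_cong_sym yu redy].
  exact: comm_trans (comm_sym (uni _ redx xu)) (uni _ redy yu).
rewrite -cls_cat -cls_nil; apply/cox_classP.
apply: cox_cong_trans (cox_cong_revl M u).
by apply: cong_cat2r; apply: comm_cong.
Qed.

Lemma good_length u : good M u -> cox_length (cox_class M u) = size u.
Proof.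
move=> /good_word_reduced[red _].
by have /reduced_expressionE[_ ->] : cox_class M u = cox_class M u /\ reduced M u.
Qed.

Lemma good_cls_inj u v : good M u -> good M v ->
  cox_class M u = cox_class M v -> u ~~> v.
Proof.
by move=> /good_word_reduced[_ uni] /good_word_reduced[redv _] /cox_classP; apply: uni.
Qed.

End GoodWords.

(** * Gaps between equal letters of a good word *)

Section Gaps.
Variables (I : finType) (M : coxeter_matrix I).
Implicit Types (s t : I) (u v : seq I).

Local Notation commutes s := (all (fun r => M s r == 2)).

Lemma good_gap1 a X b s : good M (a ++ s :: X ++ s :: b) -> ~~ commutes s X.
Proof.
move=> gu; apply/negP => /comm_moveS /(_ a (s :: b)) /gu; apply.
by exists (a ++ X), b, s, s; constructor 1; rewrite -!catA.
Qed.

Lemma good_gap2 a X Y b s t : good M (a ++ s :: X ++ t :: Y ++ s :: b) ->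
  M s t = 3 -> commutes s X -> commutes s Y -> False.
Proof.
move=> gu st sX sY; apply: (gu ((a ++ X) ++ [:: s; t; s] ++ Y ++ b)).
  rewrite -!catA; apply: comm_trans (comm_moveS sX a _) _.
  have := comm_sym (comm_moveS sY (a ++ X ++ [:: s; t]) b).
  by rewrite -!catA.
by exists (a ++ X), (Y ++ b), s, t; constructor 2.
Qed.

Lemma good_gap3 a X Y Z b s t :
  good M (a ++ s :: X ++ t :: Y ++ s :: Z ++ t :: b) -> M s t = 4 ->
  commutes s X -> commutes s Y -> commutes t Y -> commutes t Z -> False.
Proof.
move=> gu st sX sY tY tZ.
apply: (gu ((a ++ X) ++ [:: s; t; s; t] ++ Y ++ Z ++ b)).
  rewrite -!catA; apply: comm_trans (comm_moveS sX a _) _.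
  have := comm_sym (comm_moveS sY (a ++ X ++ [:: s; t]) (Z ++ t :: b)).
  rewrite -!catA; move/comm_trans; apply.
  (* Once the second s has been moved left across Y, both Y and Z separate it from the last t. *)
  have tYZ : commutes t (Y ++ Z) by rewrite all_cat tY.
  have := comm_sym (comm_moveS tYZ (a ++ X ++ [:: s; t; s]) b).
  by rewrite -!catA.
by exists (a ++ X), (Y ++ Z ++ b), s, t; constructor 3.
Qed.

End Gaps.

(** * Counting fc involutions by a complete code of words *)

Section Counting.
Variables (I : finType) (M : coxeter_matrix I).
Hypothesis M234 : forall s t, s != t -> M s t \in [:: 2; 3; 4].
Implicit Types (u v : seq I).

Local Notation "u ~~> v" := (commutation_equiv M u v) (at level 70).

Variables (C : eqType) (code : seq I -> C) (weight : C -> nat) (L : seq C).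
Hypothesis uniqL : uniq L.
Hypothesis code_comm : forall u v, u ~~> v -> code u = code v.
Hypothesis code_size : forall u, weight (code u) = size u.
Hypothesis code_in : forall u, good M u -> u ~~> rev u -> code u \in L.
Hypothesis code_inj : forall u v, good M u -> u ~~> rev u ->
  good M v -> v ~~> rev v -> code u = code v -> u ~~> v.
Hypothesis code_surj : forall c, c \in L ->
  exists u, [/\ good M u, u ~~> rev u & code u = c].

Lemma fps_coef_qX n k : fps_coef (q ^+ n)%R k = ((k == n)%:R)%R :> rat.
Proof.
elim: n k => [|n IHn] k; first by rewrite expr0.
rewrite exprS /= ; case: k => [|k].
  by rewrite big_ord1 /= mul0r.
rewrite big_ord_recl /= mul0r add0r big_ord_recl /= mul1r subSS subn0 IHn.
by rewrite big1 ?addr0 // => i _; rewrite mul0r.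
Qed.

Lemma fps_coef_sum (T : Type) (s : seq T) (F : T -> fps rat) k :
  fps_coef (\sum_(i <- s) F i)%R k = (\sum_(i <- s) fps_coef (F i) k)%R.
Proof.
by elim: s => [|x s IHs]; rewrite ?big_nil // !big_cons -IHs.
Qed.

(** Choosing a word for each code gives a bijection from L onto the fc involutions: good words of
    one element are equivalent and so share their code, and the word chosen for the code of u is
    equivalent to u. *)
Lemma fc_involution_gfE :
  fc_involution_gf M = (\sum_(c <- L) q ^+ weight c)%R.
Proof.
pose wd c := xget [::] [set u | [/\ good M u, u ~~> rev u & code u = c]]%classic.
have wdP c : c \in L -> [/\ good M (wd c), wd c ~~> rev (wd c) & code (wd c) = c].
  by move=> /code_surj ex; apply: (xgetPex [::] ex).
apply: fpsP => k; rewrite fps_coef_sum.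
under eq_bigr do rewrite fps_coef_qX eq_sym.
have -> : (\sum_(c <- L) ((weight c == k)%:R : rat))%R = ((count (fun c => weight c == k) L)%:R)%R.
  elim: L => [|c l IHl]; first by rewrite big_nil.
  by rewrite big_cons IHl /= natrD.
rewrite /fc_involution_gf /=; congr (_%:R)%R.
rewrite -size_filter; set L' := filter _ L.
rewrite -(size_map (fun c => cox_class M (wd c)) L').
have uniqm : uniq [seq cox_class M (wd c) | c <- L'].
  rewrite map_inj_in_uniq ?filter_uniq // => c d.
  rewrite !mem_filter => /andP[_ /wdP[gc _ {2}<-]] /andP[_ /wdP[gd _ {2}<-]].
  by move/(good_cls_inj M234 gc gd)/code_comm.
rewrite -(undup_id uniqm) -card_fseq; congr (#|` _ |)%fset.
apply/fsetP => w; rewrite in_fset_set; last exact: finite_fc_involutions_of_length.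
rewrite !inE /=; apply/asboolP/idP => [[/(fc_involutionP M234)[u [uw gu uru szu]] lw]|].
  apply/mapP; exists (code u).
    by rewrite mem_filter code_size szu lw eqxx code_in.
  rewrite -uw; apply/cox_classP/comm_cong.
  by have [gc rc cc] := wdP _ (code_in gu uru); apply: code_inj.
case/mapP => c; rewrite mem_filter => /andP[/eqP ck /wdP[gc rc cc]] ->.
have lc : cox_length (cox_class M (wd c)) = size (wd c) by apply: good_length.
by split; [apply/(fc_involutionP M234); exists (wd c); split|rewrite lc -code_size cc].
Qed.

End Counting.

(** * Alternating and palindromic words *)

Section SeqFacts.
Variable T : eqType.
Implicit Types (x y z : T) (s a b w : seq T) (p : pred T).

Lemma last_occurrence x s : x \in s -> exists a b, s = a ++ x :: b /\ x \notin b.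
Proof.
rewrite -mem_rev => /first_occurrence[a [b [e xa]]]; exists (rev b), (rev a).
by rewrite mem_rev xa -[s]revK e rev_cat rev_cons cat_rcons.
Qed.

Lemma two_occurrences x s : 1 < count_mem x s ->
  exists a w b, s = a ++ x :: w ++ x :: b /\ x \notin w.
Proof.
move=> c2; have xs : x \in s by rewrite -has_pred1 has_count; apply: leq_trans c2.
have [a [r [sE xa]]] := first_occurrence xs.
have xr : x \in r.
  move: c2; rewrite sE count_cat /= eqxx (count_memPn xa) add0n add1n ltnS.
  by rewrite -has_count has_pred1.
by have [y [b [rE xy]]] := first_occurrence xr; exists a, y, b; rewrite sE rE.
Qed.

Lemma filter_eq_cat p s a x b : filter p s = a ++ x :: b ->
  exists a' b', [/\ s = a' ++ x :: b', filter p a' = a & filter p b' = b].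
Proof.
elim: s a => [|y s IHs] a /=; first by case: a.
case: ifP => py; last first.
  by move=> /IHs[a' [b' [-> <- <-]]]; exists (y :: a'), b'; rewrite /= py.
case: a => [|z a] /= [<- e]; first by exists [::], s.
by have [a' [b' [-> <- <-]]] := IHs _ e; exists (y :: a'), b'; rewrite /= py.
Qed.

Lemma filter_notin_nseq x y s : y \notin s -> x != y ->
  filter (pred2 x y) s = nseq (count_mem x s) x.
Proof.
move=> ys xy; elim: s ys => //= z s IHs; rewrite inE negb_or => /andP[yz /IHs->].
by rewrite eq_sym [z == y]eq_sym (negPf yz) orbF eq_sym; case: eqVneq => // ->.
Qed.

Lemma filter_notin2 x y s : x \notin s -> y \notin s -> filter (pred2 x y) s = [::].
Proof.
move=> xs ys; apply/eqP; rewrite -[_ == _]negbK -has_filter; apply/hasPn => z zs /=.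
by apply/norP; split; [apply: contraNneq xs => <-|apply: contraNneq ys => <-].
Qed.

Definition alternating s := sorted (fun x y => x != y) s.

Lemma not_alternating s : ~~ alternating s -> exists a x b, s = a ++ x :: x :: b.
Proof.
elim: s => //= x [//|y s] IHs /=; rewrite negb_and negbK.
case/orP=> [/eqP->|/IHs[a [z [b ->]]]]; first by exists [::], y, s.
by exists (x :: a), z, b.
Qed.

Lemma alternating_square a x b : ~~ alternating (a ++ x :: x :: b).
Proof. by rewrite /alternating; case: a => [|y a] /=; rewrite ?cat_path /= eqxx ?andbF. Qed.

(** For p = [pred2 x y], a square x x in the projection on {x, y}, expressed through the gap in s
    itself, to which the gap conditions apply. *)
Definition adjacent x p s := exists a w b, s = a ++ x :: w ++ x :: b /\ ~~ has p w.

Lemma alternating_filter2 x y s :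
  ~ adjacent x (pred2 x y) s -> ~ adjacent y (pred2 x y) s ->
  alternating (filter (pred2 x y) s).
Proof.
move=> nx ny; apply/negPn/negP => /not_alternating[a [z [b e]]].
have [a' [b' [sE _ e']]] := filter_eq_cat e.
have [y' [b'' [bE fy _]]] := @filter_eq_cat _ _ [::] _ _ e'.
have zxy : z \in filter (pred2 x y) s by rewrite e mem_cat mem_head orbT.
move: zxy; rewrite mem_filter => /andP[zxy _].
have adj : adjacent z (pred2 x y) s.
  by exists a', y', b''; rewrite sE bE has_filter fy.
by case/orP: zxy => /eqP ez; rewrite ez in adj.
Qed.

Fixpoint altword x y n := if n is n'.+1 then x :: altword y x n' else [::].

Lemma size_altword x y n : size (altword x y n) = n.
Proof. by elim: n x y => //= n IHn x y; rewrite IHn. Qed.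

Lemma altwordSr x y n :
  altword x y n.+1 = rcons (altword x y n) (if odd n then y else x).
Proof.
elim: n x y => // n IHn x y.
rewrite -[LHS]/(x :: altword y x n.+1) IHn -[altword x y n.+1]/(x :: altword y x n).
by rewrite rcons_cons /=; case: (odd n).
Qed.

Lemma alternating_altword x y n : x != y -> alternating (altword x y n).
Proof.
case: n => // n; elim: n x y => // n IHn x y xy /=; rewrite xy.
by apply: (IHn y x); rewrite eq_sym.
Qed.

Lemma count_altword x y n : x != y ->
  count_mem x (altword x y n) = uphalf n /\ count_mem y (altword x y n) = n./2.
Proof.
elim: n x y => // n IHn x y xy /=; have [|c1 c2] := IHn y x; first by rewrite eq_sym.
by rewrite eqxx (negPf xy) c1 c2.
Qed.

Lemma alternating2P x y s : x != y -> all (pred2 x y) s -> alternating s ->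
  s = altword x y (size s) \/ s = altword y x (size s).
Proof.
elim: s x y => [|z s IHs] x y xy /=; first by left.
wlog zx : x y xy / z == x => [hw|].
  case/andP=> /orP[] zx all_s; first by apply: hw => //; rewrite zx all_s.
  move=> alt; rewrite or_comm; apply: (hw y x) => //; first by rewrite eq_sym.
  rewrite zx /=; apply: sub_all all_s => t /orP[]/eqP->; by rewrite /= eqxx ?orbT.
move=> /andP[_ all_s] alt; left; rewrite {z zx}(eqP zx) in alt *.
case: s => // z s in IHs all_s alt *.
move: alt; rewrite /alternating /= => /andP[xz alt].
have [e|e] := IHs x y xy all_s alt; last by rewrite {1}e.
by case: e xz => <-; rewrite eqxx.
Qed.

Lemma rev_altword x y n : rev (altword x y n) = if odd n then altword x y n else altword y x n.
Proof.
elim: n x y => // n IHn x y; rewrite [in LHS]altwordSr rev_rcons IHn /=.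
by case: (odd n).
Qed.

(* The palindromes that occur as subwords on two adjacent letters; the last two
   cases only matter for (a, b) = (0, 0), (2, 0) and (2, 2). *)
Definition pairword x y (a b : nat) :=
  if a == b.+1 then altword x y (a + b) else
  if b == a.+1 then altword y x (a + b) else
  if b == 0 then nseq a x else [:: y; x; x; y].

End SeqFacts.

Definition updown a b := [|| a == b.+1, b == a.+1 | (a == 0) && (b == 0)].

(** The pairs (2, 0) and (2, 2) occur at the end and inside of a run of doubled letters. *)
Definition wellpair a b := updown a b || (a == 2) && ((b == 0) || (b == 2)).

Section PairWord.
Variable T : eqType.
Implicit Types (x y : T) (s : seq T).

(** A nonempty alternating word of even length has different ends, so the length is odd or zero, and
    the letter at both ends occurs once more than the other. *)
Lemma alternating_palindrome x y s : x != y -> all (pred2 x y) s ->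
  alternating s -> rev s = s ->
  s = pairword x y (count_mem x s) (count_mem y s) /\
  updown (count_mem x s) (count_mem y s).
Proof.
move=> xy all_s alt pal.
have key z t : z != t -> s = altword z t (size s) ->
    s = [::] \/ odd (size s).
  move=> zt e; case: (boolP (odd (size s))) => [|/negbTE os]; first by right.
  move: pal; rewrite e rev_altword os; case: (size s) => [|n] /=; first by left.
  by case=> e'; rewrite e' eqxx in zt.
have [e|e] := alternating2P xy all_s alt.
  have [->|os] := key _ _ xy e; first by rewrite /pairword.
  have [c1 c2] := count_altword (size s) xy; rewrite -e in c1 c2.
  rewrite c1 c2 /pairword /updown.
  have -> : uphalf (size s) == (size s)./2.+1 by apply/eqP; lia.
  by split=> //; rewrite {1}e; congr altword; lia.
have yx : y != x by rewrite eq_sym.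
have [->|os] := key _ _ yx e; first by rewrite /pairword.
have [c1 c2] := count_altword (size s) yx; rewrite -e in c1 c2.
rewrite c1 c2 /pairword /updown.
have -> : ((size s)./2 == (uphalf (size s)).+1) = false by apply/eqP; lia.
have -> : uphalf (size s) == (size s)./2.+1 by apply/eqP; lia.
by split=> //; rewrite {1}e; congr altword; lia.
Qed.

Lemma pairword_alternating x y a b : x != y -> updown a b ->
  alternating (pairword x y a b).
Proof.
move=> xy; rewrite /updown /pairword; case: eqVneq => [_ _|_ /=].
  exact: alternating_altword.
case: eqVneq => [_ _|_ /= /andP[/eqP-> /eqP-> //]].
by apply: alternating_altword; rewrite eq_sym.
Qed.

Lemma rev_pairword x y a b : rev (pairword x y a b) = pairword x y a b.
Proof.
rewrite /pairword; case: eqVneq => [->|_]; first by rewrite rev_altword addSn /= oddD addbb.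
case: eqVneq => [->|_]; first by rewrite rev_altword addnS /= oddD addbb.
by case: eqVneq => // _; rewrite rev_nseq.
Qed.

Lemma all_pairword x y a b : all (pred2 x y) (pairword x y a b).
Proof.
have alt n : all (pred2 x y) (altword x y n) && all (pred2 x y) (altword y x n).
  by elim: n => //= n /andP[-> ->]; rewrite !eqxx orbT.
rewrite /pairword; case: ifP => _; first by case/andP: (alt (a + b)).
case: ifP => _; first by case/andP: (alt (a + b)).
case: ifP => _ /=; last by rewrite !eqxx orbT.
by rewrite all_nseq /= eqxx orbT.
Qed.

Lemma count_pairword x y a b : x != y -> wellpair a b ->
  count_mem x (pairword x y a b) = a /\ count_mem y (pairword x y a b) = b.
Proof.
move=> xy; have yx : y != x by rewrite eq_sym.
rewrite /wellpair /updown /pairword; case: eqVneq => [-> _|_ /=].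
  by have [-> ->] := count_altword (b.+1 + b) xy; split; lia.
case: eqVneq => [-> _|_ /=].
  by have [-> ->] := count_altword (a + a.+1) yx; split; lia.
case/orP=> [/andP[/eqP-> /eqP->] //|/andP[/eqP-> /orP[]/eqP->]] /=;
  by rewrite ?eqxx ?(negPf xy) ?(negPf yx).
Qed.

(** The exceptional words x x and y x x y repeat only the left letter x; all others alternate. *)
Lemma pairword_nosquare x y a b c d : x != y -> wellpair a b ->
  pairword x y a b <> c ++ [:: y; y] ++ d.
Proof.
move=> xy /orP[/(pairword_alternating xy) alt e|].
  by move: alt; rewrite e (negPf (alternating_square _ _ _)).
case/andP=> /eqP-> /orP[]/eqP-> e.
  have [_] := @count_pairword x y 2 0 xy isT.
  by rewrite e !count_cat /= eqxx; lia.
move: e; rewrite /pairword /= => e.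
have := congr1 size e; rewrite !size_cat /= => sz.
case: c e sz => [|? [|? [|? ?]]] /=; last by lia.
all: by case=> *; subst; rewrite eqxx in xy.
Qed.

End PairWord.

(** * Words on a path graph *)

Notation pairproj i V := (filter (pred2 i i.+1) V).

(* Simplification turns [Equality.sort nat] into [nat], which [lia] does not. *)
Ltac clia := simpl in *; lia.

Lemma count0_notin (i : nat) (s : seq nat) : count_mem i s = 0 -> i \notin s.
Proof. by move/count_memPn. Qed.

Lemma notin_count0 (i : nat) (s : seq nat) : i \notin s -> count_mem i s = 0.
Proof. by move/count_memPn. Qed.

(** The default 0 of [head] is the count of the absent letter after the last one, so the final
    height is 0 or 1. *)
Fixpoint pathok (v : seq nat) :=
  if v is h :: w then updown h (head 0 w) && pathok w else true.

(* The counts of the letters 1, 2, ... of a word containing j ... 1 0 1 ... j,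
   for j maximal: each of 1, ..., j occurs twice, and j + 1 occurs twice or never. *)
Fixpoint peakok (v : seq nat) :=
  if v is h :: w then
    (h == 2) && ((pathok w && ((head 0 w == 0) || (head 0 w == 2))) || peakok w)
  else false.

(** * Gaps, peaks and counts along a path *)

Section Tail.
Variables (N : nat) (V : seq nat).
Hypothesis ltVN : all (fun i => i < N) V.
(** In type B, r = 1, because the letter 1 only satisfies the weaker condition [gap_1]; in type D,
    after the leaves are merged, r = 0. *)
Variable r : nat.
Hypothesis r_le1 : r <= 1.
Hypothesis gap_ge2 : forall a X b i, r < i -> V = a ++ i :: X ++ i :: b ->
  i \notin X -> 1 < count_mem i.-1 X + count_mem i.+1 X.
Hypothesis gap_1 : forall a X b, V = a ++ 1 :: X ++ 1 :: b ->
  1 \notin X -> 0 \in X \/ 1 < count_mem 2 X.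

Lemma mem_lt i : i \in V -> i < N.
Proof. by move/(allP ltVN). Qed.

(** Without i, the gap would contain two letters i+2; by descending induction from N, an i+1 lies
    between two consecutive ones, hence inside the gap. *)
Lemma gap_left a X b i : V = a ++ i.+1 :: X ++ i.+1 :: b -> i.+1 \notin X -> i \in X.
Proof.
have [k le_k] : exists k, N <= i + k by exists N; apply: leq_addl.
elim: k i le_k a X b => [|k IHk] i le_k a X b VE iX.
  have : i.+1 \in V by rewrite VE mem_cat mem_head orbT.
  by move/mem_lt; lia.
apply/negPn/negP => niX.
have : 1 < count_mem i.+2 X.
  have c0 := notin_count0 niX.
  case: i => [|i] in le_k VE iX niX c0 *.
    by have [h|//] := gap_1 VE iX; rewrite h in niX.
  by have := gap_ge2 _ VE iX; rewrite /= c0; apply; lia.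
move=> /two_occurrences[A [Y [B [XE iY]]]].
have : i.+1 \in Y.
  apply: (IHk i.+1 _ (a ++ i.+1 :: A) Y (B ++ i.+1 :: b)) => //; first by lia.
  by rewrite VE XE -!catA /= -!catA.
by move=> h; move: iX; rewrite XE mem_cat inE mem_cat h !orbT.
Qed.

Lemma no_right a b i : V = a ++ i.+1 :: b -> i \notin b -> i.+1 \notin b.
Proof.
move=> VE ib; apply/negP => /first_occurrence[X [c [bE iX]]].
have : i \in X by apply: gap_left iX; rewrite VE bE.
by move=> h; move: ib; rewrite bE mem_cat h.
Qed.

Lemma no_left a b i : V = a ++ i.+1 :: b -> i \notin a -> i.+1 \notin a.
Proof.
move=> VE ia; apply/negP => /last_occurrence[c [X [aE iX]]].
have : i \in X by apply: (@gap_left c X b) => //; rewrite VE aE -catA.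
by move=> h; move: ia; rewrite aE mem_cat inE h !orbT.
Qed.

Lemma le1_between a X b i : V = a ++ X ++ b -> i \notin X -> count_mem i.+1 X <= 1.
Proof.
move=> VE iX; rewrite leqNgt; apply/negP => /two_occurrences[A [Y [B [XE iY]]]].
have : i \in Y by apply: (@gap_left (a ++ A) Y (B ++ b)) => //; rewrite VE XE -!catA /= -!catA.
by move=> h; move: iX; rewrite XE mem_cat inE mem_cat h !orbT.
Qed.

Definition peak i := adjacent i (pred2 i i.+1) V.

Lemma peak_pred i : r <= i -> peak i.+1 -> peak i.
Proof.
move=> ri [a [X [b [VE nX]]]].
have iX : i.+1 \notin X by apply: contra nX => h; apply/hasP; exists i.+1; rewrite //= eqxx.
have iiX : i.+2 \notin X by apply: contra nX => h; apply/hasP; exists i.+2; rewrite //= eqxx orbT.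
have := gap_ge2 _ VE iX; rewrite /= (notin_count0 iiX) addn0 => /(_ ri).
move=> /two_occurrences[A [Y [B [XE iY]]]].
exists (a ++ i.+1 :: A), Y, (B ++ i.+1 :: b).
rewrite VE XE -!catA /= -!catA; split=> //; apply/hasPn => z zY /=.
apply/norP; split; first by apply: contraNneq iY => <-.
by apply: contraNneq iX => <-; rewrite XE mem_cat inE mem_cat zY !orbT.
Qed.

Lemma nonpeak_alternating i : ~ peak i -> alternating (pairproj i V).
Proof.
move=> np; apply: alternating_filter2 => // -[a [X [b [VE nX]]]].
have iX : i.+1 \notin X by apply: contra nX => h; apply/hasP; exists i.+1; rewrite //= eqxx orbT.
by case/negP: nX; apply/hasP; exists i; rewrite /= ?eqxx // (gap_left VE iX).
Qed.

Local Notation c i := (count_mem i V).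

Lemma count_pairproj i : count_mem i (pairproj i V) = c i /\ count_mem i.+1 (pairproj i V) = c i.+1.
Proof.
by rewrite !count_filter; split; apply: eq_count => z /=;
  [case: (eqVneq z i)|case: (eqVneq z i.+1)]; rewrite ?orbT.
Qed.

Hypothesis palindromic : forall i, rev (pairproj i V) = pairproj i V.

Lemma nonpeak_pairproj i : ~ peak i ->
  pairproj i V = pairword i i.+1 (c i) (c i.+1) /\ updown (c i) (c i.+1).
Proof.
move=> /nonpeak_alternating alt.
have := alternating_palindrome _ (filter_all _ _) alt (palindromic i).
have [-> ->] := count_pairproj i; apply.
by rewrite neq_ltn ltnS leqnn.
Qed.

Lemma count_ge i : N <= i -> c i = 0.
Proof. by move=> le_Ni; apply/count_memPn/negP => /mem_lt; rewrite ltnNge le_Ni. Qed.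

Definition counts i m := [seq c k | k <- iota i m].

Lemma head_counts i m : i + m = N -> head 0 (counts i m) = c i.
Proof. by case: m => [|m] // iN; rewrite count_ge // -iN addn0. Qed.

Lemma pathok_counts i m : i + m = N ->
  (forall k, i <= k -> updown (c k) (c k.+1)) -> pathok (counts i m).
Proof.
elim: m i => //= m IHm i iN ud; rewrite head_counts ?addSnnS // ud // IHm ?addSnnS //.
by move=> k /ltnW; apply: ud.
Qed.

Lemma nonpeak_ge i : r <= i -> ~ peak i -> forall k, i <= k -> ~ peak k.
Proof.
move=> ri np k; elim: k => [|k IHk]; first by rewrite leqn0 => /eqP e; rewrite e in np.
rewrite leq_eqVlt => /orP[/eqP<- //|ik pk]; apply: IHk => //.
by apply: peak_pred => //; lia.
Qed.

(** If i+1 is a peak too, its gap contains both letters i, so no other i+1 exists and the projection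
    is (i+1) i i (i+1). Otherwise the run stops: at most one i+1 lies on each side of the two
    letters i, equally many by symmetry, and the projections alternate from i+1 on. *)
Lemma peak_counts i m : r <= i -> i + m = N -> peak i -> c i = 2 ->
  peakok (counts i m) /\
  forall k, i <= k -> pairproj k V = pairword k k.+1 (c k) (c k.+1).
Proof.
elim: m i => [|m IHm] i ri iN pk ci; first by move: ci; rewrite count_ge // -iN addn0.
have iN' : i.+1 + m = N by rewrite addSnnS.
rewrite /= ci eqxx head_counts //=.
have [pkS|npkS] := pselect (peak i.+1).
  have [a [X [b [VE nX]]]] := pkS.
  have iX : i.+1 \notin X by apply: contra nX => h; apply/hasP; exists i.+1; rewrite //= eqxx.
  have iiX : i.+2 \notin X by apply: contra nX => h; apply/hasP; exists i.+2; rewrite //= eqxx orbT.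
  have := gap_ge2 _ VE iX; rewrite /= (notin_count0 iiX) addn0 => /(_ ri) cX.
  have cV := ci; rewrite VE !count_cat /= !count_cat /= in cV.
  have ne : (i.+1 == i) = false by apply/eqP; lia.
  have ne' : (i == i.+1) = false by apply/eqP; lia.
  have nei : i != i.+1 by rewrite ne'.
  rewrite ne in cV.
  have ia : i \notin a by apply: count0_notin; clia.
  have ib : i \notin b by apply: count0_notin; clia.
  have iXbb : i.+1 \notin b.
    by apply: (@no_right (a ++ i.+1 :: X) b i) => //; rewrite VE -!catA.
  have ia' : i.+1 \notin a by apply: (no_left VE).
  have cX2 : count_mem i X = 2 by clia.
  have ciS : c i.+1 = 2.
    by rewrite VE !count_cat /= !count_cat /= !(notin_count0 _) // eqxx.
  have [pok pw] := IHm _ (leqW ri) iN' pkS ciS; rewrite pok orbT; split=> // k.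
  rewrite leq_eqVlt => /orP[/eqP<-|/pw //]; rewrite ci ciS.
  rewrite VE !filter_cat /= !filter_cat /= eqxx orbT (filter_notin2 ia ia') (filter_notin2 ib iXbb).
  by rewrite filter_notin_nseq // cX2 /pairword.
have npk := nonpeak_ge (leqW ri) npkS.
have path_ok : pathok (counts i.+1 m).
  by apply: pathok_counts => // k /npk/nonpeak_pairproj[].
have [a [X [b [VE nX]]]] := pk.
have ne : (i == i.+1) = false by apply/eqP; lia.
have nei : i != i.+1 by rewrite ne.
have cV := ci; rewrite VE !count_cat /= !count_cat /= eqxx in cV.
have ia : i \notin a by apply: count0_notin; clia.
have ib : i \notin b by apply: count0_notin; clia.
have ca : count_mem i.+1 a <= 1 by apply: (@le1_between [::] a _ i VE).
have cb : count_mem i.+1 b <= 1.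
  by apply: (@le1_between (a ++ i :: X ++ [:: i]) b [::] i) => //; rewrite VE cats0 -!catA /= -!catA.
have fX : filter (pred2 i i.+1) X = [::] by apply/eqP; rewrite -[_ == _]negbK -has_filter.
have swapp s : filter (pred2 i i.+1) s = filter (pred2 i.+1 i) s.
  by apply: eq_filter => z /=; rewrite orbC.
have fV : pairproj i V = nseq (count_mem i.+1 a) i.+1 ++ [:: i; i] ++ nseq (count_mem i.+1 b) i.+1.
  rewrite VE !filter_cat /= !filter_cat fX /= eqxx /=.
  by rewrite !swapp !filter_notin_nseq // eq_sym.
have cS : c i.+1 = count_mem i.+1 a + count_mem i.+1 b.
  have [_ <-] := count_pairproj i.
  by rewrite fV !count_cat !count_nseq /= eqxx ne; clia.
have cab : count_mem i.+1 a = count_mem i.+1 b.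
  have := palindromic i; rewrite fV !rev_cat !rev_nseq.
  by case: (count_mem i.+1 a) ca => [|[|//]] _; case: (count_mem i.+1 b) cb => [|[|//]] _ //= [] e; clia.
have cS' : (c i.+1 == 0) || (c i.+1 == 2) by clia.
rewrite path_ok cS'; split=> // k; rewrite leq_eqVlt => /orP[/eqP<-|/npk/nonpeak_pairproj[] //].
rewrite ci fV cS cab; case: (count_mem i.+1 b) cb => [|[|//]] _ //=.
Qed.

End Tail.

(** The head counts the letter 0. In the second alternative it is the single 0 in the middle of the
    factor j ... 1 0 1 ... j. *)
Definition okB (v : seq nat) :=
  pathok v || (if v is h :: w then (h == 1) && peakok w else false).

Section TypeB.
Variables (N : nat) (V : seq nat).
Hypothesis ltVN : all (fun i => i < N) V.
Hypothesis gap_ge2 : forall a X b i, 1 < i -> V = a ++ i :: X ++ i :: b ->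
  i \notin X -> 1 < count_mem i.-1 X + count_mem i.+1 X.
Hypothesis gap_1 : forall a X b, V = a ++ 1 :: X ++ 1 :: b ->
  1 \notin X -> 0 \in X \/ 1 < count_mem 2 X.
Hypothesis gap_0 : ~ adjacent 0 (pred2 0 1) V.
Hypothesis no1010 : forall a X Y Z b, V = a ++ 1 :: X ++ 0 :: Y ++ 1 :: Z ++ 0 :: b ->
  all (fun k => 2 < k) X -> all (fun k => 2 < k) Y -> all (fun k => 1 < k) Z -> False.
Hypothesis no0101 : forall a X Y Z b, V = a ++ 0 :: X ++ 1 :: Y ++ 0 :: Z ++ 1 :: b ->
  all (fun k => 1 < k) X -> all (fun k => 2 < k) Y -> all (fun k => 2 < k) Z -> False.
Hypothesis palindromic : forall i, rev (pairproj i V) = pairproj i V.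

Local Notation c i := (count_mem i V).

Lemma all_gt1 (X : seq nat) : 0 \notin X -> 1 \notin X -> all (fun k => 1 < k) X.
Proof. by move=> x0 x1; apply/allP => -[|[|k]] // kX; rewrite kX in x0 x1. Qed.

Lemma all_gt2 (X : seq nat) : 0 \notin X -> 1 \notin X -> 2 \notin X -> all (fun k => 2 < k) X.
Proof. by move=> x0 x1 x2; apply/allP => -[|[|[|k]]] // kX; rewrite kX in x0 x1 x2. Qed.

(** The 0 found by [gap_left] between the two letters 1 is single by [gap_0]. A 0 outside would
    complete these letters to 1010 or 0101 up to commutation. So 0 occurs once, and a further 1
    would need another 0 next to it. *)
Lemma peak1_counts : peak V 1 -> c 0 = 1 /\ c 1 = 2.
Proof.
case=> a [X [b [VE nX]]].
have x1 : 1 \notin X by apply: contra nX => h; apply/hasP; exists 1.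
have x2 : 2 \notin X by apply: contra nX => h; apply/hasP; exists 2.
have x0 := gap_left ltVN (leqnn 1) gap_ge2 gap_1 VE x1.
have [A [B [XE A0]]] := first_occurrence x0.
have B0 : 0 \notin B.
  apply/negP => /first_occurrence[Y [C [BE Y0]]]; apply: gap_0.
  exists (a ++ 1 :: A), Y, (C ++ 1 :: b); rewrite VE XE BE -!catA /= -?catA; split=> //.
  apply/hasPn => z zY /=; apply/norP; split; first by apply: contraNneq Y0 => <-.
  by apply: contraNneq x1 => <-; rewrite XE BE mem_cat inE mem_cat zY !orbT.
have [A1 B1] : 1 \notin A /\ 1 \notin B.
  by split; apply: contra x1 => h; rewrite XE mem_cat inE h ?orbT.
have [A2 B2] : 2 \notin A /\ 2 \notin B.
  by split; apply: contra x2 => h; rewrite XE mem_cat inE h ?orbT.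
have b0 : 0 \notin b.
  apply/negP => /first_occurrence[Z [d [bE Z0]]].
  apply: (no1010 (a := a) (X := A) (Y := B) (Z := Z) (b := d)).
  - by rewrite VE XE bE -!catA.
  - exact: all_gt2.
  - exact: all_gt2.
  (* A 1 in Z would be preceded by another 0 after the closing 1 of the peak, whereas Z ends at the
     first such 0. *)
  apply: all_gt1 => //; apply/negP => /first_occurrence[Z' [e [ZE Z'1]]].
  have : 0 \in Z'.
    apply: (gap_left ltVN (leqnn 1) gap_ge2 gap_1 (a := a ++ 1 :: X) (b := e ++ 0 :: d)) Z'1.
    by rewrite VE bE ZE -!catA /= -?catA.
  by move=> h; move: Z0; rewrite ZE mem_cat h.
have a0 : 0 \notin a.
  apply/negP => /last_occurrence[d [Z [aE Z0]]].
  apply: (no0101 (a := d) (X := Z) (Y := A) (Z := B) (b := b)).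
  - by rewrite VE XE aE -!catA.
  - apply: all_gt1 => //; apply/negP => /last_occurrence[e [Z' [ZE Z'1]]].
    have : 0 \in Z'.
      apply: (gap_left ltVN (leqnn 1) gap_ge2 gap_1 (a := d ++ 0 :: e) (b := X ++ 1 :: b)) Z'1.
      by rewrite VE aE ZE -!catA /= -?catA.
    by move=> h; move: Z0; rewrite ZE mem_cat inE h !orbT.
  - exact: all_gt2.
  - exact: all_gt2.
have b1 : 1 \notin b.
  by apply: (no_right ltVN (leqnn 1) gap_ge2 gap_1 (a := a ++ 1 :: X)) => //; rewrite VE -!catA.
have a1 : 1 \notin a by apply: (no_left ltVN (leqnn 1) gap_ge2 gap_1 VE).
rewrite VE XE; do 4?[rewrite !count_cat /=].
by rewrite !(notin_count0 _).
Qed.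

Lemma classification_B : okB (counts V 0 N) /\
  forall k, pairproj k V = pairword k k.+1 (c k) (c k.+1).
Proof.
have [p0 u0] := nonpeak_pairproj ltVN (leqnn 1) gap_ge2 gap_1 palindromic gap_0.
have [pk1|npk1] := pselect (peak V 1).
  have [c0 c1] := peak1_counts pk1.
  case: N ltVN => [|n] ltVN'.
    by move: pk1 ltVN' => [a [X [b [-> _]]]]; rewrite all_cat /= andbF.
  have [ok pw] := peak_counts ltVN' (leqnn 1) gap_ge2 gap_1 palindromic (leqnn 1) (add1n n) pk1 c1.
  split; first by rewrite /okB /= c0 /= ok orbT.
  by case=> // k; apply: pw.
have npk k : ~ peak V k.
  by case: k => // k; apply: (nonpeak_ge ltVN (leqnn 1) gap_ge2 (leqnn 1) npk1); apply: ltn0Sn.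
split=> [|k]; last by have [] := nonpeak_pairproj ltVN (leqnn 1) gap_ge2 gap_1 palindromic (@npk k).
rewrite /okB (pathok_counts ltVN) // => k _.
by have [] := nonpeak_pairproj ltVN (leqnn 1) gap_ge2 gap_1 palindromic (@npk k).
Qed.

End TypeB.

(** U and p are merged along their common letter i. Each i+1 may go anywhere between the prescribed
    letters i, since the projections on lower pairs ignore it. *)
Lemma insert_letter i U p : all (fun k => k <= i) U -> all (pred2 i i.+1) p ->
  count_mem i p = count_mem i U -> exists U',
  [/\ all (fun k => k <= i.+1) U', filter (fun k => k <= i) U' = U & pairproj i U' = p].
Proof.
have ne : (i.+1 == i) = false by apply/eqP; lia.
have small a : all (fun k => k <= i) a -> i \notin a -> pairproj i a = [::].
  move=> all_a ia; apply: filter_notin2 => //.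
  by apply/negP => /(allP all_a); rewrite ltnn.
have wide a : all (fun k => k <= i) a -> all (fun k => k <= i.+1) a.
  by apply: sub_all => k; apply: leqW.
elim: p U => [|x p IHp] U all_U /=.
  move=> _ /esym/count0_notin iU; exists U; split; first exact: wide.
    exact/all_filterP.
  exact: small.
case/andP=> /orP[]/eqP-> all_p; rewrite ?eqxx ?ne ?add0n ?add1n => cU.
  have iU : i \in U by rewrite -has_pred1 has_count -cU.
  have [a [b [UE ia]]] := first_occurrence iU; rewrite {U iU}UE in all_U cU *.
  move: all_U; rewrite all_cat /= => /and3P[all_a _ all_b].
  have [|U' [all_U' fU' pU']] := IHp b all_b all_p.
    by move: cU; rewrite count_cat /= eqxx (notin_count0 ia); clia.
  exists (a ++ i :: U'); split.
  - by rewrite all_cat /= all_U' wide //= leqW.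
  - by rewrite filter_cat /= leqnn fU'; congr (_ ++ _); apply/all_filterP.
  - by rewrite filter_cat /= eqxx pU' small.
have [U' [all_U' fU' pU']] := IHp U all_U all_p cU.
exists (i.+1 :: U'); split; first by rewrite /= leqnn.
  by rewrite /= ltnn.
by rewrite /= eqxx orbT pU'.
Qed.

Lemma filter_pair_le k i (U : seq nat) : k < i ->
  pairproj k (filter (fun j => j <= i) U) = pairproj k U.
Proof.
move=> ki; rewrite -filter_predI; apply: eq_filter => z /=.
by case: eqVneq => [->|_] /=; [lia|case: eqVneq => // ->].
Qed.

(** Letters above k0 are inserted one value at a time. The starting word U0 is left free to
    accommodate the fork, with k0 = 2 in type D; types A and B start from k0 = 0. *)
Lemma realize_pairs (c : nat -> nat) k0 N U0 : k0 <= N ->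
  all (fun k => k <= k0) U0 -> count_mem k0 U0 = c k0 ->
  (forall k, k0 <= k -> wellpair (c k) (c k.+1)) -> (forall k, N <= k -> c k = 0) ->
  exists U, [/\ all (fun k => k < N) U, filter (fun k => k <= k0) U = U0,
    forall k, k0 <= k -> count_mem k U = c k &
    forall k, k0 <= k -> pairproj k U = pairword k k.+1 (c k) (c k.+1)].
Proof.
move=> le_k0N all_U0 cU0 wp cN.
have [m mN] : exists m, k0 + m = N by exists (N - k0); lia.
have : exists U, [/\ all (fun k => k <= k0 + m) U, filter (fun k => k <= k0) U = U0,
    forall k, k0 <= k <= k0 + m -> count_mem k U = c k &
    forall k, k0 <= k < k0 + m -> pairproj k U = pairword k k.+1 (c k) (c k.+1)].
  elim: (m) => [|j [U [all_U fU cU pU]]].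
    exists U0; rewrite addn0; split=> //; first exact/all_filterP.
      by move=> k /anti_leq <-.
    by move=> k; lia.
  pose i := k0 + j; have ne : i != i.+1 by apply/eqP; lia.
  have wi : wellpair (c i) (c i.+1) by apply: wp; apply: leq_addr.
  have [ci ciS] := count_pairword ne wi.
  have [|U' [all_U' fU' pU']] := insert_letter all_U (all_pairword i i.+1 (c i) (c i.+1)).
    by rewrite ci cU // leq_addr leqnn.
  have pU'' k : k0 <= k < k0 + j.+1 -> pairproj k U' = pairword k k.+1 (c k) (c k.+1).
    rewrite addnS ltnS => /andP[k0k]; rewrite leq_eqVlt => /orP[/eqP-> //|lt_k].
    by rewrite -(@filter_pair_le k (k0 + j)) // fU' pU // k0k.
  exists U'; rewrite addnS; split=> //.
  - rewrite -fU -fU' -filter_predI; apply: eq_filter => z /=.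
    by case: leqP => //= h; apply/esym/(leq_trans h)/leq_addr.
  - move=> k /andP[k0k]; rewrite leq_eqVlt => /orP[/eqP->|].
      by have [_ <-] := count_pairproj U' i; rewrite pU'.
    rewrite ltnS => kj; rewrite -cU ?k0k // -fU' count_filter.
    by apply: eq_count => z /=; case: eqVneq => // ->; rewrite kj.
  - by move=> k h; apply: pU''; rewrite addnS.
rewrite mN => -[U [all_U fU cU pU]].
have ltU : all (fun k => k < N) U.
  have : N \notin U by apply: count0_notin; rewrite cU ?cN ?leqnn ?andbT.
  move=> NU; apply/allP => k kU; rewrite ltn_neqAle (allP all_U _ kU) andbT.
  by apply: contraNneq NU => <-.
have cU0' k : N <= k -> count_mem k U = 0.
  by move=> Nk; apply: notin_count0; apply/negP => /(allP ltU); rewrite ltnNge Nk.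
exists U; split=> // k k0k; have [kN|Nk] := ltnP k N.
- by rewrite cU // k0k ltnW.
- by rewrite cU0' // cN.
- by rewrite pU // k0k.
rewrite !cN ?leqW //; apply: filter_notin2; apply: count0_notin; apply: cU0' => //.
exact: leqW.
Qed.

Lemma pathok_updown v k : pathok v -> updown (nth 0 v k) (nth 0 v k.+1).
Proof.
elim: v k => [|h w IHw] k /=; first by rewrite nth_nil.
by case/andP=> ud pw; case: k => [|k] /=; [rewrite nth0|apply: IHw].
Qed.

Lemma tail_wellpair w k : pathok w || peakok w -> wellpair (nth 0 w k) (nth 0 w k.+1).
Proof.
elim: w k => [|h w IHw] k; first by rewrite /= nth_nil.
case/orP=> [/pathok_updown ud|/= /andP[/eqP-> hw]]; first by rewrite /wellpair ud.
case: k => [|k] /=; last by apply: IHw; case/orP: hw => [/andP[->]|->]; rewrite ?orbT.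
rewrite nth0 /wellpair; case/orP: hw => [/andP[_ ->]|]; first by rewrite orbT.
by case: w {IHw} => //= h' w /andP[/eqP->].
Qed.

(** A pair violating [updown] starts inside the run of 2s at the head of w, and so the preceding
    entry belongs to that run as well. *)
Lemma tail_not_updown w k : pathok w || peakok w ->
  ~~ updown (nth 0 w k.+1) (nth 0 w k.+2) -> nth 0 w k = 2.
Proof.
elim: w k => [|h w IHw] k; first by rewrite /= !nth_nil.
case/orP=> [/pathok_updown ->//|/= /andP[/eqP-> hw]]; case: k => [|k] //=.
by apply: IHw; case/orP: hw => [/andP[->]|->]; rewrite ?orbT.
Qed.

(** Such a factor puts a square of i+1 into the projection on {i+1, i+2}, so the counts are
    exceptional and c0 = c1 = 2. Then the projection on {i, i+1} is (i+1) i i (i+1), where two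
    letters i separate the letters i+1. *)
Lemma no_factor_left_pair V i a b c0 c1 c2 :
  pairproj i V = pairword i i.+1 c0 c1 ->
  pairproj i.+1 V = pairword i.+1 i.+2 c1 c2 ->
  wellpair c1 c2 -> (~~ updown c1 c2 -> c0 = 2) -> V <> a ++ [:: i.+1; i; i.+1] ++ b.
Proof.
move=> p0 p1 wp c0E VE.
have [e1 e2] : (i == i.+1) = false /\ (i == i.+2) = false by split; apply/eqP; lia.
have ne : i.+1 != i.+2 by apply/eqP; lia.
have nud : ~~ updown c1 c2.
  apply/negP => /(pairword_alternating ne); rewrite -p1 {1}VE !filter_cat /= e1 e2 eqxx.
  by rewrite (negPf (alternating_square _ _ _)).
have c12 : c1 = 2 by move: wp; rewrite /wellpair (negPf nud) /= => /andP[/eqP].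
move: p0; rewrite c0E // c12 /pairword /= => e.
have := e; rewrite {1}VE !filter_cat /= !eqxx !orbT.
have := congr1 size e; rewrite {1}VE !filter_cat /= !eqxx !orbT !size_cat /= => sz.
case: (pairproj i a) sz => [|? [|? ?]] /=; last by lia.
  by move=> _ [] *; clia.
by move=> _ [] *; clia.
Qed.

(** * Exclusion of forbidden factors from the projections; entry k of w counts the letter k+1 *)

Section NoBadFactor.
Variables (V : seq nat) (w : seq nat).
Local Notation c k := (nth 0 w k).
Hypothesis w_ok : pathok w || peakok w.
Hypothesis pairs : forall k, pairproj k.+1 V = pairword k.+1 k.+2 (c k) (c k.+1).
Hypothesis pair0 : forall a b, pairproj 0 V <> a ++ [:: 1; 1] ++ b.

Lemma no_right_square i a b : pairproj i V <> a ++ [:: i.+1; i.+1] ++ b.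
Proof.
case: i a b => [|i] a b; first exact: pair0.
rewrite pairs; apply: pairword_nosquare; last exact: tail_wellpair.
by apply/eqP; lia.
Qed.

Lemma no_factor_ii i a b : V <> a ++ [:: i.+1; i.+1] ++ b.
Proof.
move=> VE; apply: (@no_right_square i (pairproj i a) (pairproj i b)).
by rewrite {1}VE !filter_cat /= eqxx orbT.
Qed.

Lemma no_factor_right i a b : V <> a ++ [:: i.+1; i.+2; i.+1] ++ b.
Proof.
move=> VE; apply: (@no_right_square i (pairproj i a) (pairproj i b)).
have [e1 e2] : (i.+2 == i) = false /\ (i.+2 == i.+1) = false by split; apply/eqP; lia.
by rewrite {1}VE !filter_cat /= e1 e2 eqxx orbT.
Qed.

Lemma square_not_updown i a b : pairproj i.+1 V = a ++ [:: i.+1; i.+1] ++ b ->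
  ~~ updown (c i) (c i.+1).
Proof.
rewrite pairs => e; apply/negP => ud.
have ne : i.+1 != i.+2 by apply/eqP; lia.
by move: (pairword_alternating ne ud); rewrite e (negPf (alternating_square _ _ _)).
Qed.

Lemma no_factor_left i a b : V <> a ++ [:: i.+2; i.+1; i.+2] ++ b.
Proof.
apply: no_factor_left_pair (pairs i) (pairs i.+1) _ _; first exact: tail_wellpair.
exact: tail_not_updown.
Qed.

End NoBadFactor.

(** * From words to Coxeter groups *)

Lemma map_eq_cat (T1 T2 : Type) (f : T1 -> T2) u a x b : map f u = a ++ x :: b ->
  exists a' x' b', [/\ u = a' ++ x' :: b', map f a' = a, f x' = x & map f b' = b].
Proof.
elim: u a => [|y u IHu] [|z a] //= [e1 e2]; first by exists [::], y, u.
by have [a' [x' [b' [-> <- <- <-]]]] := IHu _ e2; exists (y :: a'), x', b'; rewrite -e1.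
Qed.

Lemma sumn_counts V i m : all (fun k => i <= k < i + m) V -> sumn (counts V i m) = size V.
Proof.
rewrite sumnE big_map; elim: V => [|x V IHV] /=; first by rewrite big1.
case/andP=> xm /IHV <-; rewrite big_split /= -add1n; congr (_ + _).
under eq_bigr do rewrite eq_sym.
have -> : (\sum_(k <- iota i m) (k == x))%N = count_mem x (iota i m).
  by rewrite -sum1_count [RHS]big_mkcond /=; apply: eq_bigr => k _; case: (k == x).
by rewrite count_uniq_mem ?iota_uniq // mem_iota xm.
Qed.

Definition natm (lab : nat -> nat -> nat) i j :=
  if i == j then 1 else lab (minn i j) (maxn i j).

Section Bridge.
Variables (n : nat) (M : coxeter_matrix 'I_n) (f : 'I_n -> nat) (m : nat -> nat -> nat).
Hypothesis f_inj : injective f.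
Hypothesis Mm : forall s t, M s t = m (f s) (f t).
Implicit Types (u v : seq 'I_n).

Local Notation "u ~~> v" := (commutation_equiv M u v) (at level 70).
Local Notation commutes s := (all (fun r => m s r == 2)).

Lemma commutes_map s X : all (fun r => M s r == 2) X = commutes (f s) (map f X).
Proof. by rewrite all_map; apply: eq_all => r /=; rewrite Mm. Qed.

Lemma nat_gap1 u a X b s : good M u -> map f u = a ++ s :: X ++ s :: b ->
  ~~ commutes s X.
Proof.
move=> gu h; have [a' [s' [r [uE _ sE h1]]]] := map_eq_cat h.
have [X' [t [b' [rE XE e _]]]] := map_eq_cat h1; rewrite -XE.
move: (esym e); rewrite -sE => /f_inj {}e; rewrite -commutes_map.
by rewrite uE rE -e in gu; apply: good_gap1 gu.
Qed.

Lemma nat_gap2 u a X Y b s t : good M u -> map f u = a ++ s :: X ++ t :: Y ++ s :: b ->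
  m s t = 3 -> commutes s X -> commutes s Y -> False.
Proof.
move=> gu h; have [a' [s' [r [uE _ sE h1]]]] := map_eq_cat h.
have [X' [t' [r' [rE XE tE h2]]]] := map_eq_cat h1; rewrite -XE.
have [Y' [s2 [b' [r'E YE e _]]]] := map_eq_cat h2; rewrite -YE.
move: (esym e); rewrite -sE -tE => /f_inj {}e; rewrite -!commutes_map -Mm => st sX sY.
by rewrite uE rE r'E -e in gu; apply: good_gap2 gu st sX sY.
Qed.

Lemma nat_gap3 u a X Y Z b s t : good M u ->
  map f u = a ++ s :: X ++ t :: Y ++ s :: Z ++ t :: b -> m s t = 4 ->
  commutes s X -> commutes s Y -> commutes t Y -> commutes t Z -> False.
Proof.
move=> gu h; have [a' [s' [r [uE _ sE h1]]]] := map_eq_cat h.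
have [X' [t' [r' [rE XE tE h2]]]] := map_eq_cat h1; rewrite -XE.
have [Y' [s2 [r2 [r'E YE e h3]]]] := map_eq_cat h2; rewrite -YE.
have [Z' [t2 [b' [r2E ZE e' _]]]] := map_eq_cat h3; rewrite -ZE.
move: (esym e) (esym e'); rewrite -sE -tE => /f_inj {}e /f_inj {}e'.
rewrite -!commutes_map -Mm => st sX sY tY tZ.
by rewrite uE rE r'E r2E -e -e' in gu; apply: good_gap3 gu st sX sY tY tZ.
Qed.

Lemma nat_gap_count u a X b s : good M u -> map f u = a ++ s :: X ++ s :: b ->
  (forall r, r \in X -> m s r != 2 -> m s r = 3) ->
  1 < count (fun r => m s r != 2) X.
Proof.
move=> gu uE lab3; rewrite ltn_neqAle; apply/andP; split; last first.
  rewrite -has_count; have := nat_gap1 gu uE; rewrite -has_predC.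
  by apply: sub_has.
apply/negP => /eqP/esym c1.
have /hasP[t tX mt] : has (fun r => m s r != 2) X by rewrite has_count c1.
case/splitPr: {X}tX => A B in uE lab3 c1 *.
move: c1; rewrite count_cat /= mt => c1.
have cA : count (fun r => m s r != 2) A = 0 by lia.
have cB : count (fun r => m s r != 2) B = 0 by lia.
apply: (@nat_gap2 u a A B b s t gu).
- by rewrite uE -!catA.
- by apply: lab3 => //; rewrite mem_cat mem_head orbT.
- by apply/negPn; rewrite -has_predC has_count (eq_count (a2 := fun r => m s r != 2)) ?cA.
- by apply/negPn; rewrite -has_predC has_count (eq_count (a2 := fun r => m s r != 2)) ?cB.
Qed.

Lemma palindromic_filter u (p : pred nat) : u ~~> rev u ->
  (forall x y, p x -> p y -> m x y <> 2) ->
  rev (filter p (map f u)) = filter p (map f u).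
Proof.
move=> uru pm; rewrite filter_map -map_rev -filter_rev; congr map.
by symmetry; apply: comm_filter uru => s t ps pt; rewrite Mm; apply: pm.
Qed.

Lemma comm_of_filters u v :
  (forall x y, m x y <> 2 -> filter (pred2 x y) (map f u) = filter (pred2 x y) (map f v)) ->
  u ~~> v.
Proof.
move=> h; apply: commP => s t; rewrite Mm => /h; rewrite !filter_map => /(inj_map f_inj).
have e w : [seq x <- w | preim f (pred2 (f s) (f t)) x] = [seq x <- w | pred2 s t x].
  by apply: eq_filter => z /=; rewrite !(inj_eq f_inj).
by rewrite !e.
Qed.

Lemma filters_of_comm u v (p : pred nat) : u ~~> v ->
  (forall x y, p x -> p y -> m x y <> 2) -> filter p (map f u) = filter p (map f v).
Proof.
move=> uv pm; rewrite !filter_map; congr map.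
by apply: comm_filter uv => s t ps pt; rewrite Mm; apply: pm.
Qed.

Lemma nat_bad_factor v : bad_factor M v -> exists a b s t,
  [\/ map f v = a ++ [:: s; s] ++ b,
      m s t = 3 /\ map f v = a ++ [:: s; t; s] ++ b |
      m s t = 4 /\ map f v = a ++ [:: s; t; s; t] ++ b].
Proof.
case=> a [b [s [t h]]]; exists (map f a), (map f b), (f s), (f t).
rewrite -Mm; case: h => [->|[st ->]|[st ->]]; rewrite !map_cat /=.
- by constructor 1.
- by constructor 2.
- by constructor 3.
Qed.

Lemma counts_comm u v i k : u ~~> v -> counts (map f u) i k = counts (map f v) i k.
Proof.
move=> /comm_perm uv; rewrite /counts; apply: eq_map => j.
by apply/permP; apply: perm_map.
Qed.

End Bridge.

Lemma natm_B i j : natm B_label i j =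
  if i == j then 1 else if (j == i.+1) || (i == j.+1) then
    (if (i == 0) || (j == 0) then 4 else 3) else 2.
Proof.
rewrite /natm /B_label; case: (ltngtP i j) => [ij|ji|//].
  have -> : (i == j.+1) = false by lia.
  have -> : (j == 0) = false by lia.
  by rewrite !orbF.
have -> : (j == i.+1) = false by lia.
by have -> : (i == 0) = false by lia.
Qed.

Lemma count_neighbours_B i (X : seq nat) : i \notin X ->
  count (fun r => natm B_label i r != 2) X =
  (if i == 0 then 0 else count_mem i.-1 X) + count_mem i.+1 X.
Proof.
elim: X => [|x X IHX] /=; first by case: eqP.
rewrite inE negb_or => /andP[ix /IHX ->]; rewrite natm_B (negPf ix).
have -> : ((if (x == i.+1) || (i == x.+1) then
  if (i == 0) || (x == 0) then 4 else 3 else 2) != 2) = (x == i.+1) || (i == x.+1).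
  by do 2?case: ifP.
case: (eqVneq i 0) => [->|i0] /=; first by rewrite orbF; lia.
have -> : (i == x.+1) = (x == i.-1) by lia.
case: (eqVneq x i.+1) => [->|_] /=; last by lia.
have -> : (i.+1 == i.-1) = false by lia.
lia.
Qed.

Lemma natm_B_neq2 x y : (natm B_label x y == 2) = ~~ [|| x == y, y == x.+1 | x == y.+1].
Proof. by rewrite natm_B; do 3?case: ifP => //=. Qed.

Lemma pairproj_filters V V' : (forall k, pairproj k V = pairproj k V') ->
  forall x y, natm B_label x y <> 2 -> filter (pred2 x y) V = filter (pred2 x y) V'.
Proof.
move=> h x y /eqP; rewrite natm_B_neq2 negbK.
have sw (a b : nat) W : filter (pred2 a b) W = filter (pred2 b a) W.
  by apply: eq_filter => z /=; rewrite orbC.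
case/or3P=> /eqP e; rewrite ?e //; last by rewrite !(sw y.+1).
have d (W : seq nat) : filter (pred2 y y) W = filter (pred1 y) (pairproj y W).
  by rewrite -filter_predI; apply: eq_filter => z /=; case: (z == y).
by rewrite !d h.
Qed.

Lemma okB_tail v : okB v -> pathok (behead v) || peakok (behead v).
Proof.
by case: v => //= h w /orP[/= /andP[_ ->]//|/andP[_ ->]]; rewrite orbT.
Qed.

Lemma okB_head v : okB v -> updown (nth 0 v 0) (nth 0 v 1).
Proof.
case: v => //= h w; rewrite nth0 => /orP[/= /andP[]//|/andP[/eqP->]].
by case: w => //= a w /andP[/eqP->].
Qed.

Lemma okB_wellpair v k : okB v -> wellpair (nth 0 v k) (nth 0 v k.+1).
Proof.
case: k => [|k] ok; first by rewrite /wellpair okB_head.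
by rewrite -[nth 0 v k.+1]nth_behead -[nth 0 v k.+2]nth_behead; apply/tail_wellpair/okB_tail.
Qed.

Lemma okB_peak v : okB v -> ~~ updown (nth 0 v 1) (nth 0 v 2) -> nth 0 v 0 = 1.
Proof.
case: v => //= h w /orP[pw|/andP[/eqP-> //]].
by have := pathok_updown 1 pw => /= ->.
Qed.

(* For e = 1 the letter 0 is never used, which leaves a group of type A. *)
Section TypesAB.
Variables (n e : nat) (M : coxeter_matrix 'I_n).
Hypothesis HM : forall s t, M s t = natm B_label (s + e) (t + e).
Implicit Types (u v : seq 'I_n).

Let f (s : 'I_n) := s + e.

Let f_inj : injective f.
Proof. by move=> s t /addIn/val_inj. Qed.

Local Notation "u ~~> v" := (commutation_equiv M u v) (at level 70).

Lemma AB_labels s t : s != t -> M s t \in [:: 2; 3; 4].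
Proof.
move=> st; have st' : (nat_of_ord s == t) = false := negbTE st.
rewrite HM natm_B eqn_add2r st'.
by do 2?case: ifP.
Qed.

Lemma AB_classification u : good M u -> u ~~> rev u ->
  okB (counts (map f u) 0 (e + n)) /\
  forall k, pairproj k (map f u) =
    pairword k k.+1 (count_mem k (map f u)) (count_mem k.+1 (map f u)).
Proof.
move=> gu uru.
have comm_gt2 X : all (fun k => 2 < k) X -> all (fun r => natm B_label 1 r == 2) X.
  by apply: sub_all => k; rewrite natm_B_neq2; lia.
have comm_gt1 X : all (fun k => 1 < k) X -> all (fun r => natm B_label 0 r == 2) X.
  by apply: sub_all => k; rewrite natm_B_neq2; lia.
have comm_gt1' X : all (fun k => 2 < k) X -> all (fun r => natm B_label 0 r == 2) X.
  by apply: sub_all => k; rewrite natm_B_neq2; lia.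
apply: classification_B.
- by apply/allP => _ /mapP[s _ ->]; rewrite /f addnC ltn_add2l.
- move=> a X b i i1 VE iX.
  have := nat_gap_count f_inj HM gu VE; rewrite count_neighbours_B //.
  have -> : (i == 0) = false by lia.
  apply=> r rX; rewrite natm_B.
  have -> : (i == r) = false by apply/negbTE; apply: contraNneq iX => ->.
  case: ifP => // ri _.
  have -> : (i == 0) = false by lia.
  by have -> : (r == 0) = false by lia.
- move=> a X b VE X1; have [X0|X0] := boolP (0 \in X); [by left|right].
  have := nat_gap_count f_inj HM gu VE; rewrite count_neighbours_B //= (notin_count0 X0).
  apply=> r rX; rewrite natm_B.
  have -> : (1 == r) = false by apply/negbTE; apply: contraNneq X1 => ->.
  case: ifP => // ri _ /=.
  by case: eqVneq rX => // -> rX; rewrite rX in X0.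
- move=> [a [X [b [VE nX]]]]; case/negP: (nat_gap1 f_inj HM gu VE).
  apply: sub_all (_ : all (predC (pred2 0 1)) X); last by rewrite all_predC.
  by move=> z; rewrite natm_B_neq2 /=; lia.
- move=> a X Y Z b VE X2 Y2 Z1; apply: (nat_gap3 f_inj HM gu VE) => //;
  [exact: comm_gt2|exact: comm_gt2|exact: comm_gt1'|exact: comm_gt1].
- move=> a X Y Z b VE X1 Y2 Z2; apply: (nat_gap3 f_inj HM gu VE) => //;
  [exact: comm_gt1|exact: comm_gt1'|exact: comm_gt2|exact: comm_gt2].
- move=> i; apply: (palindromic_filter HM uru) => x y xi yi /eqP.
  by rewrite natm_B_neq2; move: xi yi => /=; lia.
Qed.

(** Projections on adjacent letters are invariants of the commutation class, so it suffices to
    exclude forbidden factors from any word having these projections. *)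
Lemma AB_good u (v : seq nat) : okB v ->
  (forall k, pairproj k (map f u) = pairword k k.+1 (nth 0 v k) (nth 0 v k.+1)) ->
  good M u /\ u ~~> rev u.
Proof.
move=> ok pairs; split; last first.
  apply: (comm_of_filters f_inj HM); apply: pairproj_filters => k.
  by rewrite map_rev filter_rev pairs rev_pairword.
move=> u' uu' /(nat_bad_factor HM).
have {}pairs k : pairproj k (map f u') = pairword k k.+1 (nth 0 v k) (nth 0 v k.+1).
  rewrite -pairs; apply/esym/(filters_of_comm HM uu') => x y xi yi /eqP.
  by rewrite natm_B_neq2; move: xi yi => /=; lia.
move: {uu' u}(map f u') pairs => V pairs.
have alt0 : alternating (pairproj 0 V) by rewrite pairs pairword_alternating ?okB_head.
have pair0 a x b : pairproj 0 V <> a ++ [:: x; x] ++ b.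
  by move=> E; move: alt0; rewrite E (negPf (alternating_square _ _ _)).
have tl := okB_tail ok.
have pairsS k : pairproj k.+1 V =
    pairword k.+1 k.+2 (nth 0 (behead v) k) (nth 0 (behead v) k.+1).
  by rewrite pairs !nth_behead.
have c0 : count_mem 0 V = nth 0 v 0.
  have [<- _] := count_pairproj V 0; rewrite pairs.
  by have [] := @count_pairword _ 0 1 _ _ isT (okB_wellpair 0 ok).
have peak1 a b : pairproj 1 V = a ++ [:: 1; 1] ++ b -> count_mem 0 V = 1.
  move=> /(square_not_updown tl pairsS); rewrite !nth_behead c0; exact: okB_peak.
case=> a [b [s [t h]]]; case: h => [VE|[st VE]|[st VE]].
- case: s VE => [|i]; last by move/(no_factor_ii tl pairsS (fun a => @pair0 a 1)).
  by move=> VE; apply: (pair0 (pairproj 0 a) 0 (pairproj 0 b)); rewrite {1}VE !filter_cat.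
- move: st; rewrite natm_B; case: eqVneq => // _; case: ifP => // ts; case: ifP => // st0 _.
  case: s st0 ts VE => [|s] //; case: t => [|t]; rewrite ?orbT //= => _.
  rewrite !eqSS => /orP[]/eqP ->; first exact: (no_factor_right tl pairsS (fun a => @pair0 a 1)).
  exact: (no_factor_left tl pairsS).
- move: st; rewrite natm_B; case: eqVneq => // _; case: ifP => // ts; case: ifP => // st0 _.
  (* The label 4 only belongs to {0, 1}. A factor 0101 or 1010 contains two letters 0 and leaves a
     square 11 in the projection on {1, 2}, but such a square allows only one 0. *)
  have cc : 1 < count_mem 0 V.
    rewrite VE !count_cat /=; case: s t ts st0 {VE} => [|[|s]] [|[|t]] //=; lia.
  suff : count_mem 0 V = 1 by move=> c1; rewrite c1 in cc.
  case: s t ts st0 VE => [|[|s]] [|[|t]] //= _ _ VE.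
  - apply: (peak1 (pairproj 1 a) (pairproj 1 b)).
    by rewrite {1}VE !filter_cat /=.
  - apply: (peak1 (pairproj 1 a) (pairproj 1 b)).
    by rewrite {1}VE !filter_cat /=.
Qed.

Lemma seq_of_nat V : all (fun k => e <= k < e + n) V -> exists u, map f u = V.
Proof.
elim: V => [|k V IHV] /=; first by exists [::].
case/andP=> kn /IHV[u <-]; have kn' : k - e < n by lia.
by exists (Ordinal kn' :: u); rewrite /= /f /= subnK //; case/andP: kn.
Qed.

Lemma mem_f u : all (fun k => e <= k < e + n) (map f u).
Proof.
by apply/allP => _ /mapP[s _ ->]; rewrite /f leq_addl addnC ltn_add2l ltn_ord.
Qed.

Lemma counts_nseq u : counts (map f u) 0 (e + n) = nseq e 0 ++ counts (map f u) e n.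
Proof.
rewrite /counts iotaD map_cat; congr (_ ++ _).
apply: (@eq_from_nth _ 0) => [|k]; rewrite size_map size_iota ?size_nseq // => ke.
rewrite (nth_map 0) ?size_iota // nth_iota // nth_nseq ke.
by apply: notin_count0; apply/negP => /(allP (mem_f u)); lia.
Qed.

Lemma gf_AB (L : seq (seq nat)) : uniq L ->
  (forall v : seq nat, v \in L <-> size v = n /\ okB (nseq e 0 ++ v)) ->
  fc_involution_gf M = (\sum_(v <- L) q ^+ sumn v)%R.
Proof.
move=> uniqL memL.
apply: (fc_involution_gfE AB_labels (code := fun u => counts (map f u) e n)) => //.
- by move=> u v uv; apply: (counts_comm f e n uv).
- by move=> u; rewrite sumn_counts ?mem_f // size_map.
- move=> u gu uru; apply/memL; rewrite size_map size_iota; split=> //.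
  by rewrite -counts_nseq; have [] := AB_classification gu uru.
- move=> u v gu uru gv vrv /(congr1 (cat (nseq e 0))); rewrite -!counts_nseq => cc.
  apply: (comm_of_filters f_inj HM); apply: pairproj_filters => k.
  have [_ ->] := AB_classification gu uru; have [_ ->] := AB_classification gv vrv.
  have ck j : count_mem j (map f u) = count_mem j (map f v).
    have [je|je] := ltnP j (e + n).
      have := congr1 (fun s => nth 0 s j) cc.
      by rewrite !(nth_map 0) ?size_iota // !nth_iota.
    by rewrite !notin_count0 //; apply/negP => /(allP (mem_f _)); lia.
  by rewrite !ck.
- move=> c /memL[sz ok]; set w := nseq e 0 ++ c in ok.
  have szw : size w = e + n by rewrite size_cat size_nseq sz.
  have [||||V [ltV _ cV pV]] := @realize_pairs (fun k => nth 0 w k) 0 (e + n) (nseq (nth 0 w 0) 0) isT.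
  - by rewrite all_nseq /= orbT.
  - by rewrite count_nseq /= mul1n.
  - by move=> k _; apply: okB_wellpair.
  - by move=> k ke; rewrite nth_default ?szw.
  have [|u uV] := @seq_of_nat V.
    apply/allP => k kV; rewrite (allP ltV _ kV) andbT leqNgt; apply/negP => ke.
    have : 0 < count_mem k V by rewrite -has_count has_pred1.
    by rewrite cV // nth_cat size_nseq ke nth_nseq ke.
  have [gu uru] : good M u /\ u ~~> rev u.
    by apply: (AB_good ok) => k; rewrite uV pV.
  exists u; split=> //.
  suff : counts (map f u) 0 (e + n) = w.
    by rewrite counts_nseq => /eqP; rewrite eqseq_cat ?size_nseq // => /andP[_ /eqP].
  apply: (@eq_from_nth _ 0); first by rewrite size_map size_iota szw.
  move=> k; rewrite size_map size_iota => kn.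
  by rewrite (nth_map 0) ?size_iota // nth_iota // uV cV.
Qed.

End TypesAB.

(** * The fork of type D *)

(** c0 and c1 count the leaves, and their sum counts the merged letter. In the second alternative
    each leaf occurs once, and the run of doubled letters starts at the merged letter. *)
Definition okD (v : seq nat) :=
  if v is [:: c0, c1 & t] then
    (updown c0 c1 && pathok (c0 + c1 :: t)) ||
    [&& c0 == 1, c1 == 1 & peakok (2 :: t)]
  else false.

Lemma count_prednS k X : count_mem k.+1 (map predn X) = count_mem k.+2 X.
Proof. by rewrite count_map; apply: eq_count => -[|[|z]]. Qed.

Lemma count_predn0 X : count_mem 0 (map predn X) = count_mem 0 X + count_mem 1 X.
Proof. by rewrite count_map; elim: X => //= -[|[|z]] X ->; lia. Qed.

Lemma counts_pred U n : counts (map predn U) 0 n.+1 =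
  count_mem 0 U + count_mem 1 U :: counts U 2 n.
Proof.
rewrite /counts /= count_predn0; congr (_ :: _).
rewrite (iotaDl 1 1) -map_comp; apply/eq_in_map => k.
by rewrite mem_iota => /andP[]; case: k => // k _ _; rewrite /= count_prednS.
Qed.

Lemma pairproj_pred k U : pairproj k.+1 (map predn U) = map predn (filter (pred2 k.+2 k.+3) U).
Proof. by rewrite filter_map; congr map; apply: eq_filter => -[|[|z]]. Qed.

Lemma pairproj_predS k U : filter (pred2 k.+2 k.+3) U = map succn (pairproj k.+1 (map predn U)).
Proof.
rewrite pairproj_pred -map_comp -[LHS]map_id; apply/eq_in_map => -[|z] //.
by rewrite mem_filter.
Qed.

Lemma pairproj_pred0 U : pairproj 0 (map predn U) = map predn (filter (fun k => k <= 2) U).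
Proof. by rewrite filter_map; congr map; apply: eq_filter => -[|[|[|z]]]. Qed.

Lemma pred_eq0_le1 z : z.-1 = 0 -> z <= 1.
Proof. by case: z => [|[]]. Qed.

Lemma third_eq x y z : x <= 1 -> y <= 1 -> z <= 1 -> x != y -> z != y -> z = x.
Proof. by case: x y z => [|[|?]] [|[|?]] [|[|?]]. Qed.

(** * Classification of the words on the fork *)

Section TypeD.
Variables (n : nat) (U : seq nat).
Hypothesis ltU : all (fun i => i < n.+2) U.
Hypothesis gap_ge3 : forall a X b i, 2 < i -> U = a ++ i :: X ++ i :: b ->
  i \notin X -> 1 < count_mem i.-1 X + count_mem i.+1 X.
Hypothesis gap_2 : forall a X b, U = a ++ 2 :: X ++ 2 :: b -> 2 \notin X ->
  1 < count_mem 0 X + count_mem 1 X + count_mem 3 X.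
Hypothesis gap_01 : forall a X b s, s <= 1 -> U = a ++ s :: X ++ s :: b -> s \notin X ->
  1 < count_mem 2 X.

Local Notation V := (map predn U).

Hypothesis palV : forall i, rev (pairproj i V) = pairproj i V.
Hypothesis palW : alternating (pairproj 0 V) ->
  rev (filter (fun k => k <= 2) U) = filter (fun k => k <= 2) U.

Let ltV : all (fun i => i < n.+1) V.
Proof.
by rewrite all_map; apply: sub_all ltU => -[|i].
Qed.

Let gap_ge2 a X b i : 0 < i -> V = a ++ i :: X ++ i :: b ->
  i \notin X -> 1 < count_mem i.-1 X + count_mem i.+1 X.
Proof.
case: i => // i _ h; have [a' [x [r [UE _ xE h1]]]] := map_eq_cat h.
have [X' [y [b' [rE XE yE _]]]] := map_eq_cat h1; rewrite -XE => /notin_count0.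
rewrite count_prednS => /count0_notin iX; rewrite /= count_prednS.
have xE' : x = i.+2 by lia.
have yE' : y = i.+2 by lia.
have {}UE : U = a' ++ i.+2 :: X' ++ i.+2 :: b' by rewrite UE rE xE' yE'.
case: i {h h1 xE xE' yE yE'} UE iX => [|i] UE iX.
  by rewrite count_predn0; apply: gap_2 UE iX.
by rewrite count_prednS; apply: gap_ge3 UE iX.
Qed.

Let gap_1 a X b : V = a ++ 1 :: X ++ 1 :: b -> 1 \notin X -> 0 \in X \/ 1 < count_mem 2 X.
Proof.
move=> VE X1; have := gap_ge2 (ltn0Sn 0) VE X1.
by have [X0 _|X0] := boolP (0 \in X); [left|rewrite /= (notin_count0 X0); right].
Qed.

Local Notation c i := (count_mem i U).

Lemma count2_between a X b : U = a ++ X ++ b -> 0 \notin X -> 1 \notin X -> count_mem 2 X <= 1.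
Proof.
move=> UE X0 X1; rewrite -count_prednS.
apply: (le1_between ltV (leq0n 1) gap_ge2 gap_1 (a := map predn a) (b := map predn b)).
  by rewrite UE !map_cat.
by apply: count0_notin; rewrite count_predn0 !notin_count0.
Qed.

(** Between two equal leaves with no leaf in between lies at most one 2, contrary to [gap_01]; so
    the leaves alternate. They inherit the symmetry of the projection on {0, 1, 2}. *)
Lemma nonpeak_D : ~ peak V 0 -> updown (c 0) (c 1) /\
  filter (pred2 0 1) U = pairword 0 1 (c 0) (c 1).
Proof.
move=> npk.
have pW := palW (nonpeak_alternating ltV (leq0n 1) gap_ge2 gap_1 npk).
have noadj s : s <= 1 -> ~ adjacent s (pred2 0 1) U.
  move=> s1 [a [X [b [UE nX]]]].
  have X0 : 0 \notin X by apply: contra nX => h; apply/hasP; exists 0.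
  have X1 : 1 \notin X by apply: contra nX => h; apply/hasP; exists 1.
  have sX : s \notin X by case: s s1 {UE} => [|[|s]].
  have := gap_01 s1 UE sX; rewrite ltnNge (@count2_between (a ++ [:: s]) X (s :: b)) //.
  by rewrite UE -catA.
have alt := alternating_filter2 (noadj 0 isT) (noadj 1 isT).
have fW : filter (pred2 0 1) U = filter (pred2 0 1) (filter (fun k => k <= 2) U).
  by rewrite -filter_predI; apply: eq_filter => -[|[|z]].
have pal : rev (filter (pred2 0 1) U) = filter (pred2 0 1) U.
  by rewrite fW -filter_rev pW.
have := alternating_palindrome _ (filter_all _ _) alt pal.
by have [-> ->] := count_pairproj U 0; move=> /(_ isT)[].
Qed.

(** No 2 separates the leaves x and y of the peak, so they differ. The nearest further leaf z on
    either side equals x or y, and at most one 2 lies between these equal leaves, contrary to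
    [gap_01]. *)
Lemma peak_D : peak V 0 -> c 0 = 1 /\ c 1 = 1.
Proof.
case=> a [Y [b [h nY]]].
have [a' [x [r [UE aE xE h1]]]] := map_eq_cat h.
have [Y' [y [b' [rE YE yE bE]]]] := map_eq_cat h1; rewrite {r}rE in UE h1.
have Y0 : 0 \notin Y by apply: contra nY => k; apply/hasP; exists 0.
have Y1 : 1 \notin Y by apply: contra nY => k; apply/hasP; exists 1.
have no01 Z : 0 \notin map predn Z -> 0 \notin Z /\ 1 \notin Z.
  by move/notin_count0; rewrite count_predn0 => cz; split; apply: count0_notin; clia.
have [Y'0 Y'1] : 0 \notin Y' /\ 1 \notin Y' by apply: (no01 Y'); rewrite YE.
have Y'2 : count_mem 2 Y' = 0 by rewrite -count_prednS YE notin_count0.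
have x1 := pred_eq0_le1 xE.
have y1 := pred_eq0_le1 yE.
have le1 (s : nat) (Z : seq nat) : s <= 1 -> 0 \notin Z -> 1 \notin Z -> s \notin Z.
  by case: s => [|[|]].
have xy : x != y.
  apply/eqP => e; rewrite -e in UE.
  by have := gap_01 x1 UE (le1 _ _ x1 Y'0 Y'1); rewrite Y'2.
have b'01 : 0 \notin b' /\ 1 \notin b'.
  apply: (no01 b'); apply/negP; rewrite bE => /first_occurrence[Z [d [bE' Z0]]].
  rewrite bE' in bE; have [Z' [z [d' [b'E ZE zE _]]]] := map_eq_cat bE.
  rewrite -ZE in Z0; have [Z'0 Z'1] := no01 _ Z0; rewrite b'E in UE.
  have cZ : count_mem 2 Z' <= 1.
    apply: (@count2_between (a' ++ x :: Y' ++ [:: y]) Z' (z :: d')) => //.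
    by rewrite UE -!catA /= -!catA.
  have [zy|zy] := eqVneq z y.
    rewrite zy in UE.
    have UE' : U = (a' ++ x :: Y') ++ y :: Z' ++ y :: d' by rewrite UE -!catA.
    by have := gap_01 y1 UE' (le1 _ _ y1 Z'0 Z'1); rewrite ltnNge cZ.
  have zx := third_eq x1 y1 (pred_eq0_le1 zE) xy zy.
  rewrite zx in UE.
  have UE' : U = a' ++ x :: (Y' ++ y :: Z') ++ x :: d' by rewrite UE -!catA.
  have nx : x \notin Y' ++ y :: Z'.
    by rewrite mem_cat inE !negb_or xy (le1 x Y') // (le1 x Z').
  have := gap_01 x1 UE' nx; rewrite count_cat /= Y'2.
  rewrite (ltn_eqF (y1 : y < 2)).
  by rewrite ltnNge cZ.
have a'01 : 0 \notin a' /\ 1 \notin a'.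
  apply: (no01 a'); apply/negP; rewrite aE => /last_occurrence[d [Z [aE' Z0]]].
  rewrite aE' in aE; have [d' [z [Z' [a'E _ zE ZE]]]] := map_eq_cat aE.
  rewrite -ZE in Z0; have [Z'0 Z'1] := no01 _ Z0; rewrite a'E -!catA in UE.
  have cZ : count_mem 2 Z' <= 1.
    apply: (@count2_between (d' ++ [:: z]) Z' (x :: Y' ++ y :: b')) => //.
    by rewrite UE -!catA.
  have [zx|zx] := eqVneq z x.
    rewrite zx in UE.
    have := @gap_01 d' Z' (Y' ++ y :: b') x x1 UE (le1 _ _ x1 Z'0 Z'1).
    by rewrite ltnNge cZ.
  rewrite eq_sym in xy; have zy := third_eq y1 x1 (pred_eq0_le1 zE) xy zx.
  rewrite zy in UE.
  have UE' : U = d' ++ y :: (Z' ++ x :: Y') ++ y :: b' by rewrite UE -!catA.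
  have ny : y \notin Z' ++ x :: Y'.
    by rewrite mem_cat inE !negb_or xy (le1 y Y') // (le1 y Z').
  have := gap_01 y1 UE' ny; rewrite count_cat /= Y'2.
  rewrite (ltn_eqF (x1 : x < 2)).
  by rewrite !addn0 ltnNge cZ.
case: a'01 b'01 => [a0 a1] [b0 b1].
rewrite UE !count_cat /= !count_cat /= !(notin_count0 _) //.
by case: x y x1 y1 xy {UE h1 xE yE} => [|[|x]] [|[|y]].
Qed.

Lemma classification_D : [/\ okD (counts U 0 n.+2),
  forall k, pairproj k V = pairword k k.+1 (count_mem k V) (count_mem k.+1 V) &
  updown (c 0) (c 1) -> filter (pred2 0 1) U = pairword 0 1 (c 0) (c 1)].
Proof.
have [pk|npk] := pselect (peak V 0).
  have [c0 c1] := peak_D pk.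
  have c0V : count_mem 0 V = 2 by rewrite count_predn0 c0 c1.
  have [ok pw] := peak_counts ltV (leq0n 1) gap_ge2 gap_1 palV (leqnn 0) (add0n _) pk c0V.
  split=> [|k|]; [|exact: pw|by rewrite c0 c1].
  by move: ok; rewrite counts_pred /okD /= c0 c1 /= => ->.
have [ud fU] := nonpeak_D npk.
have npk' k : ~ peak V k by apply: (nonpeak_ge ltV (leq0n 1) gap_ge2 (leqnn 0) npk).
have pp k := nonpeak_pairproj ltV (leq0n 1) gap_ge2 gap_1 palV (@npk' k).
split=> // [|k]; last by case: (pp k).
have := pathok_counts ltV (add0n n.+1) (fun k _ => (pp k).2).
by rewrite counts_pred /okD /= ud => /= ->.
Qed.

End TypeD.

(* Replaces the successive 0 of p by the letters of s and shifts the other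
   letters, so as to recover a word of type D from its image under predn. *)
Fixpoint weave (p s : seq nat) :=
  match p with
  | [::] => [::]
  | 0 :: p' => head 0 s :: weave p' (behead s)
  | k.+1 :: p' => k.+2 :: weave p' s
  end.

Lemma weaveK W : weave (map predn W) (filter (fun k => k <= 1) W) = W.
Proof. by elim: W => //= -[|[|z]] W IHW /=; rewrite IHW. Qed.

Lemma weaveP p s : size s = count_mem 0 p -> all (fun k => k <= 1) s ->
  map predn (weave p s) = p /\ filter (fun k => k <= 1) (weave p s) = s.
Proof.
elim: p s => [|[|k] p IHp] s /=; first by move=> /size0nil->.
  case: s => //= x s [sz] /andP[x1 all_s]; have [e1 e2] := IHp s sz all_s.
  by rewrite e1 e2 x1; split=> //; congr (_ :: _); lia.
by rewrite add0n => sz all_s; have [e1 e2] := IHp s sz all_s; rewrite e1 e2.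
Qed.

Lemma natm_D_eq2 x y : (natm D_label x y == 2) = ~~ [|| x == y,
  (x == 0) && (y == 2), (x == 2) && (y == 0),
  (0 < x) && (y == x.+1) | (0 < y) && (x == y.+1)].
Proof.
rewrite /natm /D_label; case: (ltngtP x y) => [xy|yx|//].
  by case: ifP => h /=; apply/esym; lia.
by case: ifP => h /=; apply/esym; lia.
Qed.

Lemma natm_D3 x y : x != y -> natm D_label x y != 2 -> natm D_label x y = 3.
Proof. by rewrite /natm /D_label => /negPf ->; case: ifP. Qed.

Lemma count_neighbours_D i (X : seq nat) : i \notin X ->
  count (fun r => natm D_label i r != 2) X =
  if i <= 1 then count_mem 2 X else
  if i == 2 then count_mem 0 X + count_mem 1 X + count_mem 3 X else
  count_mem i.-1 X + count_mem i.+1 X.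
Proof.
elim: X => [|x X IHX] /=; first by do 2?case: ifP.
rewrite inE negb_or => /andP[ix /IHX ->]; rewrite natm_D_eq2 negbK (negPf ix) /=.
have -> : [|| (i == 0) && (x == 2), (i == 2) && (x == 0),
    (0 < i) && (x == i.+1) | (0 < x) && (i == x.+1)] =
  if i <= 1 then x == 2 else
  if i == 2 then [|| x == 0, x == 1 | x == 3] else (x == i.-1) || (x == i.+1).
  by case: i ix {IHX} => [|[|[|i]]] ix /=; lia.
case: ifP => i1; first by lia.
case: ifP => i2; first by case: x ix => [|[|[|[|x]]]] //= ix; lia.
case: (eqVneq x i.-1) => [->|_] /=; last by lia.
by have -> : (i.-1 == i.+1) = false by lia.
Qed.

Lemma okD_tail c0 c1 t : okD [:: c0, c1 & t] ->
  pathok (c0 + c1 :: t) || peakok (c0 + c1 :: t).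
Proof.
rewrite /okD => /orP[/andP[_ ->] //|/and3P[/eqP-> /eqP-> ->]]; exact: orbT.
Qed.

Lemma okD_cases c0 c1 t : okD [:: c0, c1 & t] -> ~~ updown c0 c1 ->
  [/\ c0 = 1, c1 = 1 & head 0 t = 0 \/ head 0 t = 2].
Proof.
move=> ok /negPf nud; move: (ok); rewrite /okD nud /= => /and3P[/eqP-> /eqP-> /orP[/andP[_ /orP[]/eqP]|]].
- by split=> //; left.
- by split=> //; right.
- by case: t {ok} => //= h t /andP[/eqP-> _]; split=> //; right.
Qed.

Lemma pathok_peakok_behead h t : pathok (h :: t) || peakok (h :: t) -> pathok t || peakok t.
Proof.
by case/orP=> [/= /andP[_ ->] //|/= /andP[_ /orP[/andP[-> //]|->]]]; rewrite orbT.
Qed.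

Lemma map_pairword (T T' : eqType) (g : T -> T') x y a b :
  map g (pairword x y a b) = pairword (g x) (g y) a b.
Proof.
have alt n z t : map g (altword z t n) = altword (g z) (g t) n.
  by elim: n z t => //= n IHn z t; rewrite IHn.
by rewrite /pairword; do 3?case: ifP => _; rewrite ?alt ?map_nseq.
Qed.

Lemma size_pairword (T : eqType) (x y : T) a b : updown a b -> size (pairword x y a b) = a + b.
Proof.
rewrite /updown /pairword; case: eqVneq => [_ _|_ /=]; first by rewrite size_altword.
by case: eqVneq => [_ _|_ /= /andP[/eqP-> /eqP->] //]; rewrite size_altword.
Qed.

(** Under [okD] the second branch means one occurrence of each leaf with no 2 in between, so their
    order is immaterial up to commutation. *)
Definition leaf_order c0 c1 := if updown c0 c1 then pairword 0 1 c0 c1 else [:: 0; 1].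

Definition fork_word c0 c1 t := weave (pairword 0 1 (c0 + c1) (head 0 t)) (leaf_order c0 c1).

Section Fork.
Variables (c0 c1 : nat) (t : seq nat).
Hypothesis ok : okD [:: c0, c1 & t].

Lemma fork_wordP :
  map predn (fork_word c0 c1 t) = pairword 0 1 (c0 + c1) (head 0 t) /\
  filter (fun k => k <= 1) (fork_word c0 c1 t) = leaf_order c0 c1.
Proof.
have wp := tail_wellpair 0 (okD_tail ok); rewrite /= nth0 in wp.
have [cnt _] := @count_pairword _ 0 1 _ _ isT wp.
apply: weaveP; rewrite ?cnt /leaf_order.
  by case: ifP => [/size_pairword->//|/negbT/(okD_cases ok)[-> ->]].
case: ifP => // _; apply: sub_all (all_pairword 0 1 c0 c1) => z /=.
by case/orP=> /eqP->.
Qed.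

(** In the exceptional case the fork word is not itself a palindrome, since 0 1 is reversed to 1 0;
    only its projections are. *)
Lemma rev_fork_word s : rev (filter (pred2 s 2) (fork_word c0 c1 t)) =
  filter (pred2 s 2) (fork_word c0 c1 t).
Proof.
have [ud|nud] := boolP (updown c0 c1).
  have [e1 e2] := fork_wordP; rewrite -filter_rev; congr filter.
  rewrite -[LHS]weaveK map_rev filter_rev e1 e2 rev_pairword /leaf_order ud rev_pairword.
  by rewrite /fork_word /leaf_order ud.
have [e0 e1 [e2|e2]] := okD_cases ok nud; rewrite /fork_word /leaf_order (negPf nud) e0 e1 e2.
  by rewrite /pairword /=; case: s => [|[|[|s]]].
by rewrite /pairword /=; case: s => [|[|[|s]]].
Qed.

(** Merging loses only the order of the leaves, which the projection on {0, 1} restores. In the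
    exceptional case this order is unknown, but the merged word is 0 0 or 1 0 0 1 and both orders
    give the same result. *)
Lemma fork_filter U s : s <= 1 ->
  pairproj 0 (map predn U) = pairword 0 1 (c0 + c1) (head 0 t) ->
  (updown c0 c1 -> filter (pred2 0 1) U = pairword 0 1 c0 c1) ->
  count_mem 0 U = c0 -> count_mem 1 U = c1 ->
  filter (pred2 s 2) U = filter (pred2 s 2) (fork_word c0 c1 t).
Proof.
move=> s1; rewrite pairproj_pred0; set W := filter _ U => WE fU cU0 cU1.
have fW (p : pred nat) : (forall k, p k -> k <= 2) -> filter p U = filter p W.
  move=> p2; rewrite -filter_predI; apply: eq_filter => k /=.
  by case pk: (p k) => //=; rewrite p2.
have -> : filter (pred2 s 2) U = filter (pred2 s 2) W by apply: fW => k /=; lia.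
have f01 : filter (fun k => k <= 1) W = filter (pred2 0 1) U.
  by rewrite /W -filter_predI; apply: eq_filter => -[|[|[|k]]].
have [ud|nud] := boolP (updown c0 c1).
  by rewrite -[W]weaveK WE f01 fU // /fork_word /leaf_order ud.
have [e0 e1 e2] := okD_cases ok nud.
have cW k : k <= 2 -> count_mem k W = count_mem k U.
  by move=> k2; rewrite count_filter; apply: eq_count => z /=; case: eqVneq => // ->.
have cW0 : count_mem 0 W = 1 by rewrite cW // cU0.
have cW1 : count_mem 1 W = 1 by rewrite cW // cU1.
move: W WE cW0 cW1 {fW f01 cW fU} => W WE cW0 cW1.
rewrite /fork_word /leaf_order (negPf nud) e0 e1 in WE *.
case: e2 => e2; rewrite e2 /pairword /= in WE *.
  case: W WE cW0 cW1 => [|[|[|x]] [|[|[|y]] [|z W]]] //= _ _ _;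
    by case: s s1 => [|[|s]].
case: W WE cW0 cW1 => [|[|[|[|?]]] [|[|[|x]] [|[|[|y]] [|[|[|[|?]]] [|z W]]]]] //= _ _ _;
  by case: s s1 => [|[|s]].
Qed.

End Fork.

Lemma D_filters U U' : (forall k, pairproj k.+1 (map predn U) = pairproj k.+1 (map predn U')) ->
  (forall s, s <= 1 -> filter (pred2 s 2) U = filter (pred2 s 2) U') ->
  forall x y, natm D_label x y <> 2 -> filter (pred2 x y) U = filter (pred2 x y) U'.
Proof.
move=> hV h2 x y /eqP; rewrite natm_D_eq2 negbK.
have sw (a b : nat) W : filter (pred2 a b) W = filter (pred2 b a) W.
  by apply: eq_filter => z /=; rewrite orbC.
have hU k : filter (pred2 k.+2 k.+3) U = filter (pred2 k.+2 k.+3) U'.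
  by rewrite !pairproj_predS hV.
have d (a b : nat) W : filter (pred2 a a) W = filter (pred1 a) (filter (pred2 a b) W).
  by rewrite -filter_predI; apply: eq_filter => z /=; case: (z == a).
have adj a : 0 < a -> filter (pred2 a a.+1) U = filter (pred2 a a.+1) U'.
  by case: a => [|[|a]] // _; rewrite ?hU // h2.
case/or4P=> [/eqP->|/andP[/eqP-> /eqP->]|/andP[/eqP-> /eqP->]|/orP[]/andP[a0 /eqP->]].
- case: y => [|y]; first by rewrite !(d 0 2) h2.
  by rewrite !(d y.+1 y.+2) adj.
- exact: h2.
- by rewrite !(sw 2 0) h2.
- exact: adj.
- by rewrite !(sw y.+1) adj.
Qed.

Section CommutationMap.
Variables (I : finType) (M : coxeter_matrix I).

Lemma comm_map_filter (T : Type) (p : pred I) (g : I -> T) u v :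
  (forall s t, p s -> p t -> M s t = 2 -> g s = g t) -> commutation_equiv M u v ->
  map g (filter p u) = map g (filter p v).
Proof.
move=> pM; elim=> // a b x s t st _ <-; rewrite !filter_cat !map_cat; congr (_ ++ (_ ++ _)).
rewrite /=; case ps: (p s); case pt: (p t) => //=.
by rewrite (pM s t).
Qed.

End CommutationMap.

(** * Fc involutions of type D and their counts *)

Section TypeDGroup.
Variables (n : nat).
Let M := D_matrix n.+2.
Let f (s : 'I_n.+2) : nat := s.
Implicit Types (u v : seq 'I_n.+2).

Let f_inj : injective f.
Proof. exact: val_inj. Qed.

Let HM s t : M s t = natm D_label (f s) (f t).
Proof. by []. Qed.

Local Notation "u ~~> v" := (commutation_equiv M u v) (at level 70).

Lemma D_labels s t : s != t -> M s t \in [:: 2; 3; 4].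
Proof.
move=> st; have st' : f s != f t := st.
by rewrite HM; have [->//|/(natm_D3 st') ->] := eqVneq (natm D_label (f s) (f t)) 2.
Qed.

Lemma lt_f u : all (fun k => k < n.+2) (map f u).
Proof. by apply/allP => _ /mapP[s _ ->]; apply: ltn_ord. Qed.

Lemma fork_pred_comm u v : u ~~> v ->
  pairproj 0 (map predn (map f u)) = pairproj 0 (map predn (map f v)).
Proof.
move=> uv; rewrite !pairproj_pred0 !filter_map -!map_comp.
apply: comm_map_filter uv => s t s2 t2 st.
have : natm D_label (f s) (f t) == 2 by rewrite -HM st.
by rewrite natm_D_eq2; move: s2 t2; rewrite /= /f; lia.
Qed.

(** Among 0, 1, 2 only the leaves commute. To be swapped they must be neighbours in the projection
    on {0, 1, 2}, which after merging is a square 00. *)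
Lemma fork_comm u v : u ~~> v -> alternating (pairproj 0 (map predn (map f u))) ->
  filter (fun k => k <= 2) (map f u) = filter (fun k => k <= 2) (map f v).
Proof.
elim=> // a b x s t st uv IH alt.
have {}IH := IH (etrans (congr1 (@alternating _) (esym (fork_pred_comm (comm_swap a b st)))) alt).
rewrite -IH !map_cat !filter_cat; congr (_ ++ (_ ++ _)); rewrite /=.
case: ifP => s2; case: ifP => // t2.
have : natm D_label (f s) (f t) == 2 by rewrite -HM st.
rewrite natm_D_eq2 => st'; move: alt.
rewrite pairproj_pred0 !map_cat !filter_cat !map_cat /= s2 t2 /=.
have -> : (f s).-1 = 0 by lia.
have -> : (f t).-1 = 0 by lia.
by rewrite (negPf (alternating_square _ _ _)).
Qed.

Lemma D_group_classification u : good M u -> u ~~> rev u ->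
  let U := map f u in let V := map predn U in
  [/\ okD (counts U 0 n.+2),
  forall k, pairproj k V = pairword k k.+1 (count_mem k V) (count_mem k.+1 V) &
  updown (count_mem 0 U) (count_mem 1 U) ->
    filter (pred2 0 1) U = pairword 0 1 (count_mem 0 U) (count_mem 1 U)].
Proof.
move=> gu uru U V.
have gap a X b i : U = a ++ i :: X ++ i :: b -> i \notin X ->
    1 < count (fun r => natm D_label i r != 2) X.
  move=> UE iX; apply: (nat_gap_count f_inj HM gu UE) => r rX; apply: natm_D3.
  by apply: contraNneq iX => ->.
apply: classification_D; first exact: lt_f.
- move=> a X b i i2 UE iX; have := gap _ _ _ _ UE iX; rewrite count_neighbours_D //.
  have -> : (i <= 1) = false by lia.
  by have -> : (i == 2) = false by lia.
- by move=> a X b UE iX; have := gap _ _ _ _ UE iX; rewrite count_neighbours_D.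
- by move=> a X b s s1 UE iX; have := gap _ _ _ _ UE iX; rewrite count_neighbours_D // s1.
- case=> [|k]; last first.
    rewrite pairproj_pred -map_rev; congr map.
    apply: (palindromic_filter HM uru) => x y xi yi /eqP.
    by rewrite natm_D_eq2; move: xi yi => /=; lia.
  by rewrite -filter_rev -!map_rev (fork_pred_comm uru).
- by move=> alt; rewrite -filter_rev -map_rev (fork_comm uru).
Qed.

Lemma D_good u c0 c1 t : okD [:: c0, c1 & t] ->
  let U := map f u in
  (forall k, pairproj k (map predn U) =
     pairword k k.+1 (nth 0 (c0 + c1 :: t) k) (nth 0 (c0 + c1 :: t) k.+1)) ->
  (updown c0 c1 -> filter (pred2 0 1) U = pairword 0 1 c0 c1) ->
  count_mem 0 U = c0 -> count_mem 1 U = c1 -> good M u /\ u ~~> rev u.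
Proof.
move=> ok U pairs fU cU0 cU1.
have pair0 : pairproj 0 (map predn U) = pairword 0 1 (c0 + c1) (head 0 t).
  by rewrite pairs /= nth0.
split; last first.
  apply: (comm_of_filters f_inj HM); apply: D_filters => [k|s s1].
    by rewrite !map_rev filter_rev pairs rev_pairword.
  by rewrite map_rev filter_rev (fork_filter ok s1 pair0) // rev_fork_word.
have okw := okD_tail ok; have okt := pathok_peakok_behead okw.
move=> u' uu' /(nat_bad_factor HM); set U' := map f u'.
have pairs' k : pairproj k (map predn U') =
    pairword k k.+1 (nth 0 (c0 + c1 :: t) k) (nth 0 (c0 + c1 :: t) k.+1).
  rewrite -pairs; case: k => [|k]; first by rewrite -(fork_pred_comm uu').
  rewrite !pairproj_pred; congr map.
  apply/esym/(filters_of_comm HM uu') => x y xi yi /eqP.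
  by rewrite natm_D_eq2; move: xi yi => /=; lia.
have cU' k : count_mem k U' = count_mem k U.
  by apply/esym/permP/perm_map/(comm_perm uu').
(* This excludes the factors 00, 11, 020 and 121: the leaves either alternate, in an order fixed by
   [fork_comm], or occur once each. *)
have no_ss s : s <= 1 -> forall a b, filter (pred2 0 1) U' <> a ++ [:: s; s] ++ b.
  move=> s1 a b E; have [ud|nud] := boolP (updown c0 c1).
    have alt0 : alternating (pairproj 0 (map predn U)).
      rewrite pairs pairword_alternating //.
      (* The sum c0 + c1 is odd or zero, hence not 2, which rules out a run of doubled letters. *)
      have [/(pathok_updown 0)//|/= /andP[/eqP c2 _]] := orP okw.
      by move: ud c2 {cU0 cU1}; rewrite /updown; clear; lia.
    have EE : filter (pred2 0 1) U' = filter (pred2 0 1) U.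
      have fW W : filter (pred2 0 1) W = filter (pred2 0 1) (filter (fun k => k <= 2) W).
        by rewrite -filter_predI; apply: eq_filter => -[|[|[|k]]].
      by rewrite fW -(fork_comm uu') // -fW.
    have := pairword_alternating (isT : 0 != 1) ud.
    by rewrite -fU // -EE E (negPf (alternating_square _ _ _)).
  have [e0 e1 _] := okD_cases ok nud.
  have cs : count_mem s U' = 1 by rewrite cU'; case: s s1 {E} => [|[|s]] // _; lia.
  have : count_mem s (filter (pred2 0 1) U') <= 1.
    by rewrite -cs count_filter; apply: sub_count => z /= /andP[].
  by rewrite E !count_cat /= eqxx; lia.
have pair0' a b : pairproj 0 (map predn U') <> a ++ [:: 1; 1] ++ b.
  by rewrite pairs'; apply: pairword_nosquare => //; apply: tail_wellpair okw.
have pairsS k : pairproj k.+1 (map predn U') = pairword k.+1 k.+2 (nth 0 t k) (nth 0 t k.+1).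
  by rewrite pairs'.
case=> a [b [s [r h]]]; case: h => [UE|[sr UE]|[sr UE]].
- case: s UE => [|[|s]] UE.
  + by apply: (no_ss 0 isT (filter (pred2 0 1) a) (filter (pred2 0 1) b)); rewrite {1}UE !filter_cat.
  + by apply: (no_ss 1 isT (filter (pred2 0 1) a) (filter (pred2 0 1) b)); rewrite {1}UE !filter_cat.
  + apply: (no_factor_ii okt pairsS pair0' (i := s) (a := map predn a) (b := map predn b)).
    by rewrite UE !map_cat.
- have := natm_D_eq2 s r; rewrite sr /= => /esym/negbFE.
  have sr' : (s == r) = false by apply/eqP => E; move: sr; rewrite E /natm eqxx.
  rewrite sr' /= => /or4P[/andP[/eqP s0 /eqP r2]|/andP[/eqP s2 /eqP r0]|/andP[s0 /eqP rE]|/andP[r0 /eqP sE]].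
  + rewrite s0 r2 in UE.
    by apply: (no_ss 0 isT (filter (pred2 0 1) a) (filter (pred2 0 1) b)); rewrite {1}UE !filter_cat.
  + rewrite s2 r0 in UE.
    apply: (no_factor_left_pair (pairs' 0) (pairs' 1) (tail_wellpair 1 okw) _
      (a := map predn a) (b := map predn b)); last by rewrite UE !map_cat.
    exact: (tail_not_updown okw).
  + case: s s0 rE UE {sr sr'} => [|[|s]] // _ -> UE.
      by apply: (no_ss 1 isT (filter (pred2 0 1) a) (filter (pred2 0 1) b)); rewrite {1}UE !filter_cat.
    apply: (no_factor_right okt pairsS pair0' (i := s) (a := map predn a) (b := map predn b)).
    by rewrite UE !map_cat.
  + case: r r0 sE UE {sr sr'} => [|[|r]] // _ -> UE.
      apply: (no_factor_left_pair (pairs' 0) (pairs' 1) (tail_wellpair 1 okw) _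
        (a := map predn a) (b := map predn b)); last by rewrite UE !map_cat.
      exact: (tail_not_updown okw).
    apply: (no_factor_left okt pairsS (i := r) (a := map predn a) (b := map predn b)).
    by rewrite UE !map_cat.
- have sr' : s != r by apply/eqP => E; move: sr; rewrite E /natm eqxx.
  have nsr : natm D_label s r != 2 by rewrite sr.
  by have := natm_D3 sr' nsr; rewrite sr.
Qed.

Lemma word_of_nat V : all (fun k => k < n.+2) V -> exists u, map f u = V.
Proof.
elim: V => [|k V IHV] /=; first by exists [::].
by case/andP=> kn /IHV[u <-]; exists (Ordinal kn :: u).
Qed.

Lemma gf_D (L : seq (seq nat)) : uniq L ->
  (forall v : seq nat, v \in L <-> size v = n.+2 /\ okD v) ->
  fc_involution_gf (D_matrix n.+2) = (\sum_(v <- L) q ^+ sumn v)%R.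
Proof.
move=> uniqL memL.
apply: (fc_involution_gfE D_labels (code := fun u => counts (map f u) 0 n.+2)) => //.
- by move=> u v uv; apply: (counts_comm f 0 n.+2 uv).
- by move=> u; rewrite sumn_counts ?size_map //; apply: lt_f.
- move=> u gu uru; apply/memL; rewrite size_map size_iota; split=> //.
  by have [] := D_group_classification gu uru.
- move=> u v gu uru gv vrv cc.
  have ck j : count_mem j (map f u) = count_mem j (map f v).
    have [je|je] := ltnP j n.+2.
      have := congr1 (fun s => nth 0 s j) cc.
      by rewrite !(nth_map 0) ?size_iota // !nth_iota.
    by rewrite !notin_count0 //; apply/negP => /(allP (lt_f _)); lia.
  have cp j : count_mem j (map predn (map f u)) = count_mem j (map predn (map f v)).
    by case: j => [|j]; [rewrite !count_predn0 !ck|rewrite !count_prednS ck].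
  have [oku pu fu] := D_group_classification gu uru.
  have [okv pv fv] := D_group_classification gv vrv.
  have hd w : head 0 (counts (map f w) 2 n) = count_mem 1 (map predn (map f w)).
    by rewrite count_prednS; apply: (head_counts (lt_f w)).
  apply: (comm_of_filters f_inj HM); apply: D_filters => [k|s s1].
    by rewrite pu pv !cp.
  have pu0 := pu 0; rewrite count_predn0 -hd in pu0.
  have pv0 := pv 0; rewrite count_predn0 -hd in pv0.
  rewrite (fork_filter oku s1 pu0 fu) // (fork_filter okv s1 pv0 fv) //.
  by rewrite /fork_word /leaf_order !hd !ck cp.
- case=> [|c0 [|c1 t]]; [by move/memL=> []|by move/memL=> []|].
  move=> /memL[sz ok]; have [E1 E2] := fork_wordP ok.
  have okw := okD_tail ok; have okt := pathok_peakok_behead okw.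
  have wp0 := tail_wellpair 0 okw; rewrite /= nth0 in wp0.
  have [_ cp1] := @count_pairword _ 0 1 _ _ isT wp0.
  have szt : size t = n by case: sz.
  have [||||U [ltU fU cU pU]] := @realize_pairs (fun k => nth 0 [:: c0, c1 & t] k) 2 n.+2 (fork_word c0 c1 t) isT.
  - apply/allP => z zW; have : z.-1 \in map predn (fork_word c0 c1 t) by apply: map_f.
    rewrite E1 => /(allP (all_pairword 0 1 _ _)) /=; lia.
  - by rewrite -count_prednS E1 cp1 /= nth0.
  - by case=> [|[|k]] // _; apply: (tail_wellpair k okt).
  - by move=> k ke; rewrite nth_default ?sz.
  have [u uU] := word_of_nat ltU.
  have f01 : filter (pred2 0 1) U = leaf_order c0 c1.
    rewrite -E2 -fU -filter_predI; apply: eq_filter => -[|[|[|k]]] //.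
  have c01 : count_mem 0 U = c0 /\ count_mem 1 U = c1.
    have [<- <-] := count_pairproj U 0; rewrite f01 /leaf_order; case: ifP => ud.
      by have := @count_pairword _ 0 1 c0 c1 isT; rewrite /wellpair ud => /(_ isT).
    by have [-> ->] := okD_cases ok (negbT ud).
  case: c01 => cU0 cU1.
  have [gu uru] : good M u /\ u ~~> rev u.
    apply: (D_good ok); rewrite uU //.
      case=> [|k]; first by rewrite pairproj_pred0 fU E1 /= nth0.
      by rewrite pairproj_pred pU // map_pairword.
    by move=> ud; rewrite f01 /leaf_order ud.
  exists u; split=> //; rewrite uU.
  apply: (@eq_from_nth _ 0); first by rewrite size_map size_iota sz.
  move=> k; rewrite size_map size_iota => kn.
  rewrite (nth_map 0) ?size_iota // nth_iota //.
  by case: k kn => [|[|k]] kn //; rewrite cU.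
Qed.

End TypeDGroup.

(** * Enumeration of count vectors *)

(** The predecessor is truncated, so h = 0 yields the horizontal step allowed by [updown]. A path
    without letters sits at height 0, the count of the absent next letter. *)
Fixpoint paths m h : seq (seq nat) :=
  if m is m'.+1 then [seq h :: w | w <- paths m' h.-1 ++ paths m' h.+1]
  else if h == 0 then [:: [::]] else [::].

Fixpoint peaks m : seq (seq nat) :=
  if m is m'.+1 then [seq 2 :: w | w <- paths m' 0 ++ paths m' 2 ++ peaks m']
  else [::].

Fixpoint all_paths m k : seq (seq nat) :=
  if k is k'.+1 then all_paths m k' ++ paths m k' else [::].

Lemma cons_inj (T : Type) (x : T) : injective (cons x).
Proof. by move=> u v []. Qed.

Lemma mem_map_cons (T : eqType) (x y : T) (v : seq T) L :
  (y :: v \in [seq x :: w | w <- L]) = (y == x) && (v \in L).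
Proof.
apply/mapP/andP => [[w wL [-> ->]]|[/eqP-> vL]]; first by rewrite eqxx.
by exists v.
Qed.

Lemma nil_map_cons (T : eqType) (x : T) L : ([::] \in [seq x :: w | w <- L]) = false.
Proof. by apply/negP => /mapP[]. Qed.

Lemma mem_paths m h v : (v \in paths m h) = [&& size v == m, head 0 v == h & pathok v].
Proof.
elim: m h v => [|m IHm] h v /=.
  by case: eqVneq => [->|h0]; case: v => [|a v]; rewrite ?inE //= eq_sym (negPf h0).
case: v => [|a v]; first by rewrite nil_map_cons.
rewrite mem_map_cons mem_cat !IHm /= eqSS; case: eqVneq => [->|]; last by rewrite andbF.
case: (size v == m) => //=; case: (pathok v); rewrite ?andbF // !andbT /updown.
by case: h => [|h]; lia.
Qed.

Lemma mem_peaks m v : (v \in peaks m) = (size v == m) && peakok v.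
Proof.
elim: m v => [|m IHm] [|a v] //=; first by rewrite nil_map_cons.
rewrite mem_map_cons !mem_cat !mem_paths IHm eqSS; case: eqVneq => [_|]; last by rewrite andbF.
by case: (size v == m) => //=; case: (pathok v); rewrite ?andbF ?andbT //= orbA.
Qed.

Lemma peakok_head v : peakok v -> head 0 v = 2.
Proof. by case: v => //= h w /andP[/eqP]. Qed.

(** A 2 of the run is followed by 2 or 0, which is not a unit step; so regular and exceptional count
    vectors do not overlap. *)
Lemma peakok_not_pathok v : peakok v -> ~~ pathok v.
Proof.
case: v => //= h w /andP[/eqP->]; rewrite negb_and.
by case/orP=> [/andP[_ /orP[]/eqP->]//|/peakok_head->].
Qed.

Lemma uniq_paths m h : uniq (paths m h).
Proof.
elim: m h => [|m IHm] h /=; first by case: ifP.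
rewrite map_inj_uniq ?cat_uniq ?IHm /=; last exact: cons_inj.
rewrite andbT; apply/hasPn => v; rewrite !mem_paths => /and3P[_ /eqP-> _].
by apply/negP => /and3P[_ /eqP]; lia.
Qed.

Lemma uniq_peaks m : uniq (peaks m).
Proof.
elim: m => //= m IHm; rewrite map_inj_uniq; last exact: cons_inj.
rewrite !cat_uniq !uniq_paths IHm /= !andbT; apply/andP; split; apply/hasPn => v.
  rewrite mem_cat !mem_paths mem_peaks => h; apply/negP => /and3P[_ /eqP v0 _].
  by case/orP: h => [/and3P[_ /eqP]|/andP[_ /peakok_head]]; rewrite v0.
rewrite mem_paths mem_peaks => /andP[_ /peakok_not_pathok/negPf->].
by rewrite !andbF.
Qed.

Lemma mem_all_paths m k v : (v \in all_paths m k) = [&& size v == m, head 0 v < k & pathok v].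
Proof.
elim: k => [|k IHk] /=; first by rewrite andbF.
rewrite mem_cat IHk mem_paths; case: (size v == m) => //=.
by case: (pathok v); rewrite ?andbF // !andbT; lia.
Qed.

Lemma uniq_all_paths m k : uniq (all_paths m k).
Proof.
elim: k => //= k IHk; rewrite cat_uniq IHk uniq_paths andbT; apply/hasPn => v.
by rewrite mem_paths mem_all_paths => /and3P[_ /eqP-> _]; rewrite ltnn /= andbF.
Qed.

Lemma pathok_head v : pathok v -> head 0 v <= size v.
Proof.
by elim: v => //= h w IHw /andP[+ /IHw]; rewrite /updown; lia.
Qed.

Local Open Scope ring_scope.

Definition list_gf (L : seq (seq nat)) : fps rat := \sum_(v <- L) q ^+ sumn v.

Lemma list_gf_cat L L' : list_gf (L ++ L') = list_gf L + list_gf L'.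
Proof. exact: big_cat. Qed.

Lemma list_gf_cons h L : list_gf [seq h :: w | w <- L] = q ^+ h * list_gf L.
Proof.
rewrite /list_gf big_map mulr_sumr; apply: eq_bigr => w _.
by rewrite /= exprD.
Qed.

Definition path_gf m h := list_gf (paths m h).
Definition peak_gf m := list_gf (peaks m).

Lemma path_gf0 h : path_gf 0 h = (h == 0%N)%:R.
Proof.
rewrite /path_gf /list_gf /=; case: eqP => _; first by rewrite big_seq1.
by rewrite big_nil.
Qed.

Lemma path_gfS m h : path_gf m.+1 h = q ^+ h * (path_gf m h.-1 + path_gf m h.+1).
Proof. by rewrite /path_gf /= list_gf_cons list_gf_cat. Qed.

Lemma peak_gf0 : peak_gf 0 = 0.
Proof. exact: big_nil. Qed.

Lemma peak_gfS m : peak_gf m.+1 = q ^+ 2 * (path_gf m 0 + path_gf m 2 + peak_gf m).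
Proof. by rewrite /peak_gf /= list_gf_cons !list_gf_cat addrA. Qed.

Lemma path_gf_gt m h : (m < h)%N -> path_gf m h = 0.
Proof.
elim: m h => [|m IHm] h mh; first by rewrite path_gf0 gtn_eqF.
by rewrite path_gfS !IHm ?addr0 ?mulr0 //; lia.
Qed.

Lemma list_gf_all_paths m k : list_gf (all_paths m k) = \sum_(h < k) path_gf m h.
Proof.
elim: k => [|k IHk]; first by rewrite big_ord0; apply: big_nil.
by rewrite big_ord_recr /= list_gf_cat IHk.
Qed.

Lemma A_FC_E n : A_FC n = path_gf n 0 + path_gf n 1.
Proof.
rewrite /A_FC (@gf_AB n 1 _ _ (paths n 0 ++ paths n 1)).
- exact: list_gf_cat.
- by move=> s t; rewrite !addn1 /natm eqSS /= /labelled_m /A_label /B_label minnSS maxnSS.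
- rewrite cat_uniq !uniq_paths andbT; apply/hasPn => v; rewrite !mem_paths.
  by move=> /and3P[_ /eqP-> _]; rewrite andbF.
- move=> v; rewrite mem_cat !mem_paths /= /okB /= orbF /updown; split.
    by case/orP=> /and3P[/eqP-> /eqP-> ->].
  case=> -> /andP[h ->]; rewrite eqxx !andbT /=; lia.
Qed.

(** A path that has come down to 0 after n letters starts at height at most n, which bounds the sum.
    The factor q is the single letter 0 of an exceptional word. *)
Lemma B_FC_E n : B_FC n = \sum_(h < n.+1) path_gf n h +
  (if n is m.+1 then q * peak_gf m else 0).
Proof.
pose L := all_paths n n.+1 ++ (if n is m.+1 then [seq 1%N :: w | w <- peaks m] else [::]).
rewrite /B_FC (@gf_AB n 0 _ _ L).
- rewrite -/(list_gf L) list_gf_cat list_gf_all_paths; congr (_ + _).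
  by case: (n) => [|m]; [apply: big_nil|rewrite list_gf_cons].
- by move=> s t; rewrite !addn0.
- rewrite cat_uniq uniq_all_paths andTb; apply/andP; split; last first.
    by case: (n) => // m; rewrite map_inj_uniq ?uniq_peaks //; apply: cons_inj.
  apply/hasPn => v; rewrite mem_all_paths; case: {L}n => // m /mapP[w].
  rewrite mem_peaks => /andP[_ pw ->]; apply/negP => /and3P[_ _ /= /andP[_]].
  by rewrite (negPf (peakok_not_pathok pw)).
- move=> v; rewrite mem_cat mem_all_paths /okB /=; split.
    case/orP=> [/and3P[/eqP-> _ ->] //|]; case: {L}n => // m /mapP[w].
    by rewrite mem_peaks => /andP[/eqP<- pw] ->; rewrite /= pw orbT.
  case=> <- /orP[pv|]; first by rewrite eqxx pv ltnS pathok_head.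
  case: v => // h w /andP[/eqP-> pw]; rewrite mem_map_cons mem_peaks pw !eqxx.
  by rewrite orbT.
Qed.

Definition fork_tails n h := paths n h.-1 ++ paths n h.+1.

(** An odd total 2j+1 is split between the leaves as (j+1, j) or (j, j+1), whence the factor 2 in
    the series. *)
Fixpoint odd_forks n k : seq (seq nat) :=
  if k is j.+1 then odd_forks n j ++
    ([seq j.+1 :: w | w <- [seq j :: t | t <- fork_tails n (j + j).+1]] ++
     [seq j :: w | w <- [seq j.+1 :: t | t <- fork_tails n (j + j).+1]])
  else [::].

Definition even_forks n : seq (seq nat) :=
  [seq 0%N :: w | w <- [seq 0%N :: t | t <- fork_tails n 0]].

Definition peak_forks n : seq (seq nat) :=
  [seq 1%N :: w | w <- [seq 1%N :: t | t <- paths n 0 ++ paths n 2 ++ peaks n]].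

Lemma fork_tails_gf n h : q ^+ h * list_gf (fork_tails n h) = path_gf n.+1 h.
Proof. by rewrite list_gf_cat path_gfS. Qed.

Lemma mem_fork_tails n h t : (t \in fork_tails n h) = (size t == n) && pathok (h :: t).
Proof.
have := mem_paths n.+1 h (h :: t); rewrite /= mem_map_cons eqxx eqSS /= => <- //.
Qed.

Lemma uniq_fork_tails n h : uniq (fork_tails n h).
Proof. by have := uniq_paths n.+1 h; rewrite /= map_inj_uniq //; apply: cons_inj. Qed.

Lemma odd_forks_gf n k :
  list_gf (odd_forks n k) = \sum_(j < k) 2%:R * path_gf n.+1 (j + j).+1.
Proof.
elim: k => [|k IHk]; first by rewrite big_ord0; apply: big_nil.
rewrite big_ord_recr /= !list_gf_cat IHk !list_gf_cons -fork_tails_gf; congr (_ + _).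
by rewrite !mulrA -!exprD addSn addnS mulr2n mulrDl mul1r mulrDl.
Qed.

Lemma mem_odd_forks n k c0 c1 t : ([:: c0, c1 & t] \in odd_forks n k) =
  [&& size t == n, pathok (c0 + c1 :: t)%N, minn c0 c1 < k
    & (c0 == c1.+1) || (c1 == c0.+1)]%N.
Proof.
elim: k => [|k IHk]; first by rewrite /= !andbF.
rewrite [odd_forks _ _]/= !mem_cat IHk !mem_map_cons !mem_fork_tails.
set P := pathok (c0 + c1 :: t)%N; set S := (size t == n).
have -> : [&& c0 == k.+1, c1 == k, S & pathok ((k + k).+1 :: t)]%N =
  [&& c0 == k.+1, c1 == k, S & P]%N.
  by case: eqVneq => // c0E; case: eqVneq => // c1E; rewrite /P c0E c1E addSn.
have -> : [&& c0 == k, c1 == k.+1, S & pathok ((k + k).+1 :: t)]%N =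
  [&& c0 == k, c1 == k.+1, S & P]%N.
  by case: eqVneq => // c0E; case: eqVneq => // c1E; rewrite /P c0E c1E addnS.
by case: S; case: P; rewrite ?andbF //=; apply/idP/idP; lia.
Qed.

Lemma odd_forks_short n k v : v \in odd_forks n k -> exists c0 c1 t, v = [:: c0, c1 & t].
Proof.
elim: k => //= k IHk; rewrite !mem_cat => /or3P[/IHk //||] /mapP[w /mapP[t _ ->] ->].
  by exists k.+1, k, t.
by exists k, k.+1, t.
Qed.

Lemma uniq_odd_forks n k : uniq (odd_forks n k).
Proof.
elim: k => //= k IHk; rewrite !cat_uniq IHk !map_inj_uniq ?uniq_fork_tails /=;
  try exact: cons_inj.
rewrite andbT; apply/andP; split; apply/hasPn => v.
  rewrite mem_cat => h; apply/negP => vk.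
  have [c0 [c1 [t vE]]] := odd_forks_short vk; rewrite vE mem_odd_forks in vk.
  move: h; rewrite vE !mem_map_cons; move: vk => /and4P[_ _]; lia.
move=> /mapP[w /mapP[t _ ->] ->]; rewrite mem_map_cons; lia.
Qed.

Lemma D_gf_E n : fc_involution_gf (D_matrix n.+2) =
  path_gf n.+1 0 + \sum_(j < n.+1) 2%:R * path_gf n.+1 (j + j).+1 + peak_gf n.+1.
Proof.
pose L := even_forks n ++ odd_forks n n.+1 ++ peak_forks n.
rewrite (@gf_D n L).
- rewrite -/(list_gf L) (list_gf_cat (even_forks n)) (list_gf_cat (odd_forks n n.+1)).
  rewrite odd_forks_gf addrA /even_forks /peak_forks !list_gf_cons.
  congr (_ + _ + _); first by rewrite expr0 !mul1r -fork_tails_gf expr0 mul1r.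
  by rewrite mulrA -exprD !list_gf_cat peak_gfS addrA.
- have uP : uniq (paths n 0 ++ paths n 2 ++ peaks n).
    by have := uniq_peaks n.+1; rewrite /= map_inj_uniq //; apply: cons_inj.
  have uE : uniq (even_forks n).
    by rewrite !map_inj_uniq ?uniq_fork_tails //; apply: cons_inj.
  have uF : uniq (peak_forks n) by rewrite !map_inj_uniq ?uP //; apply: cons_inj.
  rewrite (cat_uniq (even_forks n)) (cat_uniq (odd_forks n n.+1)) uniq_odd_forks uE uF.
  rewrite andbT !andTb; apply/andP; split; apply/hasPn => v.
    rewrite mem_cat => /orP[/[dup] vo /odd_forks_short[c0 [c1 [t vE]]]|].
      by move: vo; rewrite vE mem_odd_forks !mem_map_cons => /and4P[_ _ _]; lia.
    by move=> /mapP[w _ ->]; rewrite mem_map_cons.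
  by move=> /mapP[w /mapP[t _ ->] ->]; rewrite mem_odd_forks /= !andbF.
- have peakE t : (t \in paths n 0 ++ paths n 2 ++ peaks n) = (size t == n) && peakok (2 :: t)%N.
    by have := mem_peaks n.+1 (2 :: t)%N; rewrite /= mem_map_cons eqxx eqSS.
  have memL v : (v \in L) =
      [|| v \in even_forks n, v \in odd_forks n n.+1 | v \in peak_forks n].
    by rewrite (mem_cat v (even_forks n)) (mem_cat v (odd_forks n n.+1)).
  case=> [|c0 [|c1 t]]; rewrite memL /even_forks /peak_forks.
  + rewrite !nil_map_cons orbF /=; split=> [|[]//].
    by move/(@odd_forks_short n n.+1) => [? [? []]].
  + rewrite !mem_map_cons !nil_map_cons !andbF orbF; split=> [|[]//].
    by move/(@odd_forks_short n n.+1) => [? [? []]].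
  rewrite !mem_map_cons mem_odd_forks mem_fork_tails peakE /okD; split.
    case/or3P=> [/and3P[/eqP-> /eqP-> /andP[/eqP<- pw]]
                |/and4P[/eqP<- pw _ ud]|/and3P[/eqP-> /eqP-> /andP[/eqP<- pk]]].
    + by split=> //; rewrite addn0 pw.
    + by split=> //; rewrite pw andbT /updown; case/orP: ud => ->; rewrite ?orbT.
    + by split=> //; rewrite pk orbT.
  case=> -[<-] /orP[/andP[ud pw]|/and3P[/eqP-> /eqP-> pk]]; last first.
    by rewrite pk !eqxx !orbT.
  have /= hd := pathok_head pw; rewrite /= in pw *.
  have [/andP[/eqP c00 /eqP c10]|c01] := boolP ((c0 == 0) && (c1 == 0))%N.
    by rewrite c00 c10 addn0 in pw *; rewrite pw !eqxx.
  have ud' : ((c0 == c1.+1) || (c1 == c0.+1))%N.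
    by move: ud; rewrite /updown (negPf c01) orbF.
  rewrite pw ud' eqxx; have -> : (minn c0 c1 < (size t).+1)%N by lia.
  by rewrite !orbT.
Qed.

(** The conventional values for one and two generators are those that extend the formula to n = 0
    and n = 1. *)
Lemma D_FC_E n : D_FC n.+1 =
  path_gf n 0 + \sum_(j < n) 2%:R * path_gf n (j + j).+1 + peak_gf n.
Proof.
case: n => [|[|n]]; last exact: D_gf_E.
  by rewrite big_ord0 path_gf0 peak_gf0 !addr0.
rewrite big_ord1 /= !path_gfS peak_gfS !path_gf0 peak_gf0 /=.
by rewrite /D_FC; ring.
Qed.

(** * Generating series *)

Section SeriesCoef.
Variable R : comUnitRingType.
Implicit Types f g : fps R.

Lemma fps_coefD f g n : fps_coef (f + g) n = fps_coef f n + fps_coef g n.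
Proof. by []. Qed.

Lemma fps_coef1 n : fps_coef (1 : fps R) n = (n == 0%N)%:R.
Proof. by []. Qed.

Lemma fps_coefCM (c : R) f n : fps_coef (fpsC c * f) n = c * fps_coef f n.
Proof.
rewrite /= big_ord_recl /= subn0 big1 ?addr0 // => i _.
by rewrite /= mul0r.
Qed.

Lemma fps_coefXM f n : fps_coef (fpsX R * f) n = if n is m.+1 then fps_coef f m else 0.
Proof.
case: n => [|n]; first by rewrite /= big_ord1 /= mul0r.
rewrite /= big_ord_recl /= mul0r add0r big_ord_recl /= mul1r subSS subn0.
by rewrite big1 ?addr0 // => i _; rewrite mul0r.
Qed.

Lemma fpsCM (a b : R) : fpsC (a * b) = fpsC a * fpsC b.
Proof.
apply: fpsP => n; rewrite fps_coefCM /=; case: eqP => // _; by rewrite mulr0.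
Qed.

Lemma fpsCX (a : R) n : fpsC (a ^+ n) = fpsC a ^+ n.
Proof.
elim: n => [|n IHn]; last by rewrite !exprS fpsCM IHn.
by rewrite !expr0; apply: fpsP => k /=; case: eqP.
Qed.

End SeriesCoef.

Section Series.

Local Notation x := (fpsX (fps rat)).
Local Notation Q := (fpsC q).
Local Notation J := J_series.
Local Notation qp k := (qpoch2 (q ^+ 2) k).

Lemma qpochS k : qp k.+1 = qp k * (1 - q ^+ (2 * k.+1)%N).
Proof. by rewrite /qpoch2 big_ord_recr /= -exprD -mulnS. Qed.

Lemma qpoch_step_unit k : 1 - q ^+ (2 * k.+1)%N \is a GRing.unit.
Proof. by have := qpoch2_unit k.+1; rewrite qpochS unitrM => /andP[]. Qed.

Lemma qpoch_inv k : (qp k)^-1 = (1 - q ^+ (2 * k.+1)%N) / qp k.+1.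
Proof. by rewrite qpochS invrM ?qpoch2_unit ?qpoch_step_unit // mulrA mulrV ?qpoch_step_unit // mul1r. Qed.

Definition path_series h : fps (fps rat) := Fps (fun m => path_gf m h).
Definition peak_series : fps (fps rat) := Fps peak_gf.

Lemma path_series0 : path_series 0 = 1 + x * (path_series 0 + path_series 1).
Proof.
apply: fpsP => -[|n]; rewrite fps_coefD fps_coefXM fps_coef1 /=; first by rewrite path_gf0 addr0.
by rewrite path_gfS expr0 mul1r add0r.
Qed.

Lemma path_seriesS h : path_series h.+1 =
  x * (fpsC (q ^+ h.+1) * (path_series h + path_series h.+2)).
Proof.
by apply: fpsP => -[|n]; rewrite fps_coefXM ?fps_coefCM /= ?path_gf0 ?path_gfS.
Qed.

Lemma peak_series_rec :
  peak_series = x * (fpsC (q ^+ 2) * (path_series 0 + path_series 2 + peak_series)).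
Proof.
by apply: fpsP => -[|n]; rewrite fps_coefXM ?fps_coefCM /= ?peak_gf0 ?peak_gfS.
Qed.

Definition num_coef n k := (-1) ^+ k * q ^+ 'C(n.+1, 2) / qp k.

(* The decaying solution of the recurrence satisfied by [path_series]; it is
   found by substituting x^h q^'C(h+1, 2) g(x q^h) for the h-th term. *)
Definition num_series h : fps (fps rat) :=
  Fps (fun n => if (h <= n)%N && ~~ odd (n - h) then num_coef n (n - h)./2 else 0).

Lemma binS2 n : 'C(n.+2, 2) = (n.+1 + 'C(n.+1, 2))%N.
Proof. by rewrite binS bin1 addnC. Qed.

(** With P_k = (q^2;q^2)_k, the identity 1/P_k - 1/P_(k-1) = q^(2k)/P_k supplies the part q^(2k) of
    the factor q^(h+2k+1) gained by the binomial exponent. *)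
Lemma num_coef_rec h k : num_coef (h + k.*2).+1 k =
  q ^+ h.+1 * (num_coef (h + k.*2) k + (if k is j.+1 then num_coef (h + k.*2) j else 0)).
Proof.
rewrite /num_coef binS2 exprD -addSn exprD; case: k => [|k].
  by rewrite addr0 expr0 double0 mulr1; ring.
rewrite (qpoch_inv k) -mul2n exprS; ring.
Qed.

Lemma num_seriesS h : num_series h.+1 =
  x * (fpsC (q ^+ h.+1) * (num_series h + num_series h.+2)).
Proof.
apply: fpsP => -[|n]; rewrite fps_coefXM // fps_coefCM fps_coefD /= ltnS subSS.
have [hn|nh] := leqP h n; last first.
  have -> : (h.+1 < n)%N = false by lia.
  by rewrite /= addr0 mulr0.
have [k [nE|nE]] : exists k, n = (h + k.*2)%N \/ n = (h + k.*2).+1.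
  by exists (n - h)./2; lia.
- have -> : (n - h)%N = k.*2 by lia.
  rewrite odd_double doubleK nE num_coef_rec /=; congr (_ * (_ + _)).
  case: k nE => [|k] nE; first by rewrite ifF //; apply/negbTE; lia.
  have -> : (h + k.+1.*2 - h.+2)%N = k.*2 by lia.
  rewrite odd_double doubleK ifT //; lia.
- have -> : odd (n - h) by rewrite nE; lia.
  rewrite /= [X in _ * (0 + X)]ifF ?addr0 ?mulr0 //; apply/negbTE; lia.
Qed.

(** This is the origin of J: the decaying solution satisfies the boundary equation of [path_series]
    with J in place of 1. *)
Lemma num_series0 : num_series 0 = J + x * (num_series 0 + num_series 1).
Proof.
apply: fpsP => -[|n]; rewrite fps_coefD fps_coefXM ?fps_coefD /= ?subn0.
  by rewrite /num_coef !addr0.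
have [k [nE|nE]] : exists k, n = k.*2 \/ n = k.*2.+1 by exists n./2; lia.
  rewrite nE /= odd_double /= doubleK uphalf_double.
  have -> : (0 < k.*2)%N && ~~ odd (k.*2 - 1) = false by lia.
  rewrite /num_coef exprS addr0; ring.
have -> : ~~ odd n.+1 = true by lia.
have -> : ~~ odd n = false by lia.
have -> : (0 < n)%N && ~~ odd (n - 1) = true by lia.
have -> : uphalf n = k.+1 by lia.
have -> : n./2 = k by lia.
have -> : (n - 1)./2 = k by lia.
rewrite /= add0r /num_coef binS2 exprD (qpoch_inv k) exprS.
have -> : n.+1 = (2 * k.+1)%N by lia.
ring.
Qed.

(** The differences satisfy a homogeneous system whose right-hand sides all carry a factor x, so
    their coefficients vanish by induction on the degree, for all h at once. *)
Lemma J_path_series h : J * path_series h = num_series h.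
Proof.
pose d h := J * path_series h - num_series h.
have d0 : d 0 = x * (d 0 + d 1).
  rewrite /d {1}path_series0 {1}num_series0; ring.
have dS k : d k.+1 = x * (fpsC (q ^+ k.+1) * (d k + d k.+2)).
  rewrite /d {1}path_seriesS {1}num_seriesS; ring.
suff dE n k : fps_coef (d k) n = 0.
  by apply/eqP; rewrite -subr_eq0; apply/eqP/fpsP => n; apply: dE.
elim: n k => [|n IHn] [|k]; [by rewrite d0 fps_coefXM|by rewrite dS fps_coefXM|..].
  by rewrite d0 fps_coefXM fps_coefD !IHn addr0.
by rewrite dS fps_coefXM fps_coefCM fps_coefD !IHn addr0 mulr0.
Qed.

Lemma path_seriesE h : path_series h = num_series h / J.
Proof. by rewrite -J_path_series mulrAC divrr ?J_series_unit // mul1r. Qed.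

Lemma num_series01 : num_series 0 + num_series 1 = fps_dilate (- q) J.
Proof.
apply: fpsP => n; rewrite fps_coefD /= subn0.
have bE : 'C(n.+1, 2) = (n + 'C(n, 2))%N by rewrite binS bin1 addnC.
have [k [nE|nE]] : exists k, n = k.*2 \/ n = k.*2.+1 by exists n./2; lia.
  have -> : ~~ odd n by lia.
  have -> : (0 < n)%N && ~~ odd (n - 1) = false by lia.
  have -> : n./2 = k by lia.
  have -> : uphalf n = k by lia.
  rewrite addr0 /num_coef bE exprD [(- q) ^+ n]exprNn.
  have -> : (-1) ^+ n = 1 :> fps rat by rewrite -signr_odd nE odd_double.
  ring.
have -> : ~~ odd n = false by lia.
have -> : (0 < n)%N && ~~ odd (n - 1) by lia.
have -> : n./2 = k by lia.
have -> : uphalf n = k.+1 by lia.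
have -> : (n - 1)./2 = k by lia.
rewrite add0r /num_coef bE exprD [(- q) ^+ n]exprNn.
have -> : (-1) ^+ n = -1 :> fps rat by rewrite -signr_odd nE /= odd_double.
rewrite [(-1) ^+ k.+1]exprS; ring.
Qed.

Lemma A_seriesE : A_series = path_series 0 + path_series 1.
Proof. by apply: fpsP => n; rewrite fps_coefD /= A_FC_E. Qed.

Lemma A_seriesJ : A_series = fps_dilate (- q) J / J.
Proof. by rewrite A_seriesE !path_seriesE -mulrDl num_series01. Qed.

Definition sum_series : fps (fps rat) := Fps (fun n => \sum_(h < n.+1) path_gf n h).
Definition odd_series : fps (fps rat) := Fps (fun n => \sum_(j < n) path_gf n (j + j).+1).

(** J times a formally infinite sum over heights. As [path_gf m h] vanishes for h > m, the bound b m
    loses nothing, and by monotonicity all degrees up to n can share the bound b n. *)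
Lemma J_sum_coef (e b : nat -> nat) : (forall m j, b m <= j -> m < e j)%N ->
  (forall m n, m <= n -> b m <= b n)%N -> forall n,
  fps_coef (J * Fps (fun m => \sum_(j < b m) path_gf m (e j))) n =
  \sum_(j < b n) fps_coef (num_series (e j)) n.
Proof.
move=> be bm n; under [RHS]eq_bigr do rewrite -J_path_series.
transitivity (\sum_(i < n.+1) \sum_(j < b n) fps_coef J i * path_gf (n - i) (e j)).
  apply: eq_bigr => i _; rewrite -mulr_sumr; congr (_ * _) => /=.
  rewrite (big_ord_widen (b n) (fun j => path_gf (n - i) (e j))) ?bm ?leq_subr //.
  rewrite big_mkcond; apply: eq_bigr => j _; case: ltnP => // bj.
  by rewrite path_gf_gt ?be.
by rewrite exchange_big.
Qed.

Lemma sum_even_indices (a : nat -> fps rat) n :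
  \sum_(i < n.+1) (if ~~ odd i then a i./2 else 0) = \sum_(k < n./2.+1) a k.
Proof.
elim: n => [|n IHn]; first by rewrite !big_ord1.
rewrite big_ord_recr IHn /=; case on: (odd n) => /=.
  have -> : uphalf n = n./2.+1 by lia.
  by rewrite [RHS]big_ord_recr.
have -> : uphalf n = n./2 by lia.
by rewrite addr0.
Qed.

Lemma J_sum_series : J * sum_series = K_series.
Proof.
apply: fpsP => n; rewrite (J_sum_coef (e := id) (b := succn)) //=.
rewrite (reindex_inj rev_ord_inj) /=.
pose a k := (-1) ^+ k / qp k : fps rat.
transitivity (q ^+ 'C(n.+1, 2) * \sum_(i < n.+1) (if ~~ odd i then a i./2 else 0)).
  rewrite mulr_sumr; apply: eq_bigr => i _; rewrite subSS leq_subr subKn -1?ltnS //=.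
  by case: ifP => _; rewrite ?mulr0 // /num_coef /a; ring.
by rewrite sum_even_indices big_mkord.
Qed.

(** For odd h, [num_series h] has only odd powers of x, so after the shift by x only the even part
    of K occurs. The exponent C(n+2, 2) = (n+1) + C(n+1, 2) accounts for the dilation by q and the
    factor q. *)
Lemma J_odd_series :
  J * (2%:R * odd_series) = x * (Q * fps_dilate q (K_series + fps_dilate (-1) K_series)).
Proof.
apply: fpsP => n.
have -> : 2%:R * odd_series = Fps (fun m => \sum_(j < m) path_gf m (j + j).+1) *+ 2.
  by rewrite mulr_natl.
rewrite mulrnAr mulr2n fps_coefD (J_sum_coef (e := fun j => (j + j).+1) (b := id)) //; last first.
  by move=> m j; lia.
rewrite fps_coefXM; case: n => [|n]; first by rewrite big_ord0 addr0.
rewrite fps_coefCM /=.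
have [k [nE|nE]] : exists k, n = k.*2 \/ n = k.*2.+1 by exists n./2; lia.
  have -> : (-1) ^+ n = 1 :> fps rat by rewrite -signr_odd nE odd_double.
  have -> : \sum_(j < n.+1) fps_coef (num_series (j + j).+1) n.+1 =
    q ^+ n.+1 * fps_coef K_series n.
    have lekn : (k.+1 <= n.+1)%N by lia.
    transitivity (\sum_(j < n.+1 | (j < k.+1)%N) num_coef n.+1 (k - j)).
      rewrite [RHS]big_mkcond; apply: eq_bigr => j _ /=; rewrite subSS ltnS ltnS.
      have -> : (j + j <= n)%N = (j <= k)%N by lia.
      case: leqP => //= jk; have -> : ~~ odd (n - (j + j)) by lia.
      by congr (num_coef _ _); lia.
    rewrite -(big_ord_widen _ (fun j => num_coef n.+1 (k - j)) lekn).
    rewrite (reindex_inj rev_ord_inj) /= big_mkord.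
    have -> : n./2 = k by lia.
    rewrite mulrA -exprD -binS2 mulr_sumr; apply: eq_bigr => j _.
    have -> : (k - (k.+1 - j.+1))%N = j by have := ltn_ord j; lia.
    rewrite /num_coef; ring.
  rewrite mul1r /= exprS; ring.
have -> : (-1) ^+ n = -1 :> fps rat by rewrite -signr_odd nE /= odd_double.
rewrite mulN1r subrr !mulr0 big1 ?addr0 // => j _ /=.
by rewrite ifF //; apply/negbTE; lia.
Qed.

Lemma J_divK f g : J * f = g -> g / J = f.
Proof. by move=> <-; rewrite mulrAC divrr ?J_series_unit // mul1r. Qed.

Lemma path_series0A : path_series 0 = 1 + x * A_series.
Proof. by rewrite {1}path_series0 -A_seriesE. Qed.

Lemma path_series1A : path_series 1 = A_series * (1 - x) - 1.
Proof.
have -> : path_series 1 = A_series - path_series 0 by rewrite A_seriesE; ring.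
rewrite path_series0A; ring.
Qed.

(** The recurrence is geometric of ratio xq^2, and its source term xq^2 (F_0 + F_2) equals q F_1 by
    the recurrence for F_1. *)
Lemma peak_seriesE : peak_series = Q * path_series 1 / (1 - x * Q ^+ 2).
Proof.
have uU : 1 - x * Q ^+ 2 \is a GRing.unit by apply: geometric_unit.
apply: (mulIr uU); rewrite divrK // path_seriesS mulrBr mulr1.
rewrite {1}peak_series_rec !fpsCX expr1; ring.
Qed.

Lemma B_seriesE : B_series = sum_series + x * (Q * peak_series).
Proof.
apply: fpsP => n; rewrite fps_coefD fps_coefXM.
have -> : fps_coef B_series n = B_FC n by [].
by rewrite B_FC_E; case: n => [//|n]; rewrite fps_coefCM.
Qed.

Lemma D_seriesE : D_series = path_series 0 + 2%:R * odd_series + peak_series.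
Proof.
apply: fpsP => n; rewrite !fps_coefD.
have -> : fps_coef D_series n = D_FC n.+1 by [].
rewrite D_FC_E; congr (_ + _ + _); rewrite mulr_natl mulr2n fps_coefD -big_split.
by apply: eq_bigr => j _; rewrite mulrDl mul1r.
Qed.

Lemma Ke_seriesE : 2%:R * x * Q * fps_dilate q Ke_series / J = 2%:R * odd_series.
Proof.
apply: J_divK; rewrite J_odd_series.
have -> : fps_dilate q (K_series + fps_dilate (-1) K_series) = fps_dilate q Ke_series *+ 2.
  have <- : Ke_series *+ 2 = K_series + fps_dilate (-1) K_series.
    by rewrite /Ke_series -[LHS]mulr_natl mulrA divrr ?two_unit // mul1r.
  apply: fpsP => n; rewrite !mulr2n; exact: mulrDr.
rewrite mulr2n; ring.
Qed.

End Series.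

Theorem theorem3p3 :
  let x : fps (fps rat) := fpsX (fps rat) in
  let Q : fps (fps rat) := fpsC q in
  let J : fps (fps rat) := J_series in
  let J_mxq : fps (fps rat) := fps_dilate (- q) J_series in
  let K : fps (fps rat) := K_series in
  let Ke_xq : fps (fps rat) := fps_dilate q Ke_series in
  [/\ A_series = J_mxq / J,
      B_series = K / J
        + x * Q ^+ 2 * (1 - x) / (1 - x * Q ^+ 2) * (J_mxq / J)
        - x * Q ^+ 2 / (1 - x * Q ^+ 2)
    & D_series = 2%:R * x * Q * Ke_xq / J
        + (Q + x * (1 - Q) - x ^+ 2 * Q ^+ 2) / (1 - x * Q ^+ 2) * (J_mxq / J)
        - Q / (1 - x * Q ^+ 2) + 1].
Proof.
move=> x Q J J_mxq K Ke_xq.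
have uV : (1 - x * Q ^+ 2) / (1 - x * Q ^+ 2) = 1 by rewrite divrr ?geometric_unit.
split; first exact: A_seriesJ.
  rewrite -A_seriesJ (J_divK J_sum_series) B_seriesE peak_seriesE path_series1A.
  rewrite -/x -/Q; ring.
rewrite -A_seriesJ Ke_seriesE D_seriesE peak_seriesE path_series1A path_series0A.
(* The term xA coming from F_0 is brought over the denominator 1 - xq^2, to be collected with the
   contribution of the peak series. *)
have -> : fpsX _ * A_series = x * A_series * ((1 - x * Q ^+ 2) / (1 - x * Q ^+ 2)).
  by rewrite uV mulr1.
rewrite -/x -/Q; ring.
Qed.
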